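(* Let $\lambda>0$, and let $\gamma$ be a real number that is not an odd negative integer. (i) If $\mu>0$, then, with $\delta=2\mu-\gamma$, $$S_{\mu,\gamma}(a;\lambda)-a^{1-\delta}\,\mathcal{H}(1)\sim a^{-2\mu}\sum_{k=0}^\infty \frac{(-1)^k(\mu)_k}{k!\,a^{2k}}\,\zeta(-2k-\gamma)\;{}_1F_1(-k;1-\mu-k;\lambda)$$ as $|a|\to\infty$ in the sector $|\arg a|<\pi/4$. (ii) If $\mu=0$, then $$S_{0,\gamma}(a;\lambda)-\frac12\left(\frac{a^2}{\lambda}\right)^{(\gamma+1)/2}\Gamma\left(\frac{\gamma+1}{2}\right)\sim\sum_{k=0}^\infty\frac{(-\lambda)^k}{k!\,a^{2k}}\,\zeta(-2k-\gamma)$$ as $|a|\to\infty$ in the sector $|\arg a|<\pi/4$.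
   Context: For real $\gamma$, $\mu\ge 0$, $\lambda>0$ and complex $a$ with $|\arg a|<\pi/4$, $$S_{\mu,\gamma}(a;\lambda):=\sum_{n=1}^\infty\frac{n^\gamma e^{-\lambda n^2/a^2}}{(n^2+a^2)^\mu}.$$ All powers take their principal values (positive for positive $a$); in particular $(a^2/\lambda)^{(\gamma+1)/2}=a^{\gamma+1}\lambda^{-(\gamma+1)/2}$. The constant $\mathcal{H}(1)$ is $$\mathcal{H}(1)=\tfrac12\,\Gamma\left(\tfrac{1+\gamma}{2}\right)U\left(\tfrac{1+\gamma}{2},\,1+\tfrac{1+\gamma}{2}-\mu,\,\lambda\right),$$ where $U(\alpha,\beta,z)$ is the confluent hypergeometric function of the second kind (Tricomi's function). $\zeta$ is the Riemann zeta function and $(x)_k=x(x+1)\cdots(x+k-1)$, $(x)_0=1$. The function ${}_1F_1(-k;1-\mu-k;\lambda)$ is the terminating series $\sum_{n=0}^k\frac{(-k)_n}{(1-\mu-k)_n}\frac{\lambda^n}{n!}$. The symbol $\sim$ denotes an asymptotic expansion in the Poincaré sense: for every $N\ge 0$, the difference between the left-hand side and the sum of the terms $0\le k<N$ on the right is $O(|a|^{-2\mu-2N})$ (with $\mu=0$ in (ii)) as $|a|\to\infty$, uniformly in each closed subsector $|\arg a|\le \pi/4-\epsilon$, $\epsilon>0$. *)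

(* Defs.v *)
From Stdlib Require Export Reals Factorial.
From Stdlib Require Import Epsilon.
From Coquelicot Require Export Coquelicot.

Open Scope R_scope.

(** * Elementary complex functions, principal branches *)

Definition Cexp (z : C) : C :=
  (exp (Re z) * cos (Im z), exp (Re z) * sin (Im z)).

(** Principal argument, in (-PI, PI] for [z <> 0]. *)
Definition Carg (z : C) : R :=
  if Rlt_dec (Im z) 0 then - acos (Re z / Cmod z) else acos (Re z / Cmod z).

Definition Cln (z : C) : C := (ln (Cmod z), Carg z).

(** Principal value of [z ^ w], meaningful for [z <> 0]; Coquelicot's [Cpow]
    only has natural exponents. *)
Definition Cpower (z w : C) : C := Cexp (w * Cln z)%C.

Definition CSeries (u : nat -> C) : C :=
  (Series (fun n => Re (u n)), Series (fun n => Im (u n))).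

(** [Csum u N] is the sum of [u k] over [0 <= k < N] (empty for [N = 0],
    unlike [sum_n]). *)
Fixpoint Csum (u : nat -> C) (N : nat) : C :=
  match N with
  | O => RtoC 0
  | S M => (Csum u M + u M)%C
  end.

(** * Special functions *)

Fixpoint poch (x : R) (k : nat) : R :=
  match k with
  | O => 1
  | S j => poch x j * (x + INR j)
  end.

(** Terminating series 1F1(-k; b; z). *)
Definition hyp1F1_neg (k : nat) (b z : R) : R :=
  sum_f_R0 (fun n => poch (- INR k) n / poch b n * (z ^ n / INR (fact n))) k.

(** The least [n] with [x + INR n > 0]. *)
Definition shift_to_pos (x : R) : nat := Z.to_nat (up (- x)).

(** Euler's integral for [x > 0], continued to [x <= 0], [x] not an integer, by
    Gamma x = Gamma (x + 1) / x. *)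
Definition Gamma_integral (x : R) : R :=
  RInt_gen (fun t => Rpower t (x - 1) * exp (- t))
           (at_right 0) (Rbar_locally p_infty).

Fixpoint Gamma_shift (n : nat) (x : R) : R :=
  match n with
  | O => Gamma_integral x
  | S m => Gamma_shift m (x + 1) / x
  end.

Definition Gamma (x : R) : R := Gamma_shift (shift_to_pos x) x.

(** Tricomi's function U(a, b, z) for [z > 0] and real [a], [b]: the Laplace
    integral for [a > 0], continued to [a <= 0] by the contiguous relation
    U(a, b, z) = z U(a + 1, b + 1, z) - (b - a - 1) U(a + 1, b, z)
    (which for [a > 0] is an integration by parts). *)
Definition tricomiU_integral (a b z : R) : R :=
  / Gamma a *
  RInt_gen (fun t => exp (- z * t) * Rpower t (a - 1) * Rpower (1 + t) (b - a - 1))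
           (at_right 0) (Rbar_locally p_infty).

Fixpoint tricomiU_shift (n : nat) (a b z : R) : R :=
  match n with
  | O => tricomiU_integral a b z
  | S m => z * tricomiU_shift m (a + 1) (b + 1) z
           - (b - a - 1) * tricomiU_shift m (a + 1) b z
  end.

Definition tricomiU (a b z : R) : R := tricomiU_shift (shift_to_pos a) a b z.

Definition analytic_at (f : C -> C) (z : C) : Prop :=
  exists (c : nat -> C) (r : R), 0 < r /\
    forall h : C, Cmod h < r -> is_pseries c h (f (z + h)%C).

(** The analytic continuation to C \ {1} of the Dirichlet series.  It is unique
    there; the value at 1 is left unspecified. *)
Definition is_riemann_zeta (Z : C -> C) : Prop :=
  (forall s : C, 1 < Re s ->
     is_series (fun n => Cpower (RtoC (INR (S n))) (- s)%C) (Z s)) /\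
  (forall s : C, s <> RtoC 1 -> analytic_at Z s).

Definition zeta : C -> C := epsilon (inhabits (fun _ => RtoC 0)) is_riemann_zeta.

(** * The sum and its expansion *)

(** The summation index n = 1, 2, ... is [S j]. *)
Definition S_sum (mu gamma : R) (a : C) (lambda : R) : C :=
  CSeries (fun j =>
    let n := INR (S j) in
    (RtoC (Rpower n gamma) * Cexp (- (RtoC (lambda * n ^ 2) / a ^ 2))
     / Cpower (RtoC (n ^ 2) + a ^ 2) (RtoC mu))%C).

Definition H1 (mu gamma lambda : R) : R :=
  / 2 * Gamma ((1 + gamma) / 2)
  * tricomiU ((1 + gamma) / 2) (1 + (1 + gamma) / 2 - mu) lambda.

(** Poincare-type expansion f(a) ~ sum_k t_k(a) as |a| -> oo in |arg a| < PI/4,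
    the remainder after [N] terms being O(|a|^(-2 mu - 2 N)) uniformly in each
    closed subsector |arg a| <= PI/4 - eps. *)
Definition sector_expansion (mu : R) (f : C -> C) (t : nat -> C -> C) : Prop :=
  forall (N : nat) (eps : R), 0 < eps ->
  exists K R0 : R, 0 < R0 /\
    forall a : C, R0 <= Cmod a -> Rabs (Carg a) <= PI / 4 - eps ->
      Cmod (f a - Csum (fun k => t k a) N)%C
      <= K * Rpower (Cmod a) (- 2 * mu - 2 * INR N).

(* Main.v *)
(** Since (1 + w)^(-mu) = Gamma(mu)^(-1) * int_0^oo t^(mu-1) e^(-t) e^(-t w) dt for Re w > 0, the sum
    for mu > 0 is a^(-2 mu) times the average, over a Gamma(mu)-distributed t, of the sum
    theta(z) = sum n^gamma e^(-z n^2) at z = (lambda + t) / a^2.  Everything thus follows from the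
    expansion of theta as z -> 0 in a sector |arg z| <= pi/2 - eps, with a remainder
    O(|z|^N (1 + |z|)^p) that can be integrated in t.

    A primitive of x^gamma e^(-z x^2) is the incomplete gamma series
    sum_k (-z)^k x^(gamma+2k+1) / (k! (gamma+2k+1)).  It tends to the main term of theta at infinity,
    and each of its terms is the primitive of a power, whose Euler-Maclaurin regularized sum is a
    value of zeta.  The remainder is the Euler-Maclaurin sum of the primitive minus its first N terms,
    whose high derivatives are O(|z|^N x^(-p)) uniformly in the sector.  No Bernoulli periodic
    functions are needed: Taylor's formula on [n, n+1] suffices.

    The same regularized sum, for complex exponents, yields the continuation of zeta; power series
    at each point come from Cauchy's estimate (averaging over roots of unity), and the continuation
    is unique by the identity theorem along a segment avoiding 1. *)

From Stdlib Require Import ZArith Lra Lia Psatz Epsilon.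
Require Import Defs.
Open Scope R_scope.

(** * Limits and series of complex numbers *)

Fixpoint Rsum (b : nat -> R) (N : nat) : R :=
  match N with O => 0 | S M => Rsum b M + b M end.

Definition Clim (u : nat -> C) (l : C) : Prop :=
  is_lim_seq (fun n => Cmod (u n - l)%C) 0.

Definition Rser (b : nat -> R) (l : R) : Prop := is_lim_seq (Rsum b) l.
Definition Cser (u : nat -> C) (l : C) : Prop := Clim (Csum u) l.

Lemma C_ext (a b : C) : Re a = Re b -> Im a = Im b -> a = b.
Proof. destruct a, b; simpl; intros; subst; reflexivity. Qed.

Lemma im_le_Cmod (c : C) : Rabs (Im c) <= Cmod c.
Proof. eapply Rle_trans; [apply Rmax_r | apply (Rmax_Cmod c)]. Qed.

Lemma Cmod_le_parts (c : C) : Cmod c <= Rabs (Re c) + Rabs (Im c).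
Proof.
  destruct c as [x y].
  replace ((x, y) : C) with (RtoC x + Ci * RtoC y)%C
    by (apply C_ext; simpl; ring).
  eapply Rle_trans; [apply Cmod_triangle|].
  rewrite Cmod_mult, Cmod_Ci, !Cmod_R; simpl.
  apply Req_le; f_equal; [f_equal; ring|].
  rewrite Rmult_1_l; f_equal; ring.
Qed.

Lemma Cmod_minus_sym (a b : C) : Cmod (a - b)%C = Cmod (b - a)%C.
Proof. rewrite <- (Cmod_opp (a - b)); f_equal; ring. Qed.

Lemma Cmod_minus_le (a b : C) : Cmod (a - b)%C <= Cmod a + Cmod b.
Proof. unfold Cminus; eapply Rle_trans; [apply Cmod_triangle|]; rewrite Cmod_opp; lra. Qed.

Lemma Cmod_minus_tri (a b c : C) : Cmod (a - c)%C <= Cmod (a - b)%C + Cmod (b - c)%C.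
Proof. replace (a - c)%C with ((a - b) + (b - c))%C by ring; apply Cmod_triangle. Qed.

Lemma Cmod_rev_tri (a b : C) : Rabs (Cmod a - Cmod b) <= Cmod (a - b)%C.
Proof.
  apply Rabs_le; split.
  - pose proof (Cmod_triangle (b - a) a) as H.
    replace (b - a + a)%C with b in H by ring. rewrite Cmod_minus_sym in H. lra.
  - pose proof (Cmod_triangle (a - b) b) as H.
    replace (a - b + b)%C with a in H by ring. lra.
Qed.

Lemma Rle_eps_eq0 (x : R) : 0 <= x -> (forall e, 0 < e -> x <= e) -> x = 0.
Proof.
  intros H0 H. destruct (Rle_lt_or_eq_dec 0 x H0) as [Hp|]; [|auto].
  specialize (H (x / 2)). lra.
Qed.

Lemma lim0_squeeze (u v : nat -> R) :
  (forall n, 0 <= u n <= v n) -> is_lim_seq v 0 -> is_lim_seq u 0.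
Proof.
  intros H Hv. apply is_lim_seq_le_le with (u := fun _ => 0) (w := v); auto.
  apply is_lim_seq_const.
Qed.

Lemma lim0_mult_const (c : R) (u : nat -> R) :
  is_lim_seq u 0 -> is_lim_seq (fun n => c * u n) 0.
Proof.
  intros H. replace 0 with (c * 0) by ring.
  apply (is_lim_seq_scal_l u c 0 H).
Qed.

Lemma lim_seq_plus (u v : nat -> R) (a b : R) :
  is_lim_seq u a -> is_lim_seq v b -> is_lim_seq (fun n => u n + v n) (a + b).
Proof. intros; now apply is_lim_seq_plus'. Qed.

Lemma lim0_plus (u v : nat -> R) :
  is_lim_seq u 0 -> is_lim_seq v 0 -> is_lim_seq (fun n => u n + v n) 0.
Proof. intros. replace 0 with (0 + 0) by ring. now apply is_lim_seq_plus'. Qed.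

Lemma lim_seq_le_const (u : nat -> R) (l M : R) :
  is_lim_seq u l -> (forall n, u n <= M) -> l <= M.
Proof.
  intros H H1.
  apply (is_lim_seq_le u (fun _ => M) l M H1 H (is_lim_seq_const M)).
Qed.

Lemma is_lim_seq_eps (u : nat -> R) (l : R) :
  is_lim_seq u l <->
  (forall e, 0 < e -> exists N, forall n, (N <= n)%nat -> Rabs (u n - l) < e).
Proof.
  rewrite <- is_lim_seq_spec. split.
  - intros H e He. exact (H (mkposreal e He)).
  - intros H e. exact (H e (cond_pos e)).
Qed.

Lemma Clim_eps (u : nat -> C) (l : C) :
  Clim u l <->
  (forall e, 0 < e -> exists N, forall n, (N <= n)%nat -> Cmod (u n - l)%C < e).
Proof.
  unfold Clim. rewrite is_lim_seq_eps.
  split; intros H e He; destruct (H e He) as [N HN]; exists N; intros n Hn;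
    specialize (HN n Hn); rewrite Rminus_0_r in *.
  - now rewrite Rabs_pos_eq in HN by apply Cmod_ge_0.
  - now rewrite Rabs_pos_eq by apply Cmod_ge_0.
Qed.

Lemma Clim_squeeze (u : nat -> C) (l : C) (v : nat -> R) :
  (forall n, Cmod (u n - l)%C <= v n) -> is_lim_seq v 0 -> Clim u l.
Proof.
  intros H Hv. apply lim0_squeeze with v; auto.
  intros n; split; [apply Cmod_ge_0 | apply H].
Qed.

Lemma lim_seq_squeeze (u : nat -> R) (l : R) (v : nat -> R) :
  (forall n, Rabs (u n - l) <= v n) -> is_lim_seq v 0 -> is_lim_seq u l.
Proof.
  intros H Hv.
  apply is_lim_seq_ext with (fun n => l + (u n - l)); [intros; ring|].
  replace (Finite l) with (Finite (l + 0)) by (f_equal; ring).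
  apply lim_seq_plus; [apply is_lim_seq_const|].
  apply is_lim_seq_abs_0, lim0_squeeze with v; auto.
  intros n; split; [apply Rabs_pos | apply H].
Qed.

Lemma Clim_Re (u : nat -> C) (l : C) : Clim u l -> is_lim_seq (fun n => Re (u n)) (Re l).
Proof.
  intros H. apply lim_seq_squeeze with (fun n => Cmod (u n - l)%C); auto.
  intros n. apply Rle_trans with (2 := re_le_Cmod _). apply Req_le; f_equal; simpl; ring.
Qed.

Lemma Clim_Im (u : nat -> C) (l : C) : Clim u l -> is_lim_seq (fun n => Im (u n)) (Im l).
Proof.
  intros H. apply lim_seq_squeeze with (fun n => Cmod (u n - l)%C); auto.
  intros n. apply Rle_trans with (2 := im_le_Cmod _). apply Req_le; f_equal; simpl; ring.
Qed.

Lemma Clim_parts (u : nat -> C) (l : C) :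
  is_lim_seq (fun n => Re (u n)) (Re l) -> is_lim_seq (fun n => Im (u n)) (Im l) -> Clim u l.
Proof.
  intros H1 H2.
  apply Clim_squeeze with (fun n => Rabs (Re (u n) - Re l) + Rabs (Im (u n) - Im l)).
  - intros n. eapply Rle_trans; [apply Cmod_le_parts|]. apply Rle_refl.
  - apply lim0_plus; apply -> is_lim_seq_abs_0.
    + replace (Finite 0) with (Finite (Re l - Re l)) by (f_equal; ring).
      apply is_lim_seq_minus'; auto using is_lim_seq_const.
    + replace (Finite 0) with (Finite (Im l - Im l)) by (f_equal; ring).
      apply is_lim_seq_minus'; auto using is_lim_seq_const.
Qed.

Lemma Clim_ext (u v : nat -> C) (l : C) : (forall n, u n = v n) -> Clim u l -> Clim v l.
Proof. intros E; apply is_lim_seq_ext; intros; now rewrite E. Qed.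

Lemma Clim_const (c : C) : Clim (fun _ => c) c.
Proof.
  apply Clim_squeeze with (fun _ => 0); [|apply is_lim_seq_const].
  intros _. replace (c - c)%C with (RtoC 0) by ring. rewrite Cmod_0; lra.
Qed.

Lemma Clim_RtoC (s : nat -> R) (x : R) : is_lim_seq s x -> Clim (fun n => RtoC (s n)) (RtoC x).
Proof. intros H. apply Clim_parts; simpl; auto. apply is_lim_seq_const. Qed.

Lemma Clim_plus (u v : nat -> C) (a b : C) :
  Clim u a -> Clim v b -> Clim (fun n => u n + v n)%C (a + b)%C.
Proof.
  intros H1 H2.
  apply Clim_squeeze with (fun n => Cmod (u n - a)%C + Cmod (v n - b)%C).
  - intros n. replace (u n + v n - (a + b))%C with ((u n - a) + (v n - b))%C by ring.
    apply Cmod_triangle.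
  - now apply lim0_plus.
Qed.

Lemma Clim_scal (c : C) (u : nat -> C) (a : C) :
  Clim u a -> Clim (fun n => c * u n)%C (c * a)%C.
Proof.
  intros H1. apply Clim_squeeze with (fun n => Cmod c * Cmod (u n - a)%C).
  - intros n. replace (c * u n - c * a)%C with (c * (u n - a))%C by ring.
    rewrite Cmod_mult; lra.
  - now apply lim0_mult_const.
Qed.

Lemma Clim_minus (u v : nat -> C) (a b : C) :
  Clim u a -> Clim v b -> Clim (fun n => u n - v n)%C (a - b)%C.
Proof.
  intros H1 H2. replace (a - b)%C with (a + (- (1)) * b)%C by ring.
  apply Clim_ext with (fun n => u n + (- (1)) * v n)%C; [intros; ring|].
  apply Clim_plus; auto. now apply Clim_scal.
Qed.

Lemma Clim_unique (u : nat -> C) (a b : C) : Clim u a -> Clim u b -> a = b.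
Proof.
  intros H1 H2.
  apply C_ext.
  - pose proof (is_lim_seq_unique _ _ (Clim_Re _ _ H1)) as E1.
    pose proof (is_lim_seq_unique _ _ (Clim_Re _ _ H2)) as E2. congruence.
  - pose proof (is_lim_seq_unique _ _ (Clim_Im _ _ H1)) as E1.
    pose proof (is_lim_seq_unique _ _ (Clim_Im _ _ H2)) as E2. congruence.
Qed.

Lemma Clim_incr (u : nat -> C) (l : C) : Clim (fun n => u (S n)) l <-> Clim u l.
Proof. unfold Clim. symmetry. apply (is_lim_seq_incr_1 (fun n => Cmod (u n - l)%C)). Qed.

Lemma Clim_Cmod (u : nat -> C) (l : C) :
  Clim u l -> is_lim_seq (fun n => Cmod (u n)) (Cmod l).
Proof.
  intros H. apply lim_seq_squeeze with (2 := H). intros n. apply Cmod_rev_tri.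
Qed.

Lemma Clim_Cmod_le (u : nat -> C) (l : C) (M : R) :
  Clim u l -> (forall n, Cmod (u n) <= M) -> Cmod l <= M.
Proof. intros H H1. apply (lim_seq_le_const _ _ _ (Clim_Cmod _ _ H) H1). Qed.

Lemma Csum_ext (u v : nat -> C) N :
  (forall n, (n < N)%nat -> u n = v n) -> Csum u N = Csum v N.
Proof.
  induction N as [|N IH]; intros H; simpl; auto.
  rewrite IH, H; auto; intros; apply H; lia.
Qed.

Lemma Rsum_ext (u v : nat -> R) N :
  (forall n, (n < N)%nat -> u n = v n) -> Rsum u N = Rsum v N.
Proof.
  induction N as [|N IH]; intros H; simpl; auto.
  rewrite IH, H; auto; intros; apply H; lia.
Qed.

Lemma Csum_plus (u v : nat -> C) N :
  Csum (fun n => u n + v n)%C N = (Csum u N + Csum v N)%C.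
Proof. induction N as [|N IH]; simpl; [ring | rewrite IH; ring]. Qed.

Lemma Csum_minus (u v : nat -> C) N :
  Csum (fun n => u n - v n)%C N = (Csum u N - Csum v N)%C.
Proof. induction N as [|N IH]; simpl; [ring | rewrite IH; ring]. Qed.

Lemma Csum_scal (c : C) (u : nat -> C) N :
  Csum (fun n => c * u n)%C N = (c * Csum u N)%C.
Proof. induction N as [|N IH]; simpl; [ring | rewrite IH; ring]. Qed.

Lemma Csum_zero N : Csum (fun _ => RtoC 0) N = RtoC 0.
Proof. induction N as [|N IH]; simpl; [auto | rewrite IH; ring]. Qed.

Lemma Csum_exchange (u : nat -> nat -> C) N M :
  Csum (fun n => Csum (u n) M) N = Csum (fun m => Csum (fun n => u n m) N) M.
Proof.
  induction N as [|N IH]; simpl; [now rewrite Csum_zero|].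
  now rewrite IH, Csum_plus.
Qed.

Lemma Csum_S_l (u : nat -> C) N : Csum u (S N) = (u O + Csum (fun n => u (S n)) N)%C.
Proof. induction N as [|N IH]; [simpl; ring|]. change (Csum u (S (S N))) with (Csum u (S N) + u (S N))%C. rewrite IH; simpl; ring. Qed.

Lemma Csum_add (u : nat -> C) N M :
  Csum u (N + M) = (Csum u N + Csum (fun n => u (N + n)%nat) M)%C.
Proof.
  induction M as [|M IH]; [rewrite Nat.add_0_r; simpl; ring|].
  rewrite Nat.add_succ_r; simpl; rewrite IH; ring.
Qed.

Lemma Csum_telescope (u : nat -> C) N : Csum (fun n => u (S n) - u n)%C N = (u N - u O)%C.
Proof. induction N as [|N IH]; simpl; [ring | rewrite IH; ring]. Qed.

Lemma Re_Csum (u : nat -> C) N : Re (Csum u N) = Rsum (fun n => Re (u n)) N.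
Proof. induction N as [|N IH]; simpl; auto. unfold Re in *; rewrite IH; auto. Qed.

Lemma Im_Csum (u : nat -> C) N : Im (Csum u N) = Rsum (fun n => Im (u n)) N.
Proof. induction N as [|N IH]; simpl; auto. unfold Im in *; rewrite IH; auto. Qed.

Lemma Rsum_plus (u v : nat -> R) N : Rsum (fun n => u n + v n) N = Rsum u N + Rsum v N.
Proof. induction N as [|N IH]; simpl; [ring | rewrite IH; ring]. Qed.

Lemma Rsum_scal (c : R) (u : nat -> R) N : Rsum (fun n => c * u n) N = c * Rsum u N.
Proof. induction N as [|N IH]; simpl; [ring | rewrite IH; ring]. Qed.

Lemma Rsum_le (u v : nat -> R) N :
  (forall n, (n < N)%nat -> u n <= v n) -> Rsum u N <= Rsum v N.
Proof.
  induction N as [|N IH]; intros H; simpl; [lra|].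
  apply Rplus_le_compat; [apply IH; intros; apply H; lia | apply H; lia].
Qed.

Lemma Rsum_ge0 (u : nat -> R) N : (forall n, 0 <= u n) -> 0 <= Rsum u N.
Proof. intros H; induction N as [|N IH]; simpl; [lra | specialize (H N); lra]. Qed.

Lemma Csum_Cmod (u : nat -> C) (b : nat -> R) N :
  (forall n, (n < N)%nat -> Cmod (u n) <= b n) -> Cmod (Csum u N) <= Rsum b N.
Proof.
  induction N as [|N IH]; intros H; simpl; [rewrite Cmod_0; lra|].
  eapply Rle_trans; [apply Cmod_triangle|].
  apply Rplus_le_compat; [apply IH; intros; apply H; lia | apply H; lia].
Qed.

Lemma Csum_tail_Cmod (u : nat -> C) (b : nat -> R) N M :
  (forall n, Cmod (u n) <= b n) -> (N <= M)%nat ->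
  Cmod (Csum u M - Csum u N)%C <= Rsum b M - Rsum b N.
Proof.
  intros H L; induction L as [|M L IH].
  - replace (Csum u N - Csum u N)%C with (RtoC 0) by ring. rewrite Cmod_0; lra.
  - simpl. replace (Csum u M + u M - Csum u N)%C with ((Csum u M - Csum u N) + u M)%C by ring.
    eapply Rle_trans; [apply Cmod_triangle|]. specialize (H M). lra.
Qed.

Lemma Rsum_const (x : R) N : Rsum (fun _ => x) N = INR N * x.
Proof.
  induction N as [|N IH]; [simpl; ring|].
  change (Rsum ?f (S N)) with (Rsum f N + f N). rewrite IH, S_INR. ring.
Qed.

Lemma sum_f_R0_Rsum (f : nat -> R) m : sum_f_R0 f m = Rsum f (S m).
Proof.
  induction m as [|m IH]; [simpl; ring|].
  change (Rsum f (S (S m))) with (Rsum f (S m) + f (S m)). now rewrite <- IH.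
Qed.

Lemma Rser_bounded (b : nat -> R) (M : R) :
  (forall n, 0 <= b n) -> (forall n, Rsum b n <= M) -> exists l, Rser b l /\ l <= M.
Proof.
  intros H0 HM.
  destruct (ex_finite_lim_seq_incr (Rsum b) M) as [l Hl]; auto.
  - intros n; simpl; specialize (H0 n); lra.
  - exists l; split; auto. apply (lim_seq_le_const _ _ _ Hl HM).
Qed.

Lemma Rser_ge_sum (b : nat -> R) (l : R) N :
  (forall n, 0 <= b n) -> Rser b l -> Rsum b N <= l.
Proof.
  intros H0 H. apply (is_lim_seq_incr_compare (Rsum b) l H).
  intros n; simpl; specialize (H0 n); lra.
Qed.

Lemma Rser_comp (a b : nat -> R) (l : R) :
  (forall n, 0 <= a n <= b n) -> Rser b l -> exists l', Rser a l' /\ l' <= l.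
Proof.
  intros H Hb. apply Rser_bounded; [apply H|].
  intros n. apply Rle_trans with (Rsum b n).
  - apply Rsum_le; intros; apply H.
  - apply Rser_ge_sum; auto. intros k; specialize (H k); lra.
Qed.

Lemma Rser_scal (c : R) (b : nat -> R) l : Rser b l -> Rser (fun n => c * b n) (c * l).
Proof.
  intros H. apply is_lim_seq_ext with (fun n => c * Rsum b n).
  - intros; now rewrite Rsum_scal.
  - apply (is_lim_seq_scal_l _ c l H).
Qed.

Lemma Rser_plus (a b : nat -> R) l m :
  Rser a l -> Rser b m -> Rser (fun n => a n + b n) (l + m).
Proof.
  intros H1 H2. apply is_lim_seq_ext with (fun n => Rsum a n + Rsum b n).
  - intros; now rewrite Rsum_plus.
  - now apply lim_seq_plus.
Qed.

Lemma Rser_abs (a b : nat -> R) (l : R) :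
  (forall n, Rabs (a n) <= b n) -> Rser b l -> exists l', Rser a l'.
Proof.
  intros H Hb.
  destruct (Rser_comp (fun n => b n + -1 * a n) (fun n => 2 * b n) (2 * l)) as [s [Hs _]].
  - intros n; specialize (H n); apply Rabs_le_between in H; lra.
  - now apply Rser_scal.
  - exists (l + -1 * s).
    apply is_lim_seq_ext with (Rsum (fun n => b n + -1 * (b n + -1 * a n))).
    + intros n; apply Rsum_ext; intros; ring.
    + now apply Rser_plus; [|apply Rser_scal].
Qed.

Lemma Cser_abs (u : nat -> C) (b : nat -> R) (l : R) :
  (forall n, Cmod (u n) <= b n) -> Rser b l ->
  exists s, Cser u s /\ Cmod s <= l /\ (forall N, Cmod (s - Csum u N)%C <= l - Rsum b N).
Proof.
  intros H Hb.
  destruct (Rser_abs (fun n => Re (u n)) b l) as [x Hx]; auto.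
  { intros n; eapply Rle_trans; [apply re_le_Cmod | apply H]. }
  destruct (Rser_abs (fun n => Im (u n)) b l) as [y Hy]; auto.
  { intros n; eapply Rle_trans; [apply im_le_Cmod | apply H]. }
  assert (Hs : Cser u (x, y)).
  { apply Clim_parts; simpl.
    - eapply is_lim_seq_ext; [|apply Hx]. intros; now rewrite Re_Csum.
    - eapply is_lim_seq_ext; [|apply Hy]. intros; now rewrite Im_Csum. }
  assert (T : forall N, Cmod ((x, y) - Csum u N)%C <= l - Rsum b N).
  { intros N. pose proof (Clim_minus _ _ _ _ Hs (Clim_const (Csum u N))) as L.
    apply Clim_Cmod in L.
    refine (is_lim_seq_le_loc _ (fun n => Rsum b n - Rsum b N)
      (Cmod ((x, y) - Csum u N)%C) (l - Rsum b N) _ L _).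
    - exists N; intros n Hn. now apply Csum_tail_Cmod.
    - apply is_lim_seq_minus'; auto using is_lim_seq_const. }
  exists (x, y); split; [|split]; auto.
  specialize (T O). simpl in T. replace (Cmod (x, y)) with (Cmod ((x, y) - 0)%C); [lra|].
  f_equal; ring.
Qed.

Lemma Cser_unique (u : nat -> C) a b : Cser u a -> Cser u b -> a = b.
Proof. apply Clim_unique. Qed.

Lemma Cser_ext (u v : nat -> C) l : (forall n, u n = v n) -> Cser u l -> Cser v l.
Proof. intros E. apply Clim_ext. intros; now apply Csum_ext. Qed.

Lemma Cser_plus (u v : nat -> C) a b :
  Cser u a -> Cser v b -> Cser (fun n => u n + v n)%C (a + b)%C.
Proof.
  intros H1 H2. apply Clim_ext with (fun n => Csum u n + Csum v n)%C.
  - intros; now rewrite Csum_plus.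
  - now apply Clim_plus.
Qed.

Lemma Cser_minus (u v : nat -> C) a b :
  Cser u a -> Cser v b -> Cser (fun n => u n - v n)%C (a - b)%C.
Proof.
  intros H1 H2. apply Clim_ext with (fun n => Csum u n - Csum v n)%C.
  - intros; now rewrite Csum_minus.
  - now apply Clim_minus.
Qed.

Lemma Cser_scal (c : C) (u : nat -> C) a : Cser u a -> Cser (fun n => c * u n)%C (c * a)%C.
Proof.
  intros H1. apply Clim_ext with (fun n => c * Csum u n)%C.
  - intros; now rewrite Csum_scal.
  - now apply Clim_scal.
Qed.

Lemma Cser_zero : Cser (fun _ => RtoC 0) 0.
Proof. apply Clim_ext with (fun _ => RtoC 0); [intros; now rewrite Csum_zero | apply Clim_const]. Qed.

Lemma Cser_Csum (u : nat -> nat -> C) (s : nat -> C) M :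
  (forall m, (m < M)%nat -> Cser (u m) (s m)) ->
  Cser (fun n => Csum (fun m => u m n) M) (Csum s M).
Proof.
  induction M as [|M IH]; intros H; simpl; [apply Cser_zero|].
  apply Cser_plus; [apply IH; intros; apply H; lia | apply H; lia].
Qed.

Lemma Cser_S (u : nat -> C) l : Cser (fun n => u (S n)) l -> Cser u (u O + l)%C.
Proof.
  intros H. apply Clim_incr.
  apply Clim_ext with (fun n => u O + Csum (fun n => u (S n)) n)%C.
  - intros; now rewrite Csum_S_l.
  - apply Clim_plus; auto using Clim_const.
Qed.

Lemma tannery (u : nat -> nat -> C) (v : nat -> C) (A : nat -> R) (LA : R)
  (l : nat -> C) (s : C) :
  (forall n k, Cmod (u n k) <= A n) -> Rser A LA ->
  (forall n, Clim (u n) (v n)) ->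
  (forall k, Cser (fun n => u n k) (l k)) -> Cser v s -> Clim l s.
Proof.
  intros HA LAs Hv Hl Hs. apply Clim_eps. intros e He.
  destruct (proj1 (is_lim_seq_eps _ _) LAs (e / 4)) as [N HN]; [lra|].
  specialize (HN N (le_n N)).
  assert (Hv' : forall n, Cmod (v n) <= A n).
  { intros n. apply (Clim_Cmod_le _ _ _ (Hv n)); auto. }
  assert (A0 : forall n, 0 <= A n) by (intros n; eapply Rle_trans; [apply Cmod_ge_0 | apply Hv']).
  pose proof (Rser_ge_sum A LA N A0 LAs) as G.
  rewrite Rabs_minus_sym, Rabs_pos_eq in HN by lra.
  assert (Hk : forall k, Cmod (l k - Csum (fun n => u n k) N)%C <= LA - Rsum A N).
  { intros k. destruct (Cser_abs (fun n => u n k) A LA) as [t [Ht [_ Tt]]]; auto.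
    rewrite (Cser_unique _ _ _ (Hl k) Ht). apply Tt. }
  assert (Hs' : Cmod (s - Csum v N)%C <= LA - Rsum A N).
  { destruct (Cser_abs v A LA) as [t [Ht [_ Tt]]]; auto.
    rewrite (Cser_unique _ _ _ Hs Ht). apply Tt. }
  assert (F : Clim (fun k => Csum (fun n => u n k) N) (Csum v N)).
  { clear - Hv. induction N as [|N IH]; simpl; [apply Clim_const | now apply Clim_plus]. }
  destruct (proj1 (Clim_eps _ _) F (e / 4)) as [K HK]; [lra|].
  exists K; intros k Hk0. specialize (HK k Hk0). specialize (Hk k).
  pose proof (Cmod_minus_tri (l k) (Csum (fun n => u n k) N) s).
  pose proof (Cmod_minus_tri (Csum (fun n => u n k) N) (Csum v N) s).
  rewrite (Cmod_minus_sym (Csum v N) s) in *. lra.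
Qed.

Lemma sum_n_Csum (u : nat -> C) n :
  @sum_n C_AbelianMonoid u n = Csum u (S n).
Proof.
  induction n as [|n IH]; [rewrite sum_O; simpl; now rewrite Cplus_0_l|].
  rewrite sum_Sn, IH. reflexivity.
Qed.

Lemma Clim_filterlim (u : nat -> C) l :
  Clim u l <-> filterlim u eventually (@locally C_NormedModule l).
Proof.
  rewrite Clim_eps. split.
  - intros H. apply (filterlim_locally_ball_norm (K := C_AbsRing) (U := C_NormedModule)).
    intros e. destruct (H e (cond_pos e)) as [N HN]. exists N; intros n Hn. apply (HN n Hn).
  - intros H e He.
    apply (filterlim_locally_ball_norm (K := C_AbsRing) (U := C_NormedModule)) with (eps := mkposreal e He) in H.
    destruct H as [N HN]. exists N; intros n Hn. apply (HN n Hn).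
Qed.

Lemma is_series_Cser (u : nat -> C) l : is_series u l <-> Cser u l.
Proof.
  unfold is_series, Cser. rewrite <- (Clim_incr (Csum u)), Clim_filterlim.
  split; apply filterlim_ext; intros n; now rewrite sum_n_Csum.
Qed.

Lemma pow_n_Cpow (h : C) k : @pow_n C_Ring h k = (h ^ k)%C.
Proof. induction k as [|k IH]; simpl; auto. Qed.

Lemma is_pseries_Cser (c : nat -> C) h l :
  is_pseries c h l <-> Cser (fun k => h ^ k * c k)%C l.
Proof.
  unfold is_pseries. rewrite is_series_Cser.
  split; apply Cser_ext; intros n; now rewrite <- pow_n_Cpow.
Qed.

Lemma Rsum_sum_n (u : nat -> R) n : sum_n u n = Rsum u (S n).
Proof.
  induction n as [|n IH]; [rewrite sum_O; simpl; ring|].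
  rewrite sum_Sn, IH. reflexivity.
Qed.

Lemma Rser_is_series (u : nat -> R) (l : R) : Rser u l -> is_series u l.
Proof.
  intros H. apply is_lim_seq_incr_1 in H.
  refine (is_lim_seq_ext (fun n => Rsum u (S n)) _ (Finite l) _ _); [|exact H].
  intros; now rewrite Rsum_sum_n.
Qed.

Lemma CSeries_unique (u : nat -> C) l : Cser u l -> CSeries u = l.
Proof.
  intros H. apply C_ext; simpl; apply is_series_unique, Rser_is_series.
  - eapply is_lim_seq_ext; [|apply (Clim_Re _ _ H)]. intros; apply Re_Csum.
  - eapply is_lim_seq_ext; [|apply (Clim_Im _ _ H)]. intros; apply Im_Csum.
Qed.

(** * Differentiation, exponential and Taylor's formula *)

Lemma Re_plus (z w : C) : Re (z + w)%C = Re z + Re w.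
Proof. reflexivity. Qed.

Lemma Re_minus (z w : C) : Re (z - w)%C = Re z - Re w.
Proof. reflexivity. Qed.

Lemma Im_minus (z w : C) : Im (z - w)%C = Im z - Im w.
Proof. reflexivity. Qed.

Definition Cder (f : R -> C) (x : R) (l : C) : Prop :=
  is_derive (fun t => Re (f t)) x (Re l) /\ is_derive (fun t => Im (f t)) x (Im l).

Lemma is_derive_eq (f : R -> R) (x l l' : R) : is_derive f x l -> l = l' -> is_derive f x l'.
Proof. intros; now subst. Qed.

Lemma is_derive_Rext (f g : R -> R) (x l : R) :
  (forall t, f t = g t) -> is_derive f x l -> is_derive g x l.
Proof. intros; now apply is_derive_ext with f. Qed.

Lemma Cder_eq (f : R -> C) (x : R) (l l' : C) : Cder f x l -> l = l' -> Cder f x l'.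
Proof. intros; now subst. Qed.

Lemma Cder_ext_loc (f g : R -> C) (x : R) (l : C) :
  locally x (fun t => f t = g t) -> Cder f x l -> Cder g x l.
Proof.
  intros H [H1 H2]; split; eapply is_derive_ext_loc; eauto;
    eapply filter_imp; [|exact H| |exact H]; simpl; intros; congruence.
Qed.

Lemma Cder_ext (f g : R -> C) (x : R) (l : C) :
  (forall t, f t = g t) -> Cder f x l -> Cder g x l.
Proof. intros H; apply Cder_ext_loc, filter_forall; auto. Qed.

Lemma Cder_unique (f : R -> C) (x : R) (l l' : C) : Cder f x l -> Cder f x l' -> l = l'.
Proof.
  intros [H1 H2] [H3 H4]. apply is_derive_unique in H1, H2, H3, H4.
  apply C_ext; congruence.
Qed.

Lemma is_derive_Rid (x : R) : is_derive (fun t => t) x 1.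
Proof. apply (is_derive_id (K := R_AbsRing)). Qed.

Lemma is_derive_Rconst (c x : R) : is_derive (fun _ => c) x 0.
Proof. apply (is_derive_const (V := R_NormedModule)). Qed.

Lemma Cder_const (c : C) x : Cder (fun _ => c) x 0.
Proof. split; apply (is_derive_const (V := R_NormedModule)). Qed.

Lemma Cder_RtoC (f : R -> R) x l : is_derive f x l -> Cder (fun t => RtoC (f t)) x (RtoC l).
Proof. split; simpl; auto. apply (is_derive_const (V := R_NormedModule)). Qed.

Lemma Cder_plus (f g : R -> C) x a b :
  Cder f x a -> Cder g x b -> Cder (fun t => f t + g t)%C x (a + b)%C.
Proof. intros [H1 H2] [H3 H4]; split; simpl; apply (is_derive_plus (V := R_NormedModule)); auto. Qed.

Lemma Cder_minus (f g : R -> C) x a b :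
  Cder f x a -> Cder g x b -> Cder (fun t => f t - g t)%C x (a - b)%C.
Proof. intros [H1 H2] [H3 H4]; split; simpl; apply (is_derive_minus (V := R_NormedModule)); auto. Qed.

Lemma is_derive_Rmult (f g : R -> R) x a b :
  is_derive f x a -> is_derive g x b -> is_derive (fun t => f t * g t) x (a * g x + f x * b).
Proof. intros. apply (is_derive_mult f g x a b); auto. intros; apply Rmult_comm. Qed.

Lemma is_derive_Rplus (f g : R -> R) x a b :
  is_derive f x a -> is_derive g x b -> is_derive (fun t => f t + g t) x (a + b).
Proof. intros. now apply (is_derive_plus (V := R_NormedModule)). Qed.

Lemma is_derive_Rminus (f g : R -> R) x a b :
  is_derive f x a -> is_derive g x b -> is_derive (fun t => f t - g t) x (a - b).
Proof. intros. now apply (is_derive_minus (V := R_NormedModule)). Qed.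

Lemma is_derive_Rscal (c : R) (f : R -> R) x a :
  is_derive f x a -> is_derive (fun t => c * f t) x (c * a).
Proof. intros. now apply (is_derive_scal f x c a). Qed.

Lemma is_derive_Rcomp (f g : R -> R) x a b :
  is_derive f (g x) a -> is_derive g x b -> is_derive (fun t => f (g t)) x (b * a).
Proof. intros. now apply (is_derive_comp f g x a b). Qed.

Lemma Cder_mult (f g : R -> C) x a b :
  Cder f x a -> Cder g x b -> Cder (fun t => f t * g t)%C x (a * g x + f x * b)%C.
Proof.
  intros [H1 H2] [H3 H4]; split.
  - apply is_derive_eq with
      ((Re a * Re (g x) + Re (f x) * Re b) - (Im a * Im (g x) + Im (f x) * Im b)).
    + apply is_derive_Rminus; now apply is_derive_Rmult.
    + simpl; unfold Re, Im; ring.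
  - apply is_derive_eq with
      ((Re a * Im (g x) + Re (f x) * Im b) + (Im a * Re (g x) + Im (f x) * Re b)).
    + apply is_derive_Rplus; now apply is_derive_Rmult.
    + simpl; unfold Re, Im; ring.
Qed.

Lemma Cder_scal (c : C) (f : R -> C) x a :
  Cder f x a -> Cder (fun t => c * f t)%C x (c * a)%C.
Proof.
  intros H. eapply Cder_eq; [apply (Cder_mult _ _ _ _ _ (Cder_const c x) H)|]. ring.
Qed.

Lemma Cder_Csum (f : nat -> R -> C) (l : nat -> C) x N :
  (forall k, (k < N)%nat -> Cder (f k) x (l k)) ->
  Cder (fun t => Csum (fun k => f k t) N) x (Csum l N).
Proof.
  induction N as [|N IH]; intros H; simpl; [apply Cder_const|].
  apply Cder_plus; [apply IH; intros; apply H; lia | apply H; lia].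
Qed.

Lemma Cder_Cexp (g : R -> C) x l :
  Cder g x l -> Cder (fun t => Cexp (g t)) x (l * Cexp (g x))%C.
Proof.
  intros [H1 H2].
  assert (E : is_derive (fun t => exp (Re (g t))) x (Re l * exp (Re (g x)))).
  { apply (is_derive_Rcomp exp _ x); auto. apply is_derive_exp. }
  split; simpl.
  - eapply is_derive_eq; [apply is_derive_Rmult; [exact E|]|].
    + apply (is_derive_Rcomp cos _ x); [apply is_derive_cos | exact H2].
    + simpl; unfold Re, Im; ring.
  - eapply is_derive_eq; [apply is_derive_Rmult; [exact E|]|].
    + apply (is_derive_Rcomp sin _ x); [apply is_derive_sin | exact H2].
    + simpl; unfold Re, Im; ring.
Qed.

Lemma Cder_comp_real (f : R -> C) (g : R -> R) x l m :
  Cder f (g x) l -> is_derive g x m -> Cder (fun t => f (g t)) x (RtoC m * l)%C.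
Proof.
  intros [H1 H2] H3; split; simpl.
  - eapply is_derive_eq; [apply (is_derive_Rcomp (fun t => Re (f t)) g x); eauto|].
    unfold Re, Im; ring.
  - eapply is_derive_eq; [apply (is_derive_Rcomp (fun t => Im (f t)) g x); eauto|].
    unfold Re, Im; ring.
Qed.

Lemma exp_le (x y : R) : x <= y -> exp x <= exp y.
Proof. intros [H|H]; [left; now apply exp_increasing | right; now subst]. Qed.

Lemma exp_le_1 (x : R) : x <= 0 -> exp x <= 1.
Proof. intros H. rewrite <- exp_0. now apply exp_le. Qed.

Lemma inv_fact_bounds (n : nat) : 0 < / INR (fact n) <= 1.
Proof.
  split; [apply Rinv_0_lt_compat, INR_fact_lt_0|].
  rewrite <- Rinv_1. apply Rinv_le_contravar; [lra|]. exact (le_INR 1 _ (lt_O_fact n)).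
Qed.

Lemma Cmod_Cexp (z : C) : Cmod (Cexp z) = exp (Re z).
Proof.
  destruct z as [x y]. unfold Cexp, Cmod; simpl.
  replace (exp x * cos y * (exp x * cos y * 1) + exp x * sin y * (exp x * sin y * 1))
    with (Rsqr (exp x)).
  - apply sqrt_Rsqr, Rlt_le, exp_pos.
  - pose proof (sin2_cos2 y) as H. unfold Rsqr in *.
    replace (exp x * cos y * (exp x * cos y * 1) + exp x * sin y * (exp x * sin y * 1))
      with (exp x * exp x * (sin y * sin y + cos y * cos y)) by ring.
    rewrite H; ring.
Qed.

Lemma Cexp_plus (a b : C) : Cexp (a + b)%C = (Cexp a * Cexp b)%C.
Proof.
  destruct a as [a1 a2], b as [b1 b2]. unfold Cexp; apply C_ext; simpl;
  rewrite exp_plus, ?cos_plus, ?sin_plus; ring.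
Qed.

Lemma Cexp_0 : Cexp 0 = RtoC 1.
Proof. unfold Cexp; apply C_ext; simpl; rewrite exp_0, ?cos_0, ?sin_0; ring. Qed.

Lemma Cexp_RtoC (x : R) : Cexp (RtoC x) = RtoC (exp x).
Proof. unfold Cexp; apply C_ext; simpl; rewrite ?cos_0, ?sin_0; ring. Qed.

Lemma Cexp_neq_0 (z : C) : Cexp z <> RtoC 0.
Proof. apply Cmod_gt_0. rewrite Cmod_Cexp. apply exp_pos. Qed.

Lemma Cexp_opp (z : C) : Cexp (- z)%C = (/ Cexp z)%C.
Proof.
  assert (H : (Cexp (- z) * Cexp z = 1)%C).
  { rewrite <- Cexp_plus. replace (- z + z)%C with (RtoC 0) by ring. apply Cexp_0. }
  rewrite <- (Cmult_1_r (Cexp (- z))), <- (Cinv_r (Cexp z)), Cmult_assoc, H;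
  [ring | apply Cexp_neq_0].
Qed.

Lemma Cexp_nat (z : C) (n : nat) : (Cexp z ^ n)%C = Cexp (RtoC (INR n) * z)%C.
Proof.
  induction n as [|n IH].
  - simpl. replace (0 * z)%C with (RtoC 0) by ring. now rewrite Cexp_0.
  - rewrite S_INR, RtoC_plus. rewrite Cpow_S, IH, <- Cexp_plus. f_equal; ring.
Qed.

Lemma incr_of_derive_ge0 (f f' : R -> R) (a b : R) :
  a <= b -> (forall x, a <= x <= b -> is_derive f x (f' x)) ->
  (forall x, a <= x <= b -> 0 <= f' x) -> f a <= f b.
Proof.
  intros Hab D P.
  destruct (MVT_gen f a b f') as [c [Hc E]].
  - intros x Hx. rewrite Rmin_left, Rmax_right in Hx by lra. apply D; lra.
  - intros x Hx. rewrite Rmin_left, Rmax_right in Hx by lra.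
    apply derivable_continuous_pt. exists (f' x). apply is_derive_Reals, D; lra.
  - rewrite Rmin_left, Rmax_right in Hc by lra. specialize (P c Hc).
    assert (0 <= f' c * (b - a)) by (apply Rmult_le_pos; lra). lra.
Qed.

Lemma mvt_majorant (f f' g g' : R -> R) (a b : R) :
  a <= b -> (forall x, a <= x <= b -> is_derive f x (f' x)) ->
  (forall x, a <= x <= b -> is_derive g x (g' x)) ->
  (forall x, a <= x <= b -> Rabs (f' x) <= g' x) -> Rabs (f b - f a) <= g b - g a.
Proof.
  intros Hab D1 D2 P. apply Rabs_le; split.
  - assert (g a + f a <= g b + f b); [|lra].
    apply (incr_of_derive_ge0 (fun x => g x + f x) (fun x => g' x + f' x)); auto.
    + intros; apply is_derive_Rplus; auto.
    + intros x Hx; specialize (P x Hx); apply Rabs_le_between in P; lra.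
  - assert (g a - f a <= g b - f b); [|lra].
    apply (incr_of_derive_ge0 (fun x => g x - f x) (fun x => g' x - f' x)); auto.
    + intros; apply is_derive_Rminus; auto.
    + intros x Hx; specialize (P x Hx); apply Rabs_le_between in P; lra.
Qed.

Lemma Cmvt_majorant (f f' : R -> C) (g g' : R -> R) (a b : R) :
  a <= b -> (forall x, a <= x <= b -> Cder f x (f' x)) ->
  (forall x, a <= x <= b -> is_derive g x (g' x)) ->
  (forall x, a <= x <= b -> Cmod (f' x) <= g' x) -> Cmod (f b - f a)%C <= 2 * (g b - g a).
Proof.
  intros Hab D1 D2 P. eapply Rle_trans; [apply Cmod_le_parts|].
  assert (Rabs (Re (f b) - Re (f a)) <= g b - g a).
  { apply (mvt_majorant (fun x => Re (f x)) (fun x => Re (f' x)) g g'); auto.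
    - intros; now apply D1.
    - intros; eapply Rle_trans; [apply re_le_Cmod | auto]. }
  assert (Rabs (Im (f b) - Im (f a)) <= g b - g a).
  { apply (mvt_majorant (fun x => Im (f x)) (fun x => Im (f' x)) g g'); auto.
    - intros; now apply D1.
    - intros; eapply Rle_trans; [apply im_le_Cmod | auto]. }
  rewrite Re_minus, Im_minus. lra.
Qed.

Lemma Cmvt (f f' : R -> C) (M a b : R) :
  a <= b -> (forall x, a <= x <= b -> Cder f x (f' x)) ->
  (forall x, a <= x <= b -> Cmod (f' x) <= M) -> Cmod (f b - f a)%C <= 2 * (M * (b - a)).
Proof.
  intros Hab D P. replace (M * (b - a)) with (M * b - M * a) by ring.
  apply (Cmvt_majorant f f' (fun x => M * x) (fun _ => M)); auto.
  intros. eapply is_derive_eq; [apply is_derive_Rscal, is_derive_Rid|].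
  ring.
Qed.

Lemma is_derive_taylor_term (c : R) (k : nat) (t : R) :
  is_derive (fun t => c * (t ^ S k / INR (fact (S k)))) t (c * (t ^ k / INR (fact k))).
Proof.
  apply is_derive_Rscal.
  apply is_derive_Rext with (fun t => / INR (fact (S k)) * t ^ S k); [intros; unfold Rdiv; apply Rmult_comm|].
  eapply is_derive_eq; [apply is_derive_Rscal, (is_derive_pow (fun t => t) (S k) t 1), is_derive_Rid|].
  rewrite fact_simpl, mult_INR.
  pose proof (INR_fact_neq_0 k). pose proof (not_0_INR (S k) (Nat.neq_succ_0 k)).
  simpl pred. field; auto.
Qed.

Lemma is_derive_taylor_poly (c : nat -> R) (n : nat) (t : R) :
  is_derive (fun t => Rsum (fun l => c l * (t ^ l / INR (fact l))) (S n)) t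
    (Rsum (fun l => c (S l) * (t ^ l / INR (fact l))) n).
Proof.
  induction n as [|n IH].
  - simpl. apply is_derive_Rext with (fun _ => c O); [intros; field|].
    apply is_derive_Rconst.
  - change (Rsum (fun l : nat => c (S l) * (t ^ l / INR (fact l))) (S n)) with
      (Rsum (fun l : nat => c (S l) * (t ^ l / INR (fact l))) n + c (S n) * (t ^ n / INR (fact n))).
    apply is_derive_Rplus with
     (f := fun t => Rsum (fun l => c l * (t ^ l / INR (fact l))) (S n)); [exact IH|].
    apply is_derive_taylor_term.
Qed.

Lemma taylor_real (k : nat) : forall (F : nat -> R -> R) (a h M : R),
  0 <= h ->
  (forall i x, (i <= k)%nat -> a <= x <= a + h -> is_derive (F i) x (F (S i) x)) ->
  (forall x, a <= x <= a + h -> Rabs (F (S k) x) <= M) ->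
  Rabs (F O (a + h) - Rsum (fun l => F l a * (h ^ l / INR (fact l))) (S k))
    <= M * (h ^ S k / INR (fact (S k))).
Proof.
  induction k as [|k IH]; intros F a h M Hh D B.
  - simpl. replace (0 + F O a * (1 / 1)) with (F O a) by field.
    replace (M * (h * 1 / 1)) with (M * (a + h) - M * a) by field.
    apply (mvt_majorant (F O) (F 1%nat) (fun x => M * x) (fun _ => M)); try lra.
    + intros; apply D; auto.
    + intros. eapply is_derive_eq; [apply is_derive_Rscal, is_derive_Rid|].
      ring.
    + auto.
  - pose (D0 := fun t => F O (a + t) - Rsum (fun l => F l a * (t ^ l / INR (fact l))) (S (S k))).
    replace (F O (a + h) - _) with (D0 h - D0 0).
    2:{ unfold D0. rewrite Rplus_0_r.
        replace (Rsum (fun l => F l a * (0 ^ l / INR (fact l))) (S (S k))) with (F O a); [ring|].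
        clear. generalize (S k); intros n. induction n as [|n IHn]; [simpl; field|].
        change (Rsum ?f (S (S n))) with (Rsum f (S n) + f (S n)). rewrite <- IHn; simpl; unfold Rdiv; ring. }
    replace (M * (h ^ S (S k) / INR (fact (S (S k))))) with
      (M * (h ^ S (S k) / INR (fact (S (S k)))) - M * (0 ^ S (S k) / INR (fact (S (S k)))))
      by (simpl; unfold Rdiv; ring).
    apply (mvt_majorant D0
      (fun t => F 1%nat (a + t) - Rsum (fun l => F (S l) a * (t ^ l / INR (fact l))) (S k))
      (fun t => M * (t ^ S (S k) / INR (fact (S (S k)))))
      (fun t => M * (t ^ S k / INR (fact (S k))))); auto.
    + intros x Hx. apply is_derive_Rminus; [|apply is_derive_taylor_poly with (c := fun l => F l a)].
      eapply is_derive_eq; [apply (is_derive_Rcomp (F O) (fun t => a + t)); [apply D; [lia | lra]|]|].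
      * eapply is_derive_eq; [apply is_derive_Rplus;
          [apply is_derive_Rconst | apply is_derive_Rid]|].
        instantiate (1 := 1). ring.
      * ring.
    + intros; apply is_derive_taylor_term.
    + intros x Hx. apply (IH (fun i => F (S i)) a x M); [lra| |].
      * intros; apply D; [lia | lra].
      * intros; apply B; lra.
Qed.

Lemma Re_RtoC_mult (r : R) (z : C) : Re (RtoC r * z)%C = r * Re z.
Proof. simpl; unfold Re, Im; ring. Qed.

Lemma Im_RtoC_mult (r : R) (z : C) : Im (RtoC r * z)%C = r * Im z.
Proof. simpl; unfold Re, Im; ring. Qed.

Lemma taylor_complex (k : nat) (F : nat -> R -> C) (a h M : R) :
  0 <= h ->
  (forall i x, (i <= k)%nat -> a <= x <= a + h -> Cder (F i) x (F (S i) x)) ->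
  (forall x, a <= x <= a + h -> Cmod (F (S k) x) <= M) ->
  Cmod (F O (a + h)%R - Csum (fun l => RtoC (h ^ l / INR (fact l)) * F l a) (S k))%C
    <= 2 * (M * (h ^ S k / INR (fact (S k)))).
Proof.
  intros Hh D B. eapply Rle_trans; [apply Cmod_le_parts|].
  pose proof (taylor_real k (fun i x => Re (F i x)) a h M Hh) as T1.
  pose proof (taylor_real k (fun i x => Im (F i x)) a h M Hh) as T2.
  simpl in T1, T2.
  rewrite Re_minus, Im_minus, Re_Csum, Im_Csum.
  rewrite (Rsum_ext _ (fun l => Re (F l a) * (h ^ l / INR (fact l)))).
  2:{ intros; rewrite Re_RtoC_mult; ring. }
  rewrite (Rsum_ext (fun n => Im _) (fun l => Im (F l a) * (h ^ l / INR (fact l)))).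
  2:{ intros; rewrite Im_RtoC_mult; ring. }
  assert (H1 := T1 (fun i x Hi Hx => proj1 (D i x Hi Hx))
    (fun x Hx => Rle_trans _ _ _ (re_le_Cmod _) (B x Hx))).
  assert (H2 := T2 (fun i x Hi Hx => proj2 (D i x Hi Hx))
    (fun x Hx => Rle_trans _ _ _ (im_le_Cmod _) (B x Hx))).
  simpl in *. lra.
Qed.

Lemma Csum_exp_remainder (w : C) (N : nat) (M : R) :
  (forall t, 0 <= t <= 1 -> exp (- (t * Re w)) <= M) -> 1 <= M ->
  Cmod (Cexp (- w) - Csum (fun k => RtoC (/ INR (fact k)) * (- w) ^ k) N)%C
    <= 2 * (M * (Cmod w ^ N / INR (fact N))).
Proof.
  intros HM M1. destruct N as [|N].
  - simpl. replace (Cexp (- w) - 0)%C with (Cexp (- w)) by ring.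
    rewrite Cmod_Cexp. specialize (HM 1). simpl in *. unfold Re in *.
    replace (- fst w) with (- (1 * fst w)) by ring.
    assert (0 <= 1 <= 1) by lra. specialize (HM H). lra.
  - pose proof (taylor_complex N (fun i t => (- w) ^ i * Cexp (RtoC t * - w))%C 0 1
      (M * Cmod w ^ S N)) as T. cbv beta in T.
    rewrite Rplus_0_l in T. 
    rewrite (Csum_ext _ (fun l => RtoC (1 ^ l / INR (fact l)) * ((- w) ^ l * Cexp (0 * - w)))%C).
    2:{ intros. rewrite pow1. replace (0 * - w)%C with (RtoC 0) by ring. rewrite Cexp_0.
        unfold Rdiv; rewrite Rmult_1_l. ring. }
    replace (Cexp (- w)) with ((- w) ^ 0 * Cexp (1 * - w))%C.
    2:{ simpl. rewrite !Cmult_1_l; auto. }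
    eapply Rle_trans; [apply T; try lra|].
    + intros i x _ _.
      eapply Cder_eq; [apply Cder_scal, Cder_Cexp, (Cder_mult (fun t => RtoC t) (fun _ => (- w)%C));
        [apply Cder_RtoC, is_derive_Rid | apply Cder_const]|].
      simpl. ring.
    + intros x Hx. rewrite Cmod_mult, Cmod_pow, Cmod_opp, Cmod_Cexp, Rmult_comm.
      apply Rmult_le_compat_r; [apply pow_le, Cmod_ge_0|].
      replace (Re (RtoC x * - w)%C) with (- (x * Re w)) by (simpl; unfold Re; ring).
      apply HM; lra.
    + rewrite pow1. apply Req_le. unfold Rdiv; ring.
Qed.

Lemma Csum_exp_remainder_pos (w : C) (N : nat) :
  0 <= Re w ->
  Cmod (Cexp (- w) - Csum (fun k => RtoC (/ INR (fact k)) * (- w) ^ k) N)%C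
    <= 2 * Cmod w ^ N.
Proof.
  intros Hw. eapply Rle_trans; [apply (Csum_exp_remainder w N 1); [|lra]|].
  - intros t Ht. rewrite <- exp_0. apply exp_le.
    assert (0 <= t * Re w) by (apply Rmult_le_pos; lra). lra.
  - rewrite Rmult_1_l. apply Rmult_le_compat_l; [lra|].
    rewrite <- (Rmult_1_r (Cmod w ^ N)) at 2.
    apply Rmult_le_compat_l; [apply pow_le, Cmod_ge_0 | apply inv_fact_bounds].
Qed.

Lemma pow_over_fact_cv (x : R) : is_lim_seq (fun n => x ^ n / INR (fact n)) 0.
Proof.
  apply is_lim_seq_Reals. intros e He.
  destruct (cv_speed_pow_fact x e He) as [N HN]. exists N; intros n Hn. apply HN; auto.
Qed.

Lemma Cexp_series (w : C) : Cser (fun k => RtoC (/ INR (fact k)) * (- w) ^ k)%C (Cexp (- w)).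
Proof.
  apply Clim_squeeze with (fun N => 2 * (exp (Cmod w) * (Cmod w ^ N / INR (fact N)))).
  - intros N. rewrite Cmod_minus_sym. apply Csum_exp_remainder.
    + intros t Ht. apply exp_le. pose proof (re_le_Cmod w) as H. apply Rabs_le_between in H.
      assert (t * - Re w <= t * Cmod w) by (apply Rmult_le_compat_l; lra).
      assert (t * Cmod w <= 1 * Cmod w) by (apply Rmult_le_compat_r; [apply Cmod_ge_0 | lra]). lra.
    + rewrite <- exp_0. apply exp_le, Cmod_ge_0.
  - apply lim0_mult_const, lim0_mult_const, pow_over_fact_cv.
Qed.

Lemma exp_Rser (x : R) : Rser (fun k => x ^ k / INR (fact k)) (exp x).
Proof.
  pose proof (Clim_Re _ _ (Cexp_series (RtoC (- x)))) as H.
  rewrite <- RtoC_opp, Ropp_involutive, Cexp_RtoC in H. simpl in H.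
  eapply is_lim_seq_ext; [|exact H]. intros n. simpl. rewrite Re_Csum.
  apply Rsum_ext; intros. rewrite <- RtoC_pow, <- RtoC_mult. simpl. unfold Rdiv; ring.
Qed.

(** * Discrete Euler-Maclaurin summation *)

Lemma is_derive_Rpower (a x : R) :
  0 < x -> is_derive (fun t => Rpower t a) x (a * Rpower x (a - 1)).
Proof. intros. apply is_derive_Reals. now apply derivable_pt_lim_power. Qed.

Lemma Rpower_pos (x a : R) : 0 < Rpower x a.
Proof. apply exp_pos. Qed.

Lemma Rpower_exp_pos (x a y : R) : 0 < Rpower x a * exp y.
Proof. apply Rmult_lt_0_compat; [apply Rpower_pos | apply exp_pos]. Qed.

Lemma Rpower_le_exponent (x a b : R) : 1 <= x -> a <= b -> Rpower x a <= Rpower x b.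
Proof.
  intros Hx Hab. apply exp_le, Rmult_le_compat_r; auto.
  rewrite <- ln_1. destruct Hx as [Hx|<-]; [left; apply ln_increasing; lra | right; auto].
Qed.

Lemma Rpower_neg_anti (x y a : R) : 0 < x <= y -> a <= 0 -> Rpower y a <= Rpower x a.
Proof.
  intros [Hx [Hy|<-]] Ha; [|lra]. apply exp_le.
  pose proof (ln_increasing x y Hx Hy).
  assert (0 <= (- a) * (ln y - ln x)) by (apply Rmult_le_pos; lra). lra.
Qed.

Lemma Rpower_1_base (a : R) : Rpower 1 a = 1.
Proof. unfold Rpower. rewrite ln_1, Rmult_0_r; apply exp_0. Qed.

Lemma xn_ge1 n : 1 <= INR (S n).
Proof. rewrite S_INR. pose proof (pos_INR n). lra. Qed.

Lemma Rpower_summable (p : R) : 1 < p -> exists l, Rser (fun n => Rpower (INR (S n)) (- p)) l.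
Proof.
  intros Hp.
  destruct (Rser_bounded (fun n => Rpower (INR (S n)) (- p)) (1 + / (p - 1))) as [l [Hl _]].
  - intros; apply Rlt_le, Rpower_pos.
  - intros N.
    assert (B : forall N, Rsum (fun n => Rpower (INR (S n)) (- p)) (S N)
      <= 1 + / (p - 1) * (1 - Rpower (INR (S N)) (1 - p))).
    { clear N. induction N as [|N IH].
      - simpl. rewrite !Rpower_1_base. lra.
      - change (Rsum ?f (S (S N))) with (Rsum f (S N) + f (S N)). cbv beta.
        assert (Rabs (- / (p - 1) * Rpower (INR (S (S N))) (1 - p)
             - (- / (p - 1) * Rpower (INR (S N)) (1 - p))) >= Rpower (INR (S (S N))) (- p)).
        { pose proof (xn_ge1 N) as X. pose proof (S_INR (S N)) as E.
          assert (- / (p - 1) * Rpower (INR (S N)) (1 - p) - Rpower (INR (S (S N))) (-p) * INR (S N)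
             <= - / (p - 1) * Rpower (INR (S (S N))) (1 - p) - Rpower (INR (S (S N))) (-p) * INR (S (S N))).
          { apply (incr_of_derive_ge0
             (fun x => - / (p - 1) * Rpower x (1 - p) - Rpower (INR (S (S N))) (-p) * x)
             (fun x => - / (p - 1) * ((1 - p) * Rpower x (1 - p - 1)) - Rpower (INR (S (S N))) (-p) * 1)); [lra| |].
            - intros x Hx. apply is_derive_Rminus; apply is_derive_Rscal;
                [apply is_derive_Rpower; lra | apply is_derive_Rid].
            - intros x Hx. replace (1 - p - 1) with (- p) by ring.
              replace (- / (p - 1) * ((1 - p) * Rpower x (- p))) with (Rpower x (- p)) by (field; lra).
              pose proof (Rpower_neg_anti x (INR (S (S N))) (- p)). lra. }
          apply Rle_ge. eapply Rle_trans; [|apply Rle_abs]. rewrite E in *. lra. }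
        assert (D : Rpower (INR (S (S N))) (1 - p) <= Rpower (INR (S N)) (1 - p)).
        { apply Rpower_neg_anti; [|lra]. pose proof (xn_ge1 N). rewrite (S_INR (S N)). lra. }
        assert (0 < / (p - 1)) by (apply Rinv_0_lt_compat; lra).
        rewrite Rabs_pos_eq in H.
        2:{ assert (0 <= / (p - 1) * (Rpower (INR (S N)) (1 - p) - Rpower (INR (S (S N))) (1 - p))) by (apply Rmult_le_pos; lra). lra. }
        lra. }
    assert (0 < / (p - 1)) by (apply Rinv_0_lt_compat; lra).
    destruct N as [|N]; [simpl; lra|]. eapply Rle_trans; [apply B|].
    pose proof (Rpower_pos (INR (S N)) (1 - p)).
    assert (0 <= / (p - 1) * Rpower (INR (S N)) (1 - p)) by (apply Rmult_le_pos; lra). lra.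
  - now exists l.
Qed.

Lemma Rpower_neg_lim0 (p : R) : 0 < p -> is_lim_seq (fun n => Rpower (INR (S n)) (- p)) 0.
Proof.
  intros Hp. apply is_lim_seq_eps. intros e He.
  destruct (nfloor_ex (Rpower e (- / p))) as [N HN]; [apply Rlt_le, Rpower_pos|].
  exists N. intros n Hn. rewrite Rminus_0_r, Rabs_pos_eq by apply Rlt_le, Rpower_pos.
  assert (H : Rpower e (- / p) < INR (S n)).
  { rewrite S_INR. apply le_INR in Hn. lra. }
  replace e with (Rpower (Rpower e (- / p)) (- p)).
  - apply exp_increasing. pose proof (ln_increasing _ _ (Rpower_pos _ _) H). nra.
  - rewrite Rpower_mult. replace (- / p * - p) with 1 by (field; lra). now apply Rpower_1.
Qed.

Lemma Rpower_exp_bounded (p c : R) :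
  0 < c -> exists K, 0 < K /\ forall x, 1 <= x -> Rpower x p * exp (- (c * x)) <= K.
Proof.
  intros Hc. destruct (nfloor_ex (Rmax p 0)) as [M HM]; [apply Rmax_r|].
  pose (m := INR (S M)). assert (Hm : 0 < m) by (unfold m; rewrite S_INR; pose proof (pos_INR M); lra).
  exists (Rpower (m / c) m). split; [apply Rpower_pos|]. intros x Hx.
  apply Rle_trans with (Rpower x m * exp (- (c * x))).
  - apply Rmult_le_compat_r; [apply Rlt_le, exp_pos|]. apply Rpower_le_exponent; auto.
    unfold m; rewrite S_INR. pose proof (Rmax_l p 0). lra.
  - unfold Rpower. rewrite <- exp_plus. apply exp_le.
    assert (Hmc : 0 < m / c) by (apply Rdiv_lt_0_compat; lra).
    assert (Hq : 0 < c * x / m) by (apply Rdiv_lt_0_compat; nra).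
    replace x with (m / c * (c * x / m)) at 1 by (field; lra).
    rewrite ln_mult; auto.
    pose proof (exp_ineq1_le (ln (c * x / m))) as H. rewrite exp_ln in H by auto.
    assert (m * ln (c * x / m) <= m * (c * x / m)) by (apply Rmult_le_compat_l; lra).
    replace (m * (c * x / m)) with (c * x) in H0 by (field; lra). lra.
Qed.

Fixpoint bern_upto (n : nat) : nat -> R :=
  match n with
  | O => fun _ => 0
  | S m => fun i =>
      if Nat.ltb i m then bern_upto m i
      else (if Nat.eqb m 0 then 1 else 0)
           - Rsum (fun j => bern_upto m j / INR (fact (S m - j))) m
  end.

(* [bern i] is B_i / i!, the coefficients of 1 / (1 + D/2! + D^2/3! + ...). *)
Definition bern (i : nat) : R := bern_upto (S i) i.

Lemma bern_upto_eq n i : (i < n)%nat -> bern_upto n i = bern i.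
Proof.
  induction n as [|n IH]; [lia|]. intros H.
  destruct (Nat.eq_dec i n) as [->|Hne]; [reflexivity|].
  change (bern_upto (S n) i) with
    (if Nat.ltb i n then bern_upto n i
      else (if Nat.eqb n 0 then 1 else 0)
           - Rsum (fun j => bern_upto n j / INR (fact (S n - j))) n).
  replace (Nat.ltb i n) with true by (symmetry; apply Nat.ltb_lt; lia). apply IH; lia.
Qed.

Lemma bern_rec p :
  Rsum (fun i => bern i / INR (fact (S p - i))) (S p) = if Nat.eqb p 0 then 1 else 0.
Proof.
  change (Rsum ?f (S p)) with (Rsum f p + f p). cbv beta.
  replace (S p - p)%nat with 1%nat by lia.
  unfold bern at 2. unfold bern_upto; fold bern_upto. rewrite Nat.ltb_irrefl.
  rewrite (Rsum_ext (fun j => bern_upto p j / _) (fun i => bern i / INR (fact (S p - i)))).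
  - simpl; field.
  - intros; now rewrite bern_upto_eq.
Qed.

Definition emB (m : nat) : R := 2 * Rsum (fun i => Rabs (bern i)) (S m).

Lemma emB_pos m : 0 <= emB m.
Proof. apply Rmult_le_pos; [lra|]. apply Rsum_ge0; intros; apply Rabs_pos. Qed.

Lemma RtoC_Rsum (g : nat -> R) n : RtoC (Rsum g n) = Csum (fun i => RtoC (g i)) n.
Proof. induction n as [|n IH]; simpl; auto. now rewrite RtoC_plus, IH. Qed.

Lemma em_identity (f : nat -> C) (m : nat) :
  Csum (fun i => RtoC (bern i) *
    Csum (fun l => RtoC (/ INR (fact (S l))) * f (i + S l)%nat) (m - i))%C (S m)
  = if Nat.eqb m 0 then RtoC 0 else f 1%nat.
Proof.
  induction m as [|m IH].
  - simpl. ring.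
  - change (Csum ?g (S (S m))) with (Csum g (S m) + g (S m))%C. cbv beta.
    rewrite Nat.sub_diag. 
    rewrite (Csum_ext _ (fun i => RtoC (bern i) *
      Csum (fun l => RtoC (/ INR (fact (S l))) * f (i + S l)%nat) (m - i) +
       f (S m) * RtoC (bern i / INR (fact (S m - i))))%C).
    2:{ intros i Hi. replace (S m - i)%nat with (S (m - i)) by lia.
        change (Csum ?g (S (m - i))) with (Csum g (m - i) + g (m - i)%nat)%C. cbv beta.
        replace (i + S (m - i))%nat with (S m) by lia.
        unfold Rdiv. rewrite RtoC_mult. ring. }
    rewrite Csum_plus, Csum_scal, IH.
    replace (Csum (fun i => RtoC (bern i / INR (fact (S m - i)))) (S m)) with
      (RtoC (if Nat.eqb m 0 then 1 else 0)).
    2:{ now rewrite <- bern_rec, RtoC_Rsum. }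
    destruct m; cbn [Nat.eqb Csum]; ring.
Qed.

Definition family_on (F : nat -> R -> C) (a b : R) : Prop :=
  forall i x, a <= x <= b -> Cder (F i) x (F (S i) x).

Lemma em_local (m : nat) (F : nat -> R -> C) (x M : R) :
  (0 < m)%nat -> family_on F x (x + 1) ->
  (forall t, x <= t <= x + 1 -> Cmod (F (S m) t) <= M) ->
  Cmod (F 1%nat x - Csum (fun i => RtoC (bern i) * (F i (x + 1)%R - F i x)) (S m))%C <= emB m * M.
Proof.
  intros Hm D B.
  pose (rem := fun i => (F i (x + 1)%R - Csum (fun l => RtoC (1 ^ l / INR (fact l)) * F (l + i)%nat x) (S (m - i)))%C).
  assert (HM : 0 <= M) by (eapply Rle_trans; [apply Cmod_ge_0 | apply (B x); lra]).
  assert (R1 : forall i, (i < S m)%nat -> Cmod (rem i) <= 2 * M).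
  { intros i Hi. unfold rem.
    eapply Rle_trans; [apply (taylor_complex (m - i) (fun j => F (j + i)%nat) x 1 M); [lra| |]|].
    - intros j t _ Ht. apply D; auto.
    - intros t Ht. replace (S (m - i) + i)%nat with (S m) by lia. auto.
    - rewrite pow1. apply Rmult_le_compat_l; [lra|]. rewrite <- (Rmult_1_r M) at 2.
      apply Rmult_le_compat_l; auto. unfold Rdiv; rewrite Rmult_1_l. apply inv_fact_bounds. }
  rewrite (Csum_ext _ (fun i => RtoC (bern i) * rem i + RtoC (bern i) *
    Csum (fun l => RtoC (/ INR (fact (S l))) * F (i + S l)%nat x) (m - i))%C).
  2:{ intros i Hi. unfold rem. rewrite Csum_S_l. simpl (1 ^ 0). simpl (fact 0).
      replace (1 / INR 1) with 1 by (simpl; field). simpl (0 + i)%nat.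
      rewrite (Csum_ext (fun n => RtoC (1 ^ S n / INR (fact (S n))) * F (S n + i)%nat x)%C
        (fun l => RtoC (/ INR (fact (S l))) * F (i + S l)%nat x)%C).
      - ring.
      - intros l _. rewrite pow1. unfold Rdiv. rewrite Rmult_1_l. do 2 f_equal. lia. }
  rewrite Csum_plus, (em_identity (fun i => F i x)).
  destruct m as [|m]; [lia|]. cbn [Nat.eqb].
  replace (F 1%nat x - (_ + F 1%nat x))%C with (- Csum (fun i => RtoC (bern i) * rem i) (S (S m)))%C by ring.
  rewrite Cmod_opp. unfold emB.
  replace (2 * _ * M) with ((2 * M) * Rsum (fun i => Rabs (bern i)) (S (S m))) by ring.
  rewrite <- Rsum_scal. apply Csum_Cmod. intros i Hi.
  rewrite Cmod_mult, Cmod_R, Rmult_comm. apply Rmult_le_compat_r; [apply Rabs_pos | auto].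
Qed.

Definition em_rem (m : nat) (F : nat -> R -> C) (n : nat) : C :=
  (F 1%nat (INR (S n)) - Csum (fun i => RtoC (bern i) * (F i (INR (S (S n))) - F i (INR (S n)))) (S m))%C.

Definition em_bdry (m : nat) (F : nat -> R -> C) (x : R) : C :=
  Csum (fun i => RtoC (bern i) * F i x)%C (S m).

(* For a family of successive derivatives, the limit in M is the regularized sum of F 1 over
   the positive integers; it does not depend on m once m is large. *)
Definition em_partial (m : nat) (F : nat -> R -> C) (M : nat) : C :=
  (Csum (fun n => F 1%nat (INR (S n))) M - em_bdry m F (INR (S M)))%C.

Lemma em_partial_eq m F M :
  em_partial m F M = (Csum (em_rem m F) M - em_bdry m F 1)%C.
Proof.
  unfold em_partial, em_rem, em_bdry. rewrite Csum_minus, Csum_exchange.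
  rewrite (Csum_ext (fun i => Csum (fun n => RtoC (bern i) * (F i (INR (S (S n))) - F i (INR (S n))))%C M)
    (fun i => (RtoC (bern i) * F i (INR (S M)) - RtoC (bern i) * F i 1)%C)).
  - rewrite Csum_minus. ring.
  - intros i _. rewrite Csum_scal, (Csum_telescope (fun n => F i (INR (S n)))). simpl (INR 1). ring.
Qed.

Lemma em_rem_le (m : nat) (F : nat -> R -> C) (K p : R) (n : nat) :
  (0 < m)%nat -> (forall i x, 1 <= x -> Cder (F i) x (F (S i) x)) -> 0 <= K -> 0 <= p ->
  (forall x, 1 <= x -> Cmod (F (S m) x) <= K * Rpower x (- p)) ->
  Cmod (em_rem m F n) <= emB m * K * Rpower (INR (S n)) (- p).
Proof.
  intros Hm D HK Hp B. unfold em_rem. rewrite (S_INR (S n)), Rmult_assoc.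
  pose proof (xn_ge1 n). apply em_local; auto.
  - intros i x Hx. apply D; lra.
  - intros t Ht. eapply Rle_trans; [apply B; lra|]. apply Rmult_le_compat_l; auto.
    apply Rpower_neg_anti; lra.
Qed.

Lemma em_converges (m : nat) (F : nat -> R -> C) (K p l : R) :
  (0 < m)%nat -> (forall i x, 1 <= x -> Cder (F i) x (F (S i) x)) -> 0 <= K -> 1 < p ->
  (forall x, 1 <= x -> Cmod (F (S m) x) <= K * Rpower x (- p)) ->
  Rser (fun n => Rpower (INR (S n)) (- p)) l ->
  exists s, Cser (em_rem m F) s /\ Cmod s <= emB m * K * l /\
    Clim (em_partial m F) (s - em_bdry m F 1)%C.
Proof.
  intros Hm D HK Hp B Hl.
  destruct (Cser_abs (em_rem m F) (fun n => emB m * K * Rpower (INR (S n)) (- p)) (emB m * K * l))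
    as [s [Hs [Bs _]]].
  - intros n. apply em_rem_le; auto; lra.
  - now apply Rser_scal.
  - exists s; split; [|split]; auto.
    eapply Clim_ext; [intros; symmetry; apply em_partial_eq|].
    apply Clim_minus; auto using Clim_const.
Qed.

(** * Complex power series *)

Lemma choice_nat {T : Type} (P : nat -> T -> Prop) :
  (forall n, exists x, P n x) -> exists f, forall n, P n (f n).
Proof.
  intros H. exists (fun n => proj1_sig (constructive_indefinite_description _ (H n))).
  intros n. apply proj2_sig.
Qed.

Definition pseries_on (f : C -> C) (c : nat -> C) (r : R) : Prop :=
  forall h : C, Cmod h < r -> Cser (fun k => h ^ k * c k)%C (f h).

Definition powser (f : C -> C) (r : R) : Prop := exists c, pseries_on f c r.

Lemma Rser_geom (q : R) : 0 <= q < 1 -> Rser (fun k => q ^ k) (/ (1 - q)).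
Proof.
  intros Hq.
  assert (E : forall n, Rsum (fun k => q ^ k) n = / (1 - q) * (1 - q ^ n)).
  { induction n as [|n IH]; simpl; [ring|]. rewrite IH. field; lra. }
  apply is_lim_seq_ext with (fun n => / (1 - q) * (1 - q ^ n)); [auto|].
  replace (Finite (/ (1 - q))) with (Finite (/ (1 - q) * (1 - 0))) by (f_equal; ring).
  apply (is_lim_seq_scal_l _ (/ (1 - q)) (1 - 0)).
  apply is_lim_seq_minus'; [apply is_lim_seq_const|].
  apply is_lim_seq_geom. rewrite Rabs_pos_eq; lra.
Qed.

Lemma Cser_term_bounded (u : nat -> C) l : Cser u l -> exists B, 0 < B /\ forall k, Cmod (u k) <= B.
Proof.
  intros H. destruct (proj1 (Clim_eps _ _) H 1) as [N HN]; [lra|].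
  assert (F : forall M, exists B, 0 < B /\ forall k, (k < M)%nat -> Cmod (u k) <= B).
  { induction M as [|M [B [HB1 HB]]]; [exists 1; split; [lra | intros; lia]|].
    exists (B + Cmod (u M)). pose proof (Cmod_ge_0 (u M)). split; [lra|]. intros k Hk.
    destruct (Nat.eq_dec k M) as [->|]; [lra|].
    assert (Hk' : (k < M)%nat) by lia. specialize (HB k Hk'). lra. }
  destruct (F N) as [B [HB1 HB]]. exists (B + 2). split; [lra|]. intros k.
  destruct (Nat.lt_ge_cases k N) as [Hk|Hk]; [specialize (HB k Hk); lra|].
  pose proof (HN k Hk) as H1. pose proof (HN (S k) (le_S _ _ Hk)) as H2.
  replace (u k) with ((Csum u (S k) - l) - (Csum u k - l))%C by (simpl; ring).
  eapply Rle_trans; [apply Cmod_minus_le|]. lra.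
Qed.

Lemma pseries_coef_bound (f : C -> C) c r rho :
  pseries_on f c r -> 0 < rho < r -> exists B, 0 < B /\ forall k, Cmod (c k) * rho ^ k <= B.
Proof.
  intros H Hr. destruct (Cser_term_bounded _ _ (H (RtoC rho) ltac:(rewrite Cmod_R, Rabs_pos_eq; lra))) as [B [HB1 HB]].
  exists B; split; auto. intros k. specialize (HB k).
  rewrite Cmod_mult, Cmod_pow, Cmod_R, Rabs_pos_eq in HB by lra. lra.
Qed.

Lemma pow_ratio (x y : R) k : y <> 0 -> (x / y) ^ k * y ^ k = x ^ k.
Proof. intros. rewrite <- Rpow_mult_distr. f_equal. field; auto. Qed.

Lemma pseries_abs_cv (f : C -> C) c r rho :
  pseries_on f c r -> 0 <= rho < r -> exists L, Rser (fun k => Cmod (c k) * rho ^ k) L.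
Proof.
  intros H Hr. pose (rho' := (rho + r) / 2).
  destruct (pseries_coef_bound f c r rho' H) as [B [HB1 HB]]; [unfold rho'; lra|].
  assert (Hq : 0 <= rho / rho' < 1).
  { split; [apply Rdiv_le_0_compat; unfold rho'; lra|].
    apply Rmult_lt_reg_r with rho'; [unfold rho'; lra|].
    unfold Rdiv; rewrite Rmult_assoc, Rinv_l by (unfold rho'; lra). unfold rho'; lra. }
  destruct (Rser_comp (fun k => Cmod (c k) * rho ^ k) (fun k => B * (rho / rho') ^ k) (B * / (1 - rho / rho'))) as [L [HL _]].
  - intros k. split; [apply Rmult_le_pos; [apply Cmod_ge_0 | apply pow_le; lra]|].
    rewrite <- (pow_ratio rho rho' k) by (unfold rho'; lra).
    replace (Cmod (c k) * ((rho / rho') ^ k * rho' ^ k)) with (Cmod (c k) * rho' ^ k * (rho / rho') ^ k) by ring.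
    apply Rmult_le_compat_r; [apply pow_le; lra | apply HB].
  - apply Rser_scal, Rser_geom; auto.
  - now exists L.
Qed.

Lemma pseries_bounded (f : C -> C) c r rho :
  pseries_on f c r -> 0 <= rho < r -> exists M, forall h, Cmod h <= rho -> Cmod (f h) <= M.
Proof.
  intros H Hr. destruct (pseries_abs_cv f c r rho H Hr) as [L HL]. exists L. intros h Hh.
  destruct (Cser_abs (fun k => h ^ k * c k)%C (fun k => Cmod (c k) * rho ^ k) L) with (2 := HL) as [s [Hs [Bs _]]].
  - intros k. rewrite Cmod_mult, Cmod_pow, Rmult_comm. apply Rmult_le_compat_l; [apply Cmod_ge_0|].
    apply pow_incr; split; [apply Cmod_ge_0 | auto].
  - rewrite (Cser_unique _ _ _ (H h ltac:(lra)) Hs). auto.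
Qed.

Lemma powser_mono f r r' : r' <= r -> powser f r -> powser f r'.
Proof. intros L [c H]; exists c; intros h Hh; apply H; lra. Qed.

Lemma powser_ext f g r : (forall h, Cmod h < r -> f h = g h) -> powser f r -> powser g r.
Proof. intros E [c H]; exists c; intros h Hh; rewrite <- E by auto; auto. Qed.

Lemma powser_plus f g r : powser f r -> powser g r -> powser (fun h => f h + g h)%C r.
Proof.
  intros [c H] [d G]; exists (fun k => c k + d k)%C; intros h Hh.
  eapply Cser_ext; [|apply Cser_plus; [apply H | apply G]; auto]. intros; simpl; ring.
Qed.

Lemma powser_scal (a : C) f r : powser f r -> powser (fun h => a * f h)%C r.
Proof.
  intros [c H]; exists (fun k => a * c k)%C; intros h Hh.
  eapply Cser_ext; [|apply (Cser_scal a), H; auto]. intros; simpl; ring.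
Qed.

Lemma powser_minus f g r : powser f r -> powser g r -> powser (fun h => f h - g h)%C r.
Proof.
  intros H G. apply powser_ext with (fun h => f h + (- (1)) * g h)%C; [intros; ring|].
  apply powser_plus; auto. now apply powser_scal.
Qed.

Lemma powser_mult_h f r : powser f r -> powser (fun h => h * f h)%C r.
Proof.
  intros [c H]; exists (fun k => match k with O => RtoC 0 | S j => c j end); intros h Hh.
  pose proof (Cser_S (fun k => h ^ k * match k with O => RtoC 0 | S j => c j end)%C (h * f h)%C) as G.
  cbv beta in G. replace (h * f h)%C with (h ^ 0 * RtoC 0 + h * f h)%C by ring. apply G.
  eapply Cser_ext; [|apply (Cser_scal h), H; auto]. intros; simpl; ring.
Qed.

Lemma powser_linear (a b : C) f r : powser f r -> powser (fun h => (a + b * h) * f h)%C r.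
Proof.
  intros H. apply powser_ext with (fun h => a * f h + b * (h * f h))%C; [intros; ring|].
  apply powser_plus; [|apply powser_scal]; [apply powser_scal; auto | now apply powser_mult_h].
Qed.

Lemma powser_const (a : C) r : powser (fun _ => a) r.
Proof.
  exists (fun k => match k with O => a | S _ => RtoC 0 end). intros h _.
  pose proof (Cser_S (fun k => h ^ k * match k with O => a | S _ => RtoC 0 end)%C 0) as G.
  change (Cser (fun k => h ^ k * match k with O => a | S _ => RtoC 0 end)%C a).
  replace (Cser _ a) with (Cser (fun k => h ^ k * match k with O => a | S _ => RtoC 0 end)%C (h ^ 0 * a + 0)%C)
    by (f_equal; simpl; ring). apply G.
  eapply Cser_ext; [|apply Cser_zero]. intros; simpl; ring.
Qed.

Lemma powser_Csum (f : nat -> C -> C) r N :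
  (forall k, (k < N)%nat -> powser (f k) r) -> powser (fun h => Csum (fun k => f k h) N) r.
Proof.
  induction N as [|N IH]; intros H; simpl; [apply powser_const|].
  apply powser_plus; [apply IH; intros; apply H; lia | apply H; lia].
Qed.

Lemma powser_exp (y : C) r : powser (fun h => Cexp (h * y)) r.
Proof.
  exists (fun k => RtoC (/ INR (fact k)) * y ^ k)%C. intros h _.
  replace (h * y)%C with (- (- (h * y)))%C by ring.
  eapply Cser_ext; [|apply Cexp_series]. intros k. simpl.
  replace (- - (h * y))%C with (h * y)%C by ring. rewrite Cpow_mult_l. ring.
Qed.

Lemma Csum_geom (q : C) N : ((q - 1) * Csum (fun l => q ^ l) N = q ^ N - 1)%C.
Proof.
  induction N as [|N IH]; [simpl; ring|].
  change (Csum ?f (S N)) with (Csum f N + f N)%C. cbv beta. rewrite Cmult_plus_distr_l, IH. rewrite Cpow_S. ring.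
Qed.

Lemma Cexp_2PI_nat (n : nat) : Cexp (RtoC (INR n) * (0, 2 * PI)%R)%C = RtoC 1.
Proof.
  rewrite <- Cexp_nat. replace (Cexp (0, 2 * PI)) with (RtoC 1).
  - apply Cpow_1_l.
  - unfold Cexp; apply C_ext; simpl; rewrite exp_0, ?cos_2PI, ?sin_2PI; ring.
Qed.

Lemma Cexp_root_neq_1 (t : R) : 0 < Rabs t < 1 -> Cexp (0, 2 * PI * t) <> RtoC 1.
Proof.
  intros Ht E. apply (f_equal Re) in E. unfold Cexp in E; simpl in E.
  rewrite exp_0, Rmult_1_l in E.
  replace (2 * PI * t) with (2 * (PI * t)) in E by ring. rewrite cos_2a_sin in E.
  assert (Z : sin (PI * t) = 0) by nra.
  pose proof PI_RGT_0 as HP.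
  destruct (Rle_lt_dec 0 t) as [H0|H0].
  - rewrite Rabs_pos_eq in Ht by lra.
    pose proof (sin_gt_0 (PI * t)). nra.
  - rewrite Rabs_left in Ht by lra.
    pose proof (sin_gt_0 (PI * - t)) as G. rewrite Ropp_mult_distr_r_reverse, sin_neg in G. nra.
Qed.

(* Cauchy's estimate, by averaging over the N-th roots of unity: the average of
   f(rho w^l) w^(-l k) is c_k rho^k plus aliasing terms of index >= N. *)
Lemma cauchy_estimate (f : C -> C) c r rho M k :
  pseries_on f c r -> 0 < rho < r -> (forall h, Cmod h < r -> Cmod (f h) <= M) ->
  Cmod (c k) * rho ^ k <= M.
Proof.
  intros H Hr HM. destruct (pseries_abs_cv f c r rho H) as [L HL]; [lra|].
  assert (G : forall N, (k < N)%nat ->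
     Cmod (c k) * rho ^ k <= M + (L - Rsum (fun j => Cmod (c j) * rho ^ j) N)).
  { intros N HN. assert (N0 : 0 < INR N) by (apply lt_0_INR; lia).
    pose (e := fun (l : nat) (t : R) => Cexp (0, 2 * PI * (INR l * t / INR N))).
    assert (Ce : forall l t, Cmod (e l t) = 1) by (intros; unfold e; rewrite Cmod_Cexp; simpl; apply exp_0).
    pose (z := fun l => (RtoC rho * e l 1)%C).
    assert (Cz : forall l, Cmod (z l) = rho).
    { intros; unfold z; rewrite Cmod_mult, Ce, Cmod_R, Rabs_pos_eq; lra. }
    pose (d := fun j => Csum (fun l => RtoC (/ INR N) * e l (INR j - INR k)%R)%C N).
    assert (S1 : Cser (fun j => RtoC (rho ^ j) * c j * d j)%C
       (Csum (fun l => RtoC (/ INR N) * e l (- INR k)%R * f (z l)) N)%C).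
    { eapply Cser_ext; [|apply (Cser_Csum (fun l j => RtoC (/ INR N) * e l (- INR k)%R * (z l ^ j * c j))%C)].
      - intros j. simpl. unfold d. rewrite <- Csum_scal. apply Csum_ext. intros l _.
        unfold z. rewrite Cpow_mult_l, <- RtoC_pow. unfold e. rewrite Cexp_nat.
        replace (0, 2 * PI * (INR l * (INR j - INR k) / INR N))%R with
         ((0, 2 * PI * (INR l * - INR k / INR N))%R + RtoC (INR j) * (0, 2 * PI * (INR l * 1 / INR N))%R)%C.
        + rewrite Cexp_plus. ring.
        + apply C_ext; simpl; field; lra.
      - intros l Hl. apply Cser_scal. apply H. rewrite Cz; lra. }
    assert (dle : forall j, Cmod (d j) <= 1).
    { intros j. replace 1 with (Rsum (fun _ => / INR N) N).
      - apply Csum_Cmod. intros l _. rewrite Cmod_mult, Ce, Cmod_R, Rabs_pos_eq; [lra|].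
        apply Rlt_le, Rinv_0_lt_compat; auto.
      - rewrite Rsum_const. field; lra. }
    assert (dk : d k = RtoC 1).
    { unfold d. rewrite (Csum_ext _ (fun l => RtoC (/ INR N))).
      - rewrite <- RtoC_Rsum. f_equal.
        rewrite Rsum_const. field; lra.
      - intros l _. unfold e. replace (2 * PI * (INR l * (INR k - INR k) / INR N)) with 0 by (field; lra).
        change (Cexp (0, 0)) with (Cexp 0). rewrite Cexp_0. ring. }
    assert (dj : forall j, (j < N)%nat -> j <> k -> d j = RtoC 0).
    { intros j Hj Hne. unfold d. rewrite Csum_scal.
      pose (q := e 1%nat (INR j - INR k)).
      rewrite (Csum_ext _ (fun l => q ^ l)%C).
      2:{ intros l _. unfold q, e. rewrite Cexp_nat. f_equal. apply C_ext; simpl; field; lra. }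
      assert (q1 : q <> RtoC 1).
      { unfold q, e. apply Cexp_root_neq_1. simpl. rewrite Rmult_1_l.
        assert (Rabs (INR j - INR k) < INR N).
        { apply lt_INR in Hj, HN. pose proof (pos_INR j); pose proof (pos_INR k). apply Rabs_def1; lra. }
        assert (0 < Rabs (INR j - INR k)).
        { apply Rabs_pos_lt. intros E. apply Hne, INR_eq. lra. }
        unfold Rdiv. rewrite Rabs_mult, (Rabs_pos_eq (/ INR N)) by (apply Rlt_le, Rinv_0_lt_compat; auto).
        split; [apply Rmult_lt_0_compat; auto; apply Rinv_0_lt_compat; auto|].
        apply Rmult_lt_reg_r with (INR N); auto. rewrite Rmult_assoc, Rinv_l by lra. lra. }
      pose proof (Csum_geom q N) as G.
      replace (q ^ N)%C with (RtoC 1) in G.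
      - replace (Csum (fun l => q ^ l)%C N) with (/ (q - 1) * ((q - 1) * Csum (fun l => q ^ l) N))%C.
        + rewrite G. ring.
        + field. intros E. apply q1. replace q with ((q - 1) + 1)%C by ring. rewrite E; ring.
      - unfold q, e. rewrite Cexp_nat.
        replace (RtoC (INR N) * (0, 2 * PI * (INR 1 * (INR j - INR k) / INR N))%R)%C with
          (RtoC (INR j) * (0, 2 * PI)%R + - (RtoC (INR k) * (0, 2 * PI)%R))%C.
        + rewrite Cexp_plus, Cexp_opp, !Cexp_2PI_nat, Cmult_1_l, <- RtoC_inv by lra. now rewrite Rinv_1.
        + apply C_ext; simpl; field; lra. }
    assert (F1 : Csum (fun j => RtoC (rho ^ j) * c j * d j)%C N = (RtoC (rho ^ k) * c k)%C).
    { assert (Q : forall n, (k < n <= N)%nat ->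
        Csum (fun j => RtoC (rho ^ j) * c j * d j)%C n = (RtoC (rho ^ k) * c k)%C); [|apply Q; lia].
      induction n as [|n IH]; intros Hn; [lia|].
      change (Csum ?g (S n)) with (Csum g n + g n)%C. cbv beta.
      destruct (Nat.eq_dec k n) as [<-|Hne].
      - rewrite dk. rewrite (Csum_ext _ (fun _ => RtoC 0)); [rewrite Csum_zero; ring|].
        intros j Hj. rewrite dj by lia. ring.
      - rewrite (dj n) by lia. rewrite IH by lia. ring. }
    destruct (Cser_abs (fun j => RtoC (rho ^ j) * c j * d j)%C (fun j => Cmod (c j) * rho ^ j) L) with (2 := HL) as [s [Hs [_ T]]].
    { intros j. rewrite !Cmod_mult, Cmod_R, Rabs_pos_eq by (apply pow_le; lra).
      rewrite <- (Rmult_1_r (Cmod (c j) * rho ^ j)).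
      rewrite (Rmult_comm (rho ^ j)). apply Rmult_le_compat_l; auto.
      apply Rmult_le_pos; [apply Cmod_ge_0 | apply pow_le; lra]. }
    rewrite (Cser_unique _ _ _ Hs S1) in T. specialize (T N). rewrite F1 in T.
    assert (A : Cmod (Csum (fun l => RtoC (/ INR N) * e l (- INR k)%R * f (z l)) N)%C <= M).
    { replace M with (Rsum (fun _ => / INR N * M) N).
      - apply Csum_Cmod. intros l _. rewrite !Cmod_mult, Ce, Cmod_R, Rabs_pos_eq by (apply Rlt_le, Rinv_0_lt_compat; auto).
        rewrite Rmult_1_r. apply Rmult_le_compat_l; [apply Rlt_le, Rinv_0_lt_compat; auto|].
        apply HM. rewrite Cz; lra.
      - rewrite Rsum_const. field; lra. }
    replace (Cmod (c k) * rho ^ k) with (Cmod (RtoC (rho ^ k) * c k)%C).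
    2:{ rewrite Cmod_mult, Cmod_R, Rabs_pos_eq by (apply pow_le; lra). ring. }
    pose proof (Cmod_triangle (Csum (fun l => RtoC (/ INR N) * e l (- INR k)%R * f (z l)) N)%C
       (RtoC (rho ^ k) * c k - Csum (fun l => RtoC (/ INR N) * e l (- INR k)%R * f (z l)) N)%C) as Q.
    replace (_ + (_ - _))%C with (RtoC (rho ^ k) * c k)%C in Q by ring.
    rewrite Cmod_minus_sym in Q. lra. }
  apply Rle_plus_epsilon. intros eps He.
  destruct (proj1 (is_lim_seq_eps _ _) HL eps He) as [N HN].
  specialize (HN (N + S k)%nat ltac:(lia)). specialize (G (N + S k)%nat ltac:(lia)).
  apply Rabs_def2 in HN. lra.
Qed.

Lemma weierstrass_series (f : nat -> C -> C) (F : C -> C) (r : R) (M : nat -> R) (LM : R) :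
  0 < r -> (forall n, powser (f n) r) ->
  (forall n h, Cmod h < r -> Cmod (f n h) <= M n) -> Rser M LM ->
  (forall h, Cmod h < r -> Cser (fun n => f n h) (F h)) -> powser F (r / 2).
Proof.
  intros Hr Hf HM HL HF.
  destruct (choice_nat _ Hf) as [c Hc].
  pose (rho := 3 / 4 * r).
  assert (M0 : forall n, 0 <= M n).
  { intros n. eapply Rle_trans; [apply Cmod_ge_0 | apply (HM n 0)]. rewrite Cmod_0; lra. }
  assert (B : forall n k, Cmod (c n k) * rho ^ k <= M n).
  { intros n k. apply (cauchy_estimate (f n) (c n) r rho); auto. unfold rho; lra. }
  assert (P : forall k, 0 < rho ^ k) by (intros; apply pow_lt; unfold rho; lra).
  assert (B' : forall n k, Cmod (c n k) <= / rho ^ k * M n).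
  { intros n k. specialize (B n k). specialize (P k).
    apply Rmult_le_reg_l with (rho ^ k); auto. rewrite <- Rmult_assoc, Rinv_r, Rmult_1_l by lra. lra. }
  assert (D : forall k, exists s, Cser (fun n => c n k) s).
  { intros k. destruct (Cser_abs (fun n => c n k) (fun n => / rho ^ k * M n) (/ rho ^ k * LM)) as [s [Hs _]]; [auto| |].
    - now apply Rser_scal.
    - now exists s. }
  destruct (choice_nat _ D) as [d Hd]. exists d. intros h Hh.
  pose (q := Cmod h / rho).
  assert (Hq : 0 <= q < 1).
  { unfold q. split; [apply Rdiv_le_0_compat; [apply Cmod_ge_0 | unfold rho; lra]|].
    apply Rmult_lt_reg_r with rho; [unfold rho; lra|]. unfold Rdiv.
    rewrite Rmult_assoc, Rinv_l by (unfold rho; lra). unfold rho; lra. }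
  assert (T : forall n k, Cmod (h ^ k * c n k)%C <= M n * q ^ k).
  { intros n k. rewrite Cmod_mult, Cmod_pow, <- (pow_ratio (Cmod h) rho) by (unfold rho; lra).
    fold q. specialize (B n k).
    replace (q ^ k * rho ^ k * Cmod (c n k)) with (Cmod (c n k) * rho ^ k * q ^ k) by ring.
    apply Rmult_le_compat_r; auto. apply pow_le; lra. }
  apply (tannery (fun n K => Csum (fun k => h ^ k * c n k)%C K) (fun n => f n h)
     (fun n => / (1 - q) * M n) (/ (1 - q) * LM)).
  - intros n K. apply Rle_trans with (Rsum (fun k => M n * q ^ k) K); [apply Csum_Cmod; auto|].
    rewrite Rsum_scal, Rmult_comm. apply Rmult_le_compat_r; auto.
    apply Rser_ge_sum; [intros; apply pow_le; lra | apply Rser_geom; lra].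
  - now apply Rser_scal.
  - intros n. apply Hc. lra.
  - intros K. apply Cser_Csum. intros k _. now apply Cser_scal.
  - apply HF; lra.
Qed.

Lemma powser_div (f : C -> C) (d : C) (r : R) :
  0 < r -> r <= Cmod d / 2 -> powser f (2 * r) -> powser (fun h => f h / (d - h))%C (r / 2).
Proof.
  intros Hr Hd [c Hc].
  destruct (pseries_bounded f c (2 * r) r Hc) as [M HM]; [lra|].
  assert (d0 : d <> RtoC 0) by (apply Cmod_gt_0; lra).
  pose (g := fun n h => (f h * h ^ n / d ^ (S n))%C).
  assert (M0 : 0 <= M) by (eapply Rle_trans; [apply Cmod_ge_0 | apply (HM 0); rewrite Cmod_0; lra]).
  apply (weierstrass_series g _ r (fun n => M / Cmod d * (1 / 2) ^ n) (M / Cmod d * / (1 - 1 / 2))); auto.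
  - intros n. unfold g. apply powser_ext with (fun h => (/ d ^ S n) * (h ^ n * f h))%C.
    { intros; unfold Cdiv; ring. }
    apply powser_scal. clear g. induction n as [|n IH].
    + apply powser_ext with f; [intros; simpl; ring|]. exists c; intros h Hh; apply Hc; lra.
    + apply powser_ext with (fun h => h * (h ^ n * f h))%C; [intros; simpl; ring|]. now apply powser_mult_h.
  - intros n h Hh. unfold g. rewrite Cmod_div by now apply Cpow_nz.
    rewrite Cmod_mult, !Cmod_pow. simpl.
    assert (Hq : Cmod h ^ n <= (1 / 2) ^ n * Cmod d ^ n).
    { rewrite <- Rpow_mult_distr. apply pow_incr. split; [apply Cmod_ge_0 | lra]. }
    assert (P : 0 < Cmod d ^ n) by (apply pow_lt; lra).
    assert (P1 : 0 <= Cmod h ^ n) by (apply pow_le, Cmod_ge_0).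
    assert (P2 : 0 < Cmod d) by lra.
    specialize (HM h ltac:(lra)).
    apply Rmult_le_reg_r with (Cmod d * Cmod d ^ n); [now apply Rmult_lt_0_compat|].
    unfold Rdiv at 1. rewrite Rmult_assoc, Rinv_l, Rmult_1_r by (apply Rgt_not_eq; now apply Rmult_lt_0_compat).
    replace (M / Cmod d * (1 / 2) ^ n * (Cmod d * Cmod d ^ n)) with (M * ((1 / 2) ^ n * Cmod d ^ n)) by (field; lra).
    apply Rmult_le_compat; auto using Cmod_ge_0.
  - apply Rser_scal, Rser_geom; lra.
  - intros h Hh.
    assert (d1 : (d - h)%C <> RtoC 0).
    { intros E. assert (d = h) by (replace d with ((d - h) + h)%C by ring; rewrite E; ring). subst. lra. }
    destruct (Cser_abs (fun n => (h / d) ^ n)%C (fun n => (1 / 2) ^ n) (/ (1 - 1 / 2))) as [s [Hs _]].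
    + intros n. rewrite Cmod_pow, Cmod_div by auto. apply pow_incr. split.
      * apply Rdiv_le_0_compat; [apply Cmod_ge_0 | lra].
      * apply Rmult_le_reg_r with (Cmod d); [lra|]. unfold Rdiv at 1. rewrite Rmult_assoc, Rinv_l by lra. lra.
    + apply Rser_geom; lra.
    + assert (Es : (s = d / (d - h))%C).
      { pose proof (Cser_S (fun n => (h / d) ^ n)%C (h / d * s)%C) as G. cbv beta in G.
        assert (E : s = ((h / d) ^ 0 + h / d * s)%C).
        { apply (Cser_unique _ _ _ Hs). apply G. eapply Cser_ext; [|apply (Cser_scal (h / d)), Hs].
          intros; simpl; ring. }
        simpl in E. 
        assert (E2 : (s * (d - h) = d)%C).
        { transitivity (d * (s - h / d * s))%C; [field; auto|]. rewrite E at 1. field; auto. }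
        rewrite <- E2 at 1. field; auto. }
      subst s.
      replace (f h / (d - h))%C with (f h / d * (d / (d - h)))%C by (field; auto).
      eapply Cser_ext; [|apply (Cser_scal (f h / d)), Hs]. intros n. unfold g. simpl.
      unfold Cdiv. rewrite Cpow_mult_l, Cpow_inv by auto. field. split; auto using Cpow_nz.
Qed.

Lemma pseries_zero_coef (f : C -> C) c r :
  0 < r -> pseries_on f c r ->
  (forall e, 0 < e -> exists h, 0 < Cmod h < e /\ f h = RtoC 0) -> forall k, c k = RtoC 0.
Proof.
  intros Hr H Z.
  pose (rho := r / 2).
  destruct (pseries_coef_bound f c r rho H) as [B [HB1 HB]]; [unfold rho; lra|].
  intros k. induction k as [k IH] using (well_founded_induction Wf_nat.lt_wf).
  destruct (Rle_lt_or_eq_dec 0 (Cmod (c k)) (Cmod_ge_0 _)) as [Hp|He]; [exfalso|now apply Cmod_eq_0].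
  pose (K := 2 * B / rho ^ S k).
  assert (P : forall j, 0 < rho ^ j) by (intros; apply pow_lt; unfold rho; lra).
  assert (K0 : 0 < K) by (unfold K; apply Rdiv_lt_0_compat; [lra | auto]).
  assert (He0 : 0 < Rmin (rho / 2) (Cmod (c k) / (2 * K))).
  { apply Rmin_glb_lt; [unfold rho; lra|]. apply Rdiv_lt_0_compat; lra. }
  destruct (Z _ He0) as [h [[Hh1 Hh2] Hf]].
  assert (Hha : Cmod h < rho / 2) by (eapply Rlt_le_trans; [exact Hh2 | apply Rmin_l]).
  assert (Hhb : Cmod h < Cmod (c k) / (2 * K)) by (eapply Rlt_le_trans; [exact Hh2 | apply Rmin_r]).
  specialize (H h ltac:(unfold rho in *; lra)). rewrite Hf in H.
  pose (q := Cmod h / rho).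
  assert (Hq : 0 < q < 1 / 2).
  { unfold q; split; [apply Rdiv_lt_0_compat; unfold rho in *; lra|].
    apply Rmult_lt_reg_r with rho; [unfold rho; lra|]. unfold Rdiv at 1.
    rewrite Rmult_assoc, Rinv_l by (unfold rho; lra). lra. }
  assert (T : Cmod (h ^ k * c k)%C <= B * (q ^ S k) * 2).
  { assert (E : Csum (fun j => h ^ j * c j)%C k = RtoC 0).
    { rewrite (Csum_ext _ (fun _ => RtoC 0)); [apply Csum_zero|]. intros j Hj. rewrite IH by auto. ring. }
    replace (h ^ k * c k)%C with (Csum (fun j => h ^ j * c j)%C (S k)) by (simpl; rewrite E; ring).
    assert (L : Cser (fun j => h ^ (S k + j) * c (S k + j)%nat)%C (- Csum (fun j => h ^ j * c j)%C (S k))%C).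
    { apply Clim_ext with (fun n => Csum (fun j => h ^ j * c j)%C (S k + n) - Csum (fun j => h ^ j * c j)%C (S k))%C.
      - intros n. rewrite Csum_add. ring.
      - replace (- _)%C with (0 - Csum (fun j => h ^ j * c j)%C (S k))%C by ring.
        apply Clim_minus; [|apply Clim_const].
        assert (G : forall m, Clim (fun n => Csum (fun j => h ^ j * c j)%C (m + n)) 0).
        { induction m as [|m IHm]; [exact H|]. apply (proj2 (Clim_incr _ _)) in IHm.
          eapply Clim_ext; [|exact IHm]. intros n. cbv beta; now rewrite Nat.add_succ_r. }
        apply G. }
    destruct (Cser_abs (fun j => h ^ (S k + j) * c (S k + j)%nat)%C (fun j => B * q ^ S k * q ^ j) (B * q ^ S k * / (1 - q))) as [s [Hs [Bs _]]].
    - intros j. rewrite Cmod_mult, Cmod_pow, <- (pow_ratio (Cmod h) rho) by (unfold rho; lra).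
      fold q. specialize (HB (S k + j)%nat).
      replace (B * q ^ S k * q ^ j) with (q ^ (S k + j) * B) by (rewrite pow_add; ring).
      rewrite Rmult_assoc. apply Rmult_le_compat_l; [apply pow_le; lra | lra].
    - apply Rser_scal, Rser_geom; lra.
    - rewrite (Cser_unique _ _ _ Hs L), Cmod_opp in Bs. eapply Rle_trans; [exact Bs|].
      apply Rmult_le_compat_l; [apply Rmult_le_pos; [lra | apply pow_le; lra]|].
      rewrite <- (Rinv_inv 2). apply Rinv_le_contravar; lra. }
  rewrite Cmod_mult, Cmod_pow in T.
  assert (T2 : Cmod h ^ k * Cmod (c k) <= Cmod h ^ k * (K * Cmod h)).
  { eapply Rle_trans; [exact T|]. unfold K, q, Rdiv. rewrite Rpow_mult_distr, pow_inv. simpl. apply Req_le. field.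
    split; [apply Rgt_not_eq, P | unfold rho; lra]. }
  apply Rmult_le_reg_l in T2; [|apply pow_lt; auto].
  assert (K * Cmod h < K * (Cmod (c k) / (2 * K))) by (apply Rmult_lt_compat_l; auto).
  replace (K * (Cmod (c k) / (2 * K))) with (Cmod (c k) / 2) in H0 by (field; lra). lra.
Qed.

(** * The Riemann zeta function *)

Fixpoint falling (s : C) (i : nat) : C :=
  match i with O => RtoC 1 | S j => (falling s j * (s - RtoC (INR j)))%C end.

(* The successive derivatives of x^(1-s) / (1-s). *)
Definition power_family (s : C) (i : nat) (x : R) : C :=
  match i with
  | O => (Cexp ((1 - s) * RtoC (ln x)) / (1 - s))%C
  | S j => (falling (- s) j * Cexp ((- s - RtoC (INR j)) * RtoC (ln x)))%C
  end.

Lemma is_derive_ln_pos (x : R) : 0 < x -> is_derive ln x (/ x).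
Proof. intros. apply is_derive_Reals. now apply derivable_pt_lim_ln. Qed.

Lemma Cder_exp_ln (w : C) (x : R) : 0 < x ->
  Cder (fun t => Cexp (w * RtoC (ln t))) x (w * Cexp ((w - 1) * RtoC (ln x)))%C.
Proof.
  intros Hx. eapply Cder_eq.
  - apply Cder_Cexp, (Cder_scal w), Cder_RtoC, is_derive_ln_pos; auto.
  - cbv beta. replace ((w - 1) * RtoC (ln x))%C with (w * RtoC (ln x) + RtoC (- ln x))%C
      by (rewrite RtoC_opp; ring).
    rewrite Cexp_plus, Cexp_RtoC, exp_Ropp, exp_ln by auto. ring.
Qed.

Lemma one_minus_neq (s : C) : s <> RtoC 1 -> (1 - s)%C <> RtoC 0.
Proof. intros H E. apply H. replace s with (1 - (1 - s))%C by ring. rewrite E; ring. Qed.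

Lemma power_family_Cder (s : C) i x : s <> RtoC 1 -> 0 < x ->
  Cder (power_family s i) x (power_family s (S i) x).
Proof.
  intros Hs Hx. apply one_minus_neq in Hs. destruct i as [|i]; cbn [power_family falling].
  - eapply Cder_eq.
    + apply Cder_ext with (fun t => / (1 - s) * Cexp ((1 - s) * RtoC (ln t)))%C;
        [intros; cbn [power_family]; unfold Cdiv; ring|]. apply Cder_scal, Cder_exp_ln; auto.
    + rewrite Cmult_assoc, Cinv_l, !Cmult_1_l by auto. simpl. f_equal. ring.
  - eapply Cder_eq; [apply Cder_scal, Cder_exp_ln; auto|].
    rewrite Cmult_assoc. f_equal. f_equal.
    rewrite S_INR, RtoC_plus. ring.
Qed.

Lemma Cmod_exp_ln (w : C) x : Cmod (Cexp (w * RtoC (ln x))) = Rpower x (Re w).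
Proof. rewrite Cmod_Cexp. unfold Rpower. f_equal. simpl; unfold Re; ring. Qed.

Lemma power_family_mod (s : C) i x :
  Cmod (power_family s (S i) x) = Cmod (falling (- s) i) * Rpower x (- (Re s + INR i)).
Proof.
  simpl. rewrite Cmod_mult, Cmod_exp_ln. do 2 f_equal. simpl. unfold Re; ring.
Qed.

Definition zeta_value (s l : C) : Prop :=
  forall m, (0 < m)%nat -> 1 < Re s + INR m -> Clim (em_partial m (power_family s)) l.

Lemma power_family_em (s : C) m : s <> RtoC 1 -> (0 < m)%nat -> 1 < Re s + INR m ->
  exists z, Cser (em_rem m (power_family s)) z /\
    Clim (em_partial m (power_family s)) (z - em_bdry m (power_family s) 1)%C.
Proof.
  intros Hs Hm H. destruct (Rpower_summable _ H) as [l Hl].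
  destruct (em_converges m (power_family s) (Cmod (falling (- s) m)) (Re s + INR m) l) as [z [H1 [_ H2]]]; auto.
  - intros; apply power_family_Cder; auto; lra.
  - apply Cmod_ge_0.
  - intros x Hx. rewrite power_family_mod. lra.
  - now exists z.
Qed.

Lemma em_partial_succ (s : C) m l : 1 < Re s + INR m ->
  (Clim (em_partial m (power_family s)) l <-> Clim (em_partial (S m) (power_family s)) l).
Proof.
  intros H.
  assert (Z : Clim (fun M => RtoC (bern (S m)) * power_family s (S m) (INR (S M)))%C 0).
  { apply Clim_squeeze with (fun M => Rabs (bern (S m)) * Cmod (falling (- s) m) * Rpower (INR (S M)) (- (Re s + INR m))).
    - intros M. replace (RtoC (bern (S m)) * power_family s (S m) (INR (S M)) - 0)%C with
        (RtoC (bern (S m)) * power_family s (S m) (INR (S M)))%C by ring.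
      rewrite Cmod_mult, power_family_mod, Cmod_R. lra.
    - apply lim0_mult_const, Rpower_neg_lim0. lra. }
  assert (E : forall M, em_partial (S m) (power_family s) M =
    (em_partial m (power_family s) M - RtoC (bern (S m)) * power_family s (S m) (INR (S M)))%C).
  { intros M. unfold em_partial, em_bdry.
    change (Csum ?g (S (S m))) with (Csum g (S m) + g (S m))%C. cbv beta. ring. }
  split; intros L.
  - replace l with (l - 0)%C by ring. eapply Clim_ext; [intros; symmetry; apply E|].
    now apply Clim_minus.
  - replace l with (l + 0)%C by ring.
    apply Clim_ext with (fun M => em_partial (S m) (power_family s) M +
       RtoC (bern (S m)) * power_family s (S m) (INR (S M)))%C.
    + intros M. rewrite E. ring.
    + now apply Clim_plus.
Qed.

Lemma zeta_value_of (s l : C) m : (0 < m)%nat -> 1 < Re s + INR m ->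
  Clim (em_partial m (power_family s)) l -> zeta_value s l.
Proof.
  intros Hm H L. 
  assert (U : forall n, Clim (em_partial (n + m) (power_family s)) l).
  { induction n as [|n IH]; auto. apply -> (em_partial_succ s (n + m) l); [exact IH|].
    rewrite plus_INR. pose proof (pos_INR n). lra. }
  intros k Hk Hk'. specialize (U k). rewrite Nat.add_comm in U.
  assert (V : forall n, Clim (em_partial (n + k) (power_family s)) l -> Clim (em_partial k (power_family s)) l).
  { induction n as [|n IH]; auto. intros Q. apply IH. apply <- (em_partial_succ s (n + k) l); [exact Q|].
    rewrite plus_INR. pose proof (pos_INR n). lra. }
  apply (V m U).
Qed.

Lemma exists_nat_above (x : R) : exists n, 0 < x + INR n + 1.
Proof.
  destruct (nfloor_ex (Rabs x)) as [n Hn]; [apply Rabs_pos|]. exists n.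
  pose proof (Rle_abs (- x)) as H. rewrite Rabs_Ropp in H. lra.
Qed.

Lemma zeta_value_ex (s : C) : s <> RtoC 1 -> exists l, zeta_value s l.
Proof.
  intros Hs. destruct (exists_nat_above (Re s)) as [n Hn].
  assert (1 < Re s + INR (n + 2)).
  { rewrite plus_INR. simpl. lra. }
  destruct (power_family_em s (n + 2)) as [z [_ L]]; auto; [lia|].
  eexists. apply (zeta_value_of _ _ (n + 2)); [lia | exact H | exact L].
Qed.

Definition zeta_em (s : C) : C := epsilon (inhabits (RtoC 0)) (zeta_value s).

Lemma zeta_em_spec (s : C) : s <> RtoC 1 -> zeta_value s (zeta_em s).
Proof. intros H. apply (epsilon_spec (inhabits (RtoC 0)) (zeta_value s)). now apply zeta_value_ex. Qed.

Lemma Carg_pos (x : R) : 0 < x -> Carg (RtoC x) = 0.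
Proof.
  intros Hx. unfold Carg. rewrite Cmod_R, Rabs_pos_eq by lra. simpl.
  destruct (Rlt_dec 0 0); [lra|]. unfold Rdiv; rewrite Rinv_r by lra. apply acos_1.
Qed.

Lemma Cpower_pos_base (x : R) (w : C) : 0 < x -> Cpower (RtoC x) w = Cexp (w * RtoC (ln x)).
Proof.
  intros Hx. unfold Cpower, Cln. rewrite Carg_pos, Cmod_R, Rabs_pos_eq by lra. reflexivity.
Qed.

Lemma zeta_em_series (s : C) : 1 < Re s ->
  Cser (fun n => power_family s 1 (INR (S n))) (zeta_em s).
Proof.
  intros H.
  assert (Hs : s <> RtoC 1) by (intros ->; simpl in H; lra).
  pose proof (zeta_em_spec s Hs 1%nat ltac:(lia) ltac:(simpl; lra)) as L.
  assert (B : Clim (fun M => em_bdry 1 (power_family s) (INR (S M))) 0).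
  { apply Clim_squeeze with (fun M =>
      Rabs (bern 0) * / Cmod (1 - s)%C * Rpower (INR (S M)) (- (Re s - 1)) +
      Rabs (bern 1) * Cmod (falling (- s) 0) * Rpower (INR (S M)) (- (Re s + INR 0))).
    - intros M. unfold em_bdry. replace (Csum _ 2 - 0)%C with
       (RtoC (bern 0) * power_family s 0 (INR (S M)) + RtoC (bern 1) * power_family s 1 (INR (S M)))%C
        by (cbn [Csum]; ring).
      eapply Rle_trans; [apply Cmod_triangle|].
      rewrite !Cmod_mult, power_family_mod, !Cmod_R. unfold power_family.
      rewrite Cmod_div, Cmod_exp_ln by now apply one_minus_neq.
      replace (Re (1 - s)%C) with (- (Re s - 1)) by (simpl; unfold Re; ring). unfold Rdiv. lra.
    - apply lim0_plus; apply lim0_mult_const, Rpower_neg_lim0; simpl; lra. }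
  replace (zeta_em s) with (zeta_em s + 0)%C by ring.
  eapply Clim_ext; [|apply (Clim_plus _ _ _ _ L B)].
  intros M. unfold em_partial. cbv beta. ring.
Qed.

Lemma falling_bounded (s0 : C) i : exists K, 0 <= K /\
  forall h, Cmod h < 1 -> Cmod (falling (- (s0 + h)) i) <= K.
Proof.
  induction i as [|i [K [K0 HK]]]; [exists 1; split; [lra|]; intros; simpl; rewrite Cmod_1; lra|].
  exists (K * (Cmod s0 + 1 + INR i)). pose proof (Cmod_ge_0 s0). pose proof (pos_INR i).
  split; [apply Rmult_le_pos; lra|]. intros h Hh. simpl. rewrite Cmod_mult.
  apply Rmult_le_compat; auto using Cmod_ge_0.
  eapply Rle_trans; [apply Cmod_minus_le|]. rewrite Cmod_opp, Cmod_R, Rabs_pos_eq by auto.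
  pose proof (Cmod_triangle s0 h). lra.
Qed.

Lemma powser_power_family (s0 : C) i x r :
  (forall h, Cmod h < r -> (1 - (s0 + h))%C <> RtoC 0) ->
  powser (fun h => (1 - s0 - h) * power_family (s0 + h) i x)%C r.
Proof.
  intros Hn. destruct i as [|i].
  - apply powser_ext with (fun h => Cexp ((1 - s0) * RtoC (ln x)) * Cexp (h * - RtoC (ln x)))%C.
    + intros h Hh. rewrite <- Cexp_plus. simpl.
      replace ((1 - s0) * RtoC (ln x) + h * - RtoC (ln x))%C with ((1 - (s0 + h)) * RtoC (ln x))%C by ring.
      specialize (Hn h Hh). field. auto.
    + apply powser_scal, powser_exp.
  - apply powser_ext with (fun h => ((1 - s0) + (- (1)) * h) *
       (Cexp ((- s0 - RtoC (INR i)) * RtoC (ln x)) * (falling (- (s0 + h)) i * Cexp (h * - RtoC (ln x)))))%C.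
    + intros h Hh. simpl power_family.
      replace ((- (s0 + h) - RtoC (INR i)) * RtoC (ln x))%C with
        ((- s0 - RtoC (INR i)) * RtoC (ln x) + h * - RtoC (ln x))%C by ring.
      rewrite Cexp_plus. ring.
    + apply powser_linear, powser_scal. clear Hn. induction i as [|i IH].
      * apply powser_ext with (fun h => Cexp (h * - RtoC (ln x))); [intros; simpl; ring | apply powser_exp].
      * apply powser_ext with (fun h => ((- s0 - RtoC (INR i)) + (- (1)) * h) *
          (falling (- (s0 + h)) i * Cexp (h * - RtoC (ln x))))%C.
        -- intros; simpl. ring.
        -- now apply powser_linear.
Qed.

Lemma zeta_em_analytic (s0 : C) : s0 <> RtoC 1 -> analytic_at zeta_em s0.
Proof.
  intros Hs.
  pose (d := (1 - s0)%C).
  assert (d0 : 0 < Cmod d) by (apply Cmod_gt_0; now apply one_minus_neq).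
  pose (r := Rmin 1 (Cmod d)).
  assert (Hr : 0 < r) by (apply Rmin_glb_lt; lra).
  assert (r1 : r <= 1) by apply Rmin_l. assert (rd : r <= Cmod d) by apply Rmin_r.
  assert (Hn : forall h, Cmod h < r -> (1 - (s0 + h))%C <> RtoC 0).
  { intros h Hh E. assert (d = h) by (replace h with (d - (1 - (s0 + h)))%C by (unfold d; ring); rewrite E; ring).
    subst h. lra. }
  destruct (exists_nat_above (Re s0)) as [n0 Hn0].
  pose (m := (n0 + 4)%nat). 
  assert (Hm : 3 < Re s0 + INR m).
  { unfold m; rewrite plus_INR. simpl. lra. }
  destruct (falling_bounded s0 m) as [K [K0 HK]].
  destruct (Rpower_summable 2) as [LM HLM]; [lra|].
  assert (Hre : forall h, Cmod h < r -> 2 < Re (s0 + h)%C + INR m).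
  { intros h Hh. rewrite Re_plus. pose proof (re_le_Cmod h) as G. apply Rabs_le_between in G. lra. }
  assert (Hns : forall h, Cmod h < r -> (s0 + h)%C <> RtoC 1).
  { intros h Hh E. apply (Hn h Hh). rewrite E; ring. }
  pose (f := fun n h => ((1 - s0 - h) * em_rem m (power_family (s0 + h)) n)%C).
  pose (bd := fun h => ((1 - s0 - h) * em_bdry m (power_family (s0 + h)) 1)%C).
  pose (T := fun h => ((1 - s0 - h) * (zeta_em (s0 + h) + em_bdry m (power_family (s0 + h)) 1))%C).
  assert (P1 : powser T (r / 2)).
  { apply (weierstrass_series f T r (fun n => (Cmod d + 1) * emB m * K * Rpower (INR (S n)) (- (2))) ((Cmod d + 1) * emB m * K * LM)); auto.
    - intros n. unfold f, em_rem.
      apply powser_ext with (fun h => (1 - s0 - h) * power_family (s0 + h) 1 (INR (S n)) -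
        Csum (fun i => RtoC (bern i) * ((1 - s0 - h) * power_family (s0 + h) i (INR (S (S n))) - (1 - s0 - h) * power_family (s0 + h) i (INR (S n)))) (S m))%C.
      + intros h Hh.
        rewrite (Csum_ext _ (fun i => (1 - s0 - h) * (RtoC (bern i) *
          (power_family (s0 + h) i (INR (S (S n))) - power_family (s0 + h) i (INR (S n)))))%C)
          by (intros; ring).
        rewrite Csum_scal. ring.
      + apply powser_minus; [now apply powser_power_family|]. apply powser_Csum. intros i _.
        apply powser_scal, powser_minus; now apply powser_power_family.
    - intros n h Hh. unfold f. rewrite Cmod_mult, !Rmult_assoc. apply Rmult_le_compat; auto using Cmod_ge_0.
      { replace (1 - s0 - h)%C with (d - h)%C by (unfold d; ring).
        eapply Rle_trans; [apply Cmod_minus_le|]. lra. }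
      specialize (Hre h Hh). pose proof (emB_pos m).
      rewrite <- Rmult_assoc.
      apply Rle_trans with (emB m * K * Rpower (INR (S n)) (- (Re (s0 + h)%C + INR m))).
      + apply em_rem_le; auto; [unfold m; lia| |lra|].
        * intros; apply power_family_Cder; auto; lra.
        * intros x Hx. rewrite power_family_mod. apply Rmult_le_compat_r; [apply Rlt_le, Rpower_pos|].
          apply HK. lra.
      + apply Rmult_le_compat_l; [now apply Rmult_le_pos|]. apply Rpower_le_exponent; [apply xn_ge1 | lra].
    - now apply Rser_scal.
    - intros h Hh. specialize (Hre h Hh). specialize (Hns h Hh). unfold f, T. apply Cser_scal.
      destruct (power_family_em (s0 + h) m) as [z [Hz L]]; auto; [unfold m; lia | lra |].
      rewrite (Clim_unique _ _ _ (zeta_em_spec _ Hns m ltac:(unfold m; lia) ltac:(lra)) L).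
      replace (z - _ + _)%C with z by ring. auto. }
  assert (P2 : powser bd r).
  { unfold bd, em_bdry.
    apply powser_ext with (fun h => Csum (fun i => RtoC (bern i) * ((1 - s0 - h) * power_family (s0 + h) i 1)) (S m))%C.
    - intros h Hh. rewrite <- Csum_scal. apply Csum_ext; intros; ring.
    - apply powser_Csum. intros i _. now apply powser_scal, powser_power_family. }
  assert (P3 : powser (fun h => T h - bd h)%C (2 * (r / 4))).
  { replace (2 * (r / 4)) with (r / 2) by field. apply powser_minus; auto.
    apply powser_mono with r; auto; lra. }
  apply (powser_div _ d) in P3; try lra.
  destruct P3 as [c Hc]. exists c, (r / 4 / 2). split; [lra|].
  intros h Hh. apply is_pseries_Cser.
  replace (zeta_em (s0 + h)) with ((T h - bd h) / (d - h))%C; [now apply Hc|].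
  unfold T, bd, d. assert (Hh' : Cmod h < r) by lra. specialize (Hn h Hh'). field.
  intros E; apply Hn. rewrite <- E; ring.
Qed.

Lemma zeta_em_is_zeta : is_riemann_zeta zeta_em.
Proof.
  split; [|exact zeta_em_analytic].
  intros s Hs. apply is_series_Cser. eapply Cser_ext; [|apply zeta_em_series; auto].
  intros n. rewrite Cpower_pos_base by (pose proof (xn_ge1 n); lra). simpl.
  rewrite Cmult_1_l. do 2 f_equal. ring.
Qed.

Definition zero_near (f : C -> C) (z : C) : Prop :=
  exists e, 0 < e /\ forall h, Cmod h < e -> f (z + h)%C = RtoC 0.

Lemma zero_near_of_accumulation (f : C -> C) (z : C) :
  analytic_at f z ->
  (forall e, 0 < e -> exists h, 0 < Cmod h < e /\ f (z + h)%C = RtoC 0) -> zero_near f z.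
Proof.
  intros [c [r [Hr Hc]]] Z.
  assert (H : pseries_on (fun h => f (z + h)%C) c r).
  { intros h Hh. apply is_pseries_Cser; auto. }
  pose proof (pseries_zero_coef _ c r Hr H Z) as E.
  exists r; split; auto. intros h Hh. apply (Cser_unique _ _ _ (H h Hh)).
  eapply Cser_ext; [|apply Cser_zero]. intros k; simpl. rewrite E. ring.
Qed.

Lemma identity_along_segment (f : C -> C) (p v : C) :
  v <> RtoC 0 ->
  (forall t, 0 <= t <= 1 -> analytic_at f (p + RtoC t * v)%C) -> zero_near f p ->
  zero_near f (p + v)%C.
Proof.
  intros Hv An Z0. apply Cmod_gt_0 in Hv.
  pose (E := fun t => 0 <= t <= 1 /\ forall u, 0 <= u <= t -> zero_near f (p + RtoC u * v)%C).
  assert (E0 : E 0).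
  { split; [lra|]. intros u Hu. replace u with 0 by lra. replace (p + 0 * v)%C with p by ring. auto. }
  destruct (completeness E) as [tau [Hub Hlub]].
  { exists 1. intros t [Ht _]; lra. }
  { now exists 0. }
  assert (Ht0 : 0 <= tau) by (apply Hub; auto).
  assert (Ht1 : tau <= 1) by (apply Hlub; intros t [Ht _]; lra).
  assert (below : forall u, 0 <= u < tau -> zero_near f (p + RtoC u * v)%C).
  { intros u Hu. destruct (Classical_Prop.classic (zero_near f (p + RtoC u * v)%C)) as [|N]; auto.
    exfalso. assert (tau <= u); [|lra]. apply Hlub. intros t [Ht Hz].
    destruct (Rle_lt_dec t u); auto. exfalso. apply N, Hz; lra. }
  assert (at_tau : zero_near f (p + RtoC tau * v)%C).
  { destruct (Rle_lt_or_eq_dec 0 tau Ht0) as [Hp|<-].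
    2:{ replace (p + 0 * v)%C with p by ring. auto. }
    apply zero_near_of_accumulation; [apply An; lra|]. intros e He.
    pose (t := Rmin (tau / 2) (e / 2 / Cmod v)).
    assert (Q : 0 < t) by (apply Rmin_glb_lt; [lra | apply Rdiv_lt_0_compat; lra]).
    assert (Q1 : t <= tau / 2) by apply Rmin_l.
    assert (Q2 : t <= e / 2 / Cmod v) by apply Rmin_r.
    exists (RtoC (- t) * v)%C. rewrite Cmod_mult, Cmod_R, Rabs_Ropp, Rabs_pos_eq by lra. split.
    - split; [apply Rmult_lt_0_compat; auto|].
      apply Rle_lt_trans with (e / 2 / Cmod v * Cmod v); [apply Rmult_le_compat_r; lra|].
      replace (e / 2 / Cmod v * Cmod v) with (e / 2) by (field; lra). lra.
    - destruct (below (tau - t)) as [e' [He' Z]]; [lra|].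
      specialize (Z 0). rewrite Cmod_0 in Z. rewrite <- (Z He'). f_equal.
      rewrite RtoC_minus, RtoC_opp. ring. }
  destruct (Rle_lt_or_eq_dec tau 1 Ht1) as [Hlt|He].
  2:{ subst. replace (p + v)%C with (p + 1 * v)%C by ring. auto. }
  exfalso. destruct at_tau as [e [He Z]].
  pose (t := Rmin (1 - tau) (e / 2 / Cmod v)).
  assert (Q : 0 < t) by (apply Rmin_glb_lt; [lra | apply Rdiv_lt_0_compat; lra]).
  assert (Q1 : t <= 1 - tau) by apply Rmin_l.
  assert (Q2 : t <= e / 2 / Cmod v) by apply Rmin_r.
  assert (tau + t <= tau); [|lra]. apply Hub. split; [lra|]. intros u Hu.
  destruct (Rlt_le_dec u tau) as [|Hu2]; [apply below; lra|].
  exists (e / 2). split; [lra|]. intros h Hh.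
  replace (p + RtoC u * v + h)%C with (p + RtoC tau * v + (RtoC (u - tau) * v + h))%C
    by (rewrite RtoC_minus; ring).
  apply Z. eapply Rle_lt_trans; [apply Cmod_triangle|].
  rewrite Cmod_mult, Cmod_R, Rabs_pos_eq by lra.
  assert ((u - tau) * Cmod v <= e / 2 / Cmod v * Cmod v) by (apply Rmult_le_compat_r; lra).
  replace (e / 2 / Cmod v * Cmod v) with (e / 2) in H by (field; lra). lra.
Qed.

Lemma analytic_at_minus (f g : C -> C) z :
  analytic_at f z -> analytic_at g z -> analytic_at (fun s => f s - g s)%C z.
Proof.
  intros [c [r [Hr Hc]]] [d [r' [Hr' Hd]]].
  assert (F : powser (fun h => f (z + h)%C) (Rmin r r')).
  { exists c; intros h Hh. apply is_pseries_Cser, Hc. eapply Rlt_le_trans; [exact Hh | apply Rmin_l]. }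
  assert (G : powser (fun h => g (z + h)%C) (Rmin r r')).
  { exists d; intros h Hh. apply is_pseries_Cser, Hd. eapply Rlt_le_trans; [exact Hh | apply Rmin_r]. }
  destruct (powser_minus _ _ _ F G) as [a Ha].
  exists a, (Rmin r r'). split; [now apply Rmin_glb_lt|]. intros h Hh. now apply is_pseries_Cser, Ha.
Qed.

Lemma zeta_spec : is_riemann_zeta zeta.
Proof. apply (epsilon_spec (inhabits (fun _ => RtoC 0)) is_riemann_zeta). exists zeta_em. apply zeta_em_is_zeta. Qed.

(* The segment from 2 + i to x meets the real axis only at x, so it avoids the pole. *)
Lemma zeta_real (x : R) : x <> 1 -> zeta (RtoC x) = zeta_em (RtoC x).
Proof.
  intros Hx. destruct zeta_spec as [S1 A1]. destruct zeta_em_is_zeta as [S2 A2].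
  assert (Z : zero_near (fun s => zeta s - zeta_em s)%C (RtoC x)).
  { replace (RtoC x) with ((2, 1) + (x - 2, -1)%R)%C by (apply C_ext; simpl; ring).
    apply identity_along_segment.
    - intros E. apply (f_equal Im) in E. simpl in E. lra.
    - intros t Ht. apply analytic_at_minus; [apply A1 | apply A2];
        intros E; pose proof (f_equal Re E) as E1; pose proof (f_equal Im E) as E2;
        simpl in E1, E2; assert (t = 1) by lra; subst t; apply Hx; lra.
    - exists (1 / 2). split; [lra|]. intros h Hh.
      assert (H : 1 < Re ((2, 1) + h)%C).
      { rewrite Re_plus. pose proof (re_le_Cmod h) as G. apply Rabs_le_between in G. simpl (Re (2, 1)). lra. }
      specialize (S1 _ H). specialize (S2 _ H). apply is_series_Cser in S1, S2.
      rewrite (Cser_unique _ _ _ S1 S2). ring. }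
  destruct Z as [e [He Z]]. specialize (Z 0). rewrite Cmod_0 in Z. specialize (Z He).
  replace (RtoC x + 0)%C with (RtoC x) in Z by ring.
  replace (zeta (RtoC x)) with ((zeta (RtoC x) - zeta_em (RtoC x)) + zeta_em (RtoC x))%C by ring.
  rewrite Z. ring.
Qed.

(** * The incomplete gamma series *)

Definition nonpole (al : R) : Prop := forall k : nat, al + INR k <> 0.

Lemma nonpole_succ al : nonpole al -> nonpole (al + 1).
Proof. intros H k. specialize (H (S k)). rewrite S_INR in H. lra. Qed.

Lemma nonpole_pos al : 0 < al -> nonpole al.
Proof. intros H k. pose proof (pos_INR k). lra. Qed.

Lemma nonpole_bound al : nonpole al -> exists A, 0 < A /\ forall k, Rabs (/ (al + INR k)) <= A.
Proof.
  intros H.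
  assert (F : forall N, exists A, 0 < A /\ forall k, (k < N)%nat -> Rabs (/ (al + INR k)) <= A).
  { induction N as [|N [A [A0 HA]]]; [exists 1; split; [lra | intros; lia]|].
    exists (A + Rabs (/ (al + INR N))). pose proof (Rabs_pos (/ (al + INR N))). split; [lra|].
    intros k Hk. destruct (Nat.eq_dec k N) as [->|]; [lra|].
    specialize (HA k ltac:(lia)). lra. }
  destruct (exists_nat_above al) as [n Hn]. destruct (F (n + 2)%nat) as [A [A0 HA]].
  exists (A + 1). split; [lra|]. intros k. destruct (Nat.lt_ge_cases k (n + 2)) as [Hk|Hk].
  - specialize (HA k Hk). lra.
  - apply le_INR in Hk. rewrite plus_INR in Hk. simpl in Hk.
    rewrite Rabs_pos_eq by (apply Rlt_le, Rinv_0_lt_compat; lra).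
    apply Rle_trans with (/ 1); [apply Rinv_le_contravar; lra | lra].
Qed.

Definition igam_coef (al : R) (k : nat) : R := / INR (fact k) * / (al + INR k).

(* w^(-al) times the lower incomplete gamma function of al at w. *)
Definition igam (al : R) (w : C) : C :=
  CSeries (fun k => RtoC (igam_coef al k) * (- w) ^ k)%C.

Lemma igam_coef_le al A k : (forall k, Rabs (/ (al + INR k)) <= A) ->
  Rabs (igam_coef al k) <= A * / INR (fact k).
Proof.
  intros H. unfold igam_coef. rewrite Rabs_mult, Rmult_comm.
  assert (0 < / INR (fact k)) by apply Rinv_0_lt_compat, INR_fact_lt_0.
  rewrite (Rabs_pos_eq (/ INR (fact k))) by lra. apply Rmult_le_compat_r; [lra | auto].
Qed.

Lemma igam_tail al : nonpole al -> exists A, 0 < A /\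
  forall w, Cser (fun k => RtoC (igam_coef al k) * (- w) ^ k)%C (igam al w) /\
    Cmod (igam al w) <= A * exp (Cmod w) /\
    forall N, Cmod (igam al w - Csum (fun k => RtoC (igam_coef al k) * (- w) ^ k) N)%C
      <= A * (exp (Cmod w) - Rsum (fun k => Cmod w ^ k / INR (fact k)) N).
Proof.
  intros H. destruct (nonpole_bound al H) as [A [A0 HA]]. exists A; split; auto. intros w.
  destruct (Cser_abs (fun k => RtoC (igam_coef al k) * (- w) ^ k)%C
    (fun k => A * (Cmod w ^ k / INR (fact k))) (A * exp (Cmod w))) as [s [Hs [B T]]].
  - intros k. rewrite Cmod_mult, Cmod_pow, Cmod_opp, Cmod_R.
    replace (A * (Cmod w ^ k / INR (fact k))) with (A * / INR (fact k) * Cmod w ^ k) by (unfold Rdiv; ring).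
    apply Rmult_le_compat_r; [apply pow_le, Cmod_ge_0 | now apply igam_coef_le].
  - apply Rser_scal, exp_Rser.
  - unfold igam. rewrite (CSeries_unique _ _ Hs). split; [|split]; auto.
    intros N. specialize (T N). rewrite Rsum_scal in T. lra.
Qed.

Lemma igam_spec al w : nonpole al -> Cser (fun k => RtoC (igam_coef al k) * (- w) ^ k)%C (igam al w).
Proof. intros H. destruct (igam_tail al H) as [A [_ HA]]. apply HA. Qed.

Lemma igam_rec al w : nonpole al ->
  (RtoC al * igam al w = Cexp (- w) + w * igam (al + 1) w)%C.
Proof.
  intros H.
  pose (u := fun k => (RtoC al * (RtoC (igam_coef al k) * (- w) ^ k) - RtoC (/ INR (fact k)) * (- w) ^ k)%C).
  assert (H1 : Cser u (RtoC al * igam al w - Cexp (- w))%C).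
  { apply Cser_minus; [apply Cser_scal, igam_spec; auto | apply Cexp_series]. }
  assert (u0 : u O = RtoC 0).
  { unfold u, igam_coef. specialize (H O). simpl in *. apply C_ext; simpl; field; lra. }
  assert (H2 : Cser u (u O + w * igam (al + 1) w)%C).
  { apply Cser_S. eapply Cser_ext; [|apply (Cser_scal w), igam_spec, nonpole_succ; auto].
    intros k. cbv beta. unfold u, igam_coef.
    replace (RtoC (/ INR (fact k) * / (al + 1 + INR k))) with
      (- RtoC (al * (/ INR (fact (S k)) * / (al + INR (S k))) - / INR (fact (S k))))%C.
    - rewrite RtoC_minus, RtoC_mult. simpl. ring.
    - rewrite <- RtoC_opp. f_equal. specialize (H (S k)). rewrite fact_simpl, mult_INR, S_INR in *.
      pose proof (INR_fact_neq_0 k). pose proof (pos_INR k). field. repeat split; lra. }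
  pose proof (Cser_unique _ _ _ H1 H2) as E. rewrite u0 in E.
  replace (RtoC al * igam al w)%C with ((RtoC al * igam al w - Cexp (- w)) + Cexp (- w))%C by ring.
  rewrite E. ring.
Qed.

Lemma INR_sq_le_pow4 k : INR k * INR k <= 4 ^ k.
Proof.
  assert (H : INR k <= 2 ^ k).
  { induction k as [|k IH]; [simpl; lra|]. rewrite S_INR. simpl.
    assert (1 <= 2 ^ k) by (apply pow_R1_Rle; lra). lra. }
  replace 4 with (2 * 2) by ring. rewrite Rpow_mult_distr. apply Rmult_le_compat; auto using pos_INR.
Qed.

Lemma Cpow_quad (v d : C) (R0 : R) k : 1 <= R0 -> Cmod v + Cmod d <= R0 ->
  Cmod ((v + d) ^ k - v ^ k - RtoC (INR k) * (d * v ^ pred k))%C <= (INR k * INR k) * (Cmod d ^ 2 * R0 ^ k).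
Proof.
  intros H1 H2. pose proof (Cmod_ge_0 v). pose proof (Cmod_ge_0 d).
  assert (d2 : 0 <= Cmod d ^ 2) by (apply pow_le; auto).
  induction k as [|k IH].
  - simpl. replace (1 - 1 - 0 * (d * 1))%C with (RtoC 0) by ring. rewrite Cmod_0. lra.
  - assert (E : ((v + d) ^ S k - v ^ S k - RtoC (INR (S k)) * (d * v ^ pred (S k)) =
      (v + d) * ((v + d) ^ k - v ^ k - RtoC (INR k) * (d * v ^ pred k)) +
       RtoC (INR k) * (d * d) * v ^ pred k)%C).
    { rewrite S_INR, RtoC_plus. destruct k as [|k]; [simpl; ring|].
      simpl pred. rewrite !Cpow_S. ring. }
    rewrite E. eapply Rle_trans; [apply Cmod_triangle|].
    rewrite !Cmod_mult, Cmod_pow, Cmod_R, Rabs_pos_eq by apply pos_INR.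
    assert (P : 1 <= R0 ^ k) by now apply pow_R1_Rle.
    assert (Q : Cmod v ^ pred k <= R0 ^ S k).
    { apply Rle_trans with (R0 ^ pred k); [apply pow_incr; lra | apply Rle_pow; auto; lia]. }
    assert (V : Cmod (v + d)%C <= R0) by (eapply Rle_trans; [apply Cmod_triangle | auto]).
    apply Rle_trans with (R0 * (INR k * INR k * (Cmod d ^ 2 * R0 ^ k)) + INR k * Cmod d ^ 2 * R0 ^ S k).
    + apply Rplus_le_compat.
      * apply Rmult_le_compat; auto using Cmod_ge_0.
      * replace (Cmod d * Cmod d) with (Cmod d ^ 2) by ring.
        apply Rmult_le_compat_l; auto. apply Rmult_le_pos; auto using pos_INR.
    + replace (R0 * (INR k * INR k * (Cmod d ^ 2 * R0 ^ k))) with (INR k * INR k * (Cmod d ^ 2 * R0 ^ S k)) by (simpl; ring).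
      replace (INR k * Cmod d ^ 2 * R0 ^ S k) with (INR k * (Cmod d ^ 2 * R0 ^ S k)) by ring.
      rewrite <- Rmult_plus_distr_r. apply Rmult_le_compat_r.
      * apply Rmult_le_pos; auto. apply pow_le; lra.
      * rewrite S_INR. pose proof (pos_INR k). nra.
Qed.

Lemma igam_quad al w : nonpole al -> exists K, 0 <= K /\ forall h, Cmod h <= 1 ->
  Cmod (igam al (w + h) - igam al w - h * - igam (al + 1) w)%C <= K * Cmod h ^ 2.
Proof.
  intros H. destruct (nonpole_bound al H) as [A [A0 HA]].
  pose (R0 := Cmod w + 1). exists (A * exp (4 * R0)).
  split; [apply Rmult_le_pos; [lra | apply Rlt_le, exp_pos]|]. intros h Hh.
  pose (c := fun k => RtoC (igam_coef al k)).
  assert (S1 : Cser (fun k => c k * (RtoC (INR k) * ((- h) * (- w) ^ pred k)))%C (h * - igam (al + 1) w)%C).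
  { pose (u := (fun k => c k * (RtoC (INR k) * ((- h) * (- w) ^ pred k)))%C).
    replace (h * - igam (al + 1) w)%C with (u O + h * - igam (al + 1) w)%C by (unfold u; simpl; ring).
    apply (Cser_S u).
    replace (h * - igam (al + 1) w)%C with ((- h) * igam (al + 1) w)%C by ring.
    eapply Cser_ext; [|apply (Cser_scal (- h)%C), igam_spec, nonpole_succ; auto].
    intros k. unfold u, c. simpl pred. unfold igam_coef.
    replace (RtoC (/ INR (fact k) * / (al + 1 + INR k))) with
     (RtoC (/ INR (fact (S k)) * / (al + INR (S k))) * RtoC (INR (S k)))%C; [ring|].
    rewrite <- RtoC_mult. f_equal. specialize (H (S k)). rewrite fact_simpl, mult_INR, S_INR in *.
    pose proof (INR_fact_neq_0 k). pose proof (pos_INR k). field. repeat split; lra. }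
  pose proof (Cser_minus _ _ _ _ (Cser_minus _ _ _ _ (igam_spec al (w + h) H) (igam_spec al w H)) S1) as S2.
  pose (u := (fun n => RtoC (igam_coef al n) * (- (w + h)) ^ n - RtoC (igam_coef al n) * (- w) ^ n -
              c n * (RtoC (INR n) * (- h * (- w) ^ pred n)))%C).
  destruct (Cser_abs u (fun k => A * Cmod h ^ 2 * ((4 * R0) ^ k / INR (fact k)))
    (A * Cmod h ^ 2 * exp (4 * R0))) as [s [Hs [B _]]].
  - intros k. unfold u, c.
    replace (_ - _)%C with (RtoC (igam_coef al k) * ((- w + - h) ^ k - (- w) ^ k - RtoC (INR k) * (- h * (- w) ^ pred k)))%C.
    2:{ replace (- (w + h))%C with (- w + - h)%C by ring. ring. }
    rewrite Cmod_mult, Cmod_R.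
    pose proof (Cpow_quad (- w) (- h) R0 k) as Q. rewrite !Cmod_opp in Q.
    specialize (Q ltac:(unfold R0; pose proof (Cmod_ge_0 w); lra) ltac:(unfold R0; lra)).
    apply Rle_trans with (A * / INR (fact k) * (4 ^ k * (Cmod h ^ 2 * R0 ^ k))).
    + apply Rmult_le_compat; auto using Rabs_pos, Cmod_ge_0; [now apply igam_coef_le|].
      eapply Rle_trans; [exact Q|]. apply Rmult_le_compat_r; [|apply INR_sq_le_pow4].
      apply Rmult_le_pos; apply pow_le; [apply Cmod_ge_0 | unfold R0; pose proof (Cmod_ge_0 w); lra].
    + rewrite Rpow_mult_distr. apply Req_le. unfold Rdiv. ring.
  - apply Rser_scal, exp_Rser.
  - rewrite (Cser_unique _ _ _ S2 Hs). lra.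
Qed.

Lemma Cder_eps (g : R -> C) (t : R) (L : C) :
  (forall e, 0 < e -> exists d, 0 < d /\ forall s, Rabs s < d ->
     Cmod (g (t + s)%R - g t - RtoC s * L)%C <= e * Rabs s) -> Cder g t L.
Proof.
  intros H. split; apply is_derive_Reals; intros e He.
  - destruct (H (e / 2)) as [d [Hd Hs]]; [lra|]. exists (mkposreal d Hd). intros s Hs0 Hsd. simpl in Hsd.
    specialize (Hs s Hsd). pose proof (Rabs_pos_lt s Hs0).
    apply Rmult_lt_reg_r with (Rabs s); auto. rewrite <- Rabs_mult.
    apply Rle_lt_trans with (e / 2 * Rabs s); [|nra].
    eapply Rle_trans; [|exact Hs]. eapply Rle_trans; [|apply re_le_Cmod].
    rewrite !Re_minus, Re_RtoC_mult. apply Req_le. f_equal. field; auto.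
  - destruct (H (e / 2)) as [d [Hd Hs]]; [lra|]. exists (mkposreal d Hd). intros s Hs0 Hsd. simpl in Hsd.
    specialize (Hs s Hsd). pose proof (Rabs_pos_lt s Hs0).
    apply Rmult_lt_reg_r with (Rabs s); auto. rewrite <- Rabs_mult.
    apply Rle_lt_trans with (e / 2 * Rabs s); [|nra].
    eapply Rle_trans; [|exact Hs]. eapply Rle_trans; [|apply im_le_Cmod].
    rewrite !Im_minus, Im_RtoC_mult. apply Req_le. f_equal. field; auto.
Qed.

Lemma is_derive_eps (f : R -> R) (t l e : R) : is_derive f t l -> 0 < e ->
  exists d, 0 < d /\ forall s, Rabs s < d -> Rabs (f (t + s) - f t - s * l) <= e * Rabs s.
Proof.
  intros H He. apply is_derive_Reals in H. destruct (H e He) as [d Hd].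
  exists d; split; [apply cond_pos|]. intros s Hs.
  destruct (Req_dec s 0) as [->|H0].
  - rewrite Rplus_0_r, Rabs_R0. replace (f t - f t - 0 * l) with 0 by ring. rewrite Rabs_R0; lra.
  - specialize (Hd s H0 Hs). 
    replace (f (t + s) - f t - s * l) with (((f (t + s) - f t) / s - l) * s) by (field; auto).
    rewrite Rabs_mult. apply Rmult_le_compat_r; [apply Rabs_pos | lra].
Qed.

Lemma Cder_eps_inv (g : R -> C) (t : R) (L : C) e : Cder g t L -> 0 < e ->
  exists d, 0 < d /\ forall s, Rabs s < d -> Cmod (g (t + s)%R - g t - RtoC s * L)%C <= e * Rabs s.
Proof.
  intros [H1 H2] He.
  destruct (is_derive_eps _ _ _ (e / 2) H1) as [d1 [Hd1 E1]]; [lra|].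
  destruct (is_derive_eps _ _ _ (e / 2) H2) as [d2 [Hd2 E2]]; [lra|].
  exists (Rmin d1 d2). split; [now apply Rmin_glb_lt|]. intros s Hs.
  eapply Rle_trans; [apply Cmod_le_parts|].
  rewrite !Re_minus, !Im_minus, Re_RtoC_mult, Im_RtoC_mult.
  specialize (E1 s ltac:(eapply Rlt_le_trans; [exact Hs | apply Rmin_l])).
  specialize (E2 s ltac:(eapply Rlt_le_trans; [exact Hs | apply Rmin_r])). lra.
Qed.

Lemma Cder_comp_quad (f : C -> C) (w : R -> C) (t K : R) (l f' : C) :
  0 <= K ->
  (forall h, Cmod h <= 1 -> Cmod (f (w t + h) - f (w t) - h * f')%C <= K * Cmod h ^ 2) ->
  Cder w t l -> Cder (fun x => f (w x)) t (l * f')%C.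
Proof.
  intros HK Q Hw. apply Cder_eps. intros e He.
  pose (P := Cmod l + 1). assert (HP : 1 <= P) by (unfold P; pose proof (Cmod_ge_0 l); lra).
  pose (F := Cmod f' + 1). assert (HF : 1 <= F) by (unfold F; pose proof (Cmod_ge_0 f'); lra).
  destruct (Cder_eps_inv w t l (Rmin 1 (e / 2 / F)) Hw) as [d [Hd Hs]].
  { apply Rmin_glb_lt; [lra|]. apply Rdiv_lt_0_compat; lra. }
  assert (m1 : Rmin 1 (e / 2 / F) <= 1) by apply Rmin_l.
  assert (m2 : Rmin 1 (e / 2 / F) <= e / 2 / F) by apply Rmin_r.
  assert (X : 0 < e / 2 / ((K + 1) * P ^ 2)).
  { apply Rdiv_lt_0_compat; [lra|]. apply Rmult_lt_0_compat; [lra | apply pow_lt; lra]. }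
  exists (Rmin d (Rmin (/ P) (e / 2 / ((K + 1) * P ^ 2)))). split.
  { repeat apply Rmin_glb_lt; auto. apply Rinv_0_lt_compat; lra. }
  intros s Hsd.
  assert (s1 : Rabs s < d) by (eapply Rlt_le_trans; [exact Hsd | apply Rmin_l]).
  assert (s2 : Rabs s < / P).
  { eapply Rlt_le_trans; [exact Hsd |]. eapply Rle_trans; [apply Rmin_r | apply Rmin_l]. }
  assert (s3 : Rabs s < e / 2 / ((K + 1) * P ^ 2)).
  { eapply Rlt_le_trans; [exact Hsd |]. eapply Rle_trans; [apply Rmin_r | apply Rmin_r]. }
  pose (h := (w (t + s)%R - w t)%C). specialize (Hs s s1). fold h in Hs.
  pose proof (Rabs_pos s) as sp.
  assert (hb : Cmod h <= P * Rabs s).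
  { replace h with ((h - RtoC s * l) + RtoC s * l)%C by ring.
    eapply Rle_trans; [apply Cmod_triangle|]. rewrite Cmod_mult, Cmod_R. unfold P. nra. }
  assert (h1 : Cmod h <= 1).
  { eapply Rle_trans; [exact hb|]. rewrite <- (Rinv_r P) by lra. apply Rmult_le_compat_l; lra. }
  specialize (Q h h1). replace (w t + h)%C with (w (t + s)) in Q by (unfold h; ring).
  replace (f (w (t + s)%R) - f (w t) - RtoC s * (l * f'))%C with
    ((f (w (t + s)%R) - f (w t) - h * f') + (h - RtoC s * l) * f')%C by ring.
  eapply Rle_trans; [apply Cmod_triangle|]. rewrite (Cmod_mult (h - RtoC s * l)).
  assert (A1 : Cmod (h - RtoC s * l) * Cmod f' <= e / 2 * Rabs s).
  { apply Rle_trans with (e / 2 / F * Rabs s * F).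
    - apply Rmult_le_compat; auto using Cmod_ge_0; [|unfold F; lra].
      eapply Rle_trans; [exact Hs|]. apply Rmult_le_compat_r; auto.
    - apply Req_le. field. lra. }
  assert (A2 : K * Cmod h ^ 2 <= e / 2 * Rabs s).
  { apply Rle_trans with ((K + 1) * (P * Rabs s) ^ 2).
    - apply Rmult_le_compat; auto; [apply pow_le, Cmod_ge_0 | lra |].
      apply pow_incr; split; auto using Cmod_ge_0.
    - replace ((K + 1) * (P * Rabs s) ^ 2) with ((K + 1) * P ^ 2 * Rabs s * Rabs s) by ring.
      apply Rmult_le_compat_r; auto.
      apply Rle_trans with ((K + 1) * P ^ 2 * (e / 2 / ((K + 1) * P ^ 2))).
      + apply Rmult_le_compat_l; [|lra]. apply Rmult_le_pos; [lra | apply pow_le; lra].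
      + apply Req_le. field. split; lra. }
  lra.
Qed.

Lemma igam_Cder al (w : R -> C) t l : nonpole al -> Cder w t l ->
  Cder (fun x => igam al (w x)) t (l * - igam (al + 1) (w t))%C.
Proof.
  intros H Hw. destruct (igam_quad al (w t) H) as [K [K0 HK]].
  now apply Cder_comp_quad with K.
Qed.

Definition igam_ray (al : R) (z : C) (x : R) : C :=
  (RtoC (Rpower x al) * igam al (z * RtoC x))%C.

Lemma Rpower_succ (x a : R) : 0 < x -> Rpower x (a + 1) = x * Rpower x a.
Proof. intros. rewrite Rpower_plus, Rpower_1 by auto. ring. Qed.

Lemma Rpower_pred (x a : R) : 0 < x -> Rpower x a = x * Rpower x (a - 1).
Proof. intros. rewrite <- Rpower_succ by auto. f_equal; ring. Qed.

Lemma igam_ray_Cder al z x : nonpole al -> 0 < x ->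
  Cder (igam_ray al z) x (RtoC (Rpower x (al - 1)) * Cexp (- (z * RtoC x)))%C.
Proof.
  intros H Hx. unfold igam_ray. eapply Cder_eq.
  - apply Cder_mult.
    + apply Cder_RtoC, is_derive_Rpower; auto.
    + apply igam_Cder; auto. apply (Cder_scal z), Cder_RtoC, is_derive_Rid.
  - cbv beta. pose proof (igam_rec al (z * RtoC x) H) as E.
    replace (Cexp (- (z * RtoC x))) with (RtoC al * igam al (z * RtoC x) - z * RtoC x * igam (al + 1) (z * RtoC x))%C.
    2:{ rewrite E. ring. }
    rewrite (Rpower_pred x al Hx), !RtoC_mult. ring.
Qed.

(** * The gamma function *)

Definition Ctends (f : R -> C) (l : C) : Prop :=
  forall e, 0 < e -> exists X, forall x, X <= x -> Cmod (f x - l)%C < e.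

Lemma RInt_gen_eps (f : R -> R) (l : R) :
  (forall e, 0 < e -> exists a0 b0, 0 < a0 /\ forall a b, 0 < a < a0 -> b0 < b ->
     exists I, is_RInt f a b I /\ Rabs (I - l) < e) ->
  is_RInt_gen f (at_right 0) (Rbar_locally p_infty) l.
Proof.
  intros H P [e He]. destruct (H e (cond_pos e)) as [a0 [b0 [Ha0 Hab]]].
  exists (fun a => 0 < a < a0) (fun b => b0 < b).
  - exists (mkposreal a0 Ha0). intros y Hy Hy0. split; auto.
    unfold ball in Hy; simpl in Hy; unfold AbsRing_ball, abs, minus, plus, opp in Hy; simpl in Hy.
    apply Rabs_def2 in Hy. lra.
  - now exists b0.
  - intros a b Ha Hb. destruct (Hab a b Ha Hb) as [I [HI HIe]]. exists I. split; auto.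
Qed.

Lemma exp_neg_tends0 (p c : R) : 0 < c -> forall e, 0 < e -> exists X, 1 <= X /\
  forall x, X <= x -> Rpower x p * exp (- (c * x)) < e.
Proof.
  intros Hc e He. destruct (Rpower_exp_bounded (p + 1) c Hc) as [K [K0 HK]].
  exists (1 + K / e). assert (0 < K / e) by (apply Rdiv_lt_0_compat; lra).
  split; [lra|]. intros x Hx. specialize (HK x ltac:(lra)).
  rewrite Rpower_succ, Rmult_assoc in HK by lra.
  apply Rmult_lt_reg_l with x; [lra|]. eapply Rle_lt_trans; [exact HK|].
  apply Rlt_le_trans with ((1 + K / e) * e).
  - replace ((1 + K / e) * e) with (e + K) by (field; lra). lra.
  - apply Rmult_le_compat_r; lra.
Qed.

Lemma locally_of_pos (x : R) (P : R -> Prop) : 0 < x -> (forall u, 0 < u -> P u) -> locally x P.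
Proof.
  intros Hx HP. exists (mkposreal x Hx). intros y Hy. apply HP.
  unfold ball in Hy; simpl in Hy; unfold AbsRing_ball, abs, minus, plus, opp in Hy; simpl in Hy.
  apply Rabs_def2 in Hy. lra.
Qed.

Lemma is_derive_continuous (f : R -> R) x l : is_derive f x l -> continuous f x.
Proof. intros H. apply (ex_derive_continuous (K := R_AbsRing) (V := R_NormedModule)). now exists l. Qed.

Lemma continuous_Rpower_exp (p c x : R) : 0 < x ->
  continuous (fun t => Rpower t p * exp (- (c * t))) x.
Proof.
  intros Hx. apply (is_derive_continuous _ _ _ (is_derive_Rmult _ _ _ _ _ (is_derive_Rpower p x Hx)
    (is_derive_Rcomp exp (fun t => - (c * t)) x _ _ (is_derive_exp _)
      (is_derive_eq _ _ _ (- (c * 1)) (is_derive_opp (V := R_NormedModule) _ _ _ (is_derive_Rscal c _ _ _ (is_derive_Rid x))) eq_refl)))).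
Qed.

Lemma igam_real al x : nonpole al -> igam al (RtoC x) = RtoC (Re (igam al (RtoC x))).
Proof.
  intros H. apply C_ext; [reflexivity|]. simpl (Im (RtoC _)).
  pose proof (Clim_Im _ _ (igam_spec al (RtoC x) H)) as L.
  assert (E : forall n, Im (Csum (fun k => RtoC (igam_coef al k) * (- RtoC x) ^ k)%C n) = 0).
  { intros n. rewrite Im_Csum. rewrite (Rsum_ext _ (fun _ => 0)).
    - induction n; simpl; [auto | rewrite IHn; ring].
    - intros k _. rewrite <- RtoC_opp, <- RtoC_pow, <- RtoC_mult. reflexivity. }
  assert (L0 : is_lim_seq (fun n => Im (Csum (fun k => RtoC (igam_coef al k) * (- RtoC x) ^ k)%C n)) 0).
  { eapply is_lim_seq_ext; [intros; symmetry; apply E | apply is_lim_seq_const]. }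
  pose proof (is_lim_seq_unique _ _ L) as U1. pose proof (is_lim_seq_unique _ _ L0) as U2. congruence.
Qed.

Definition igam_rray (al c x : R) : R := Re (igam_ray al (RtoC c) x).

Lemma igam_ray_real al c x : nonpole al -> igam_ray al (RtoC c) x = RtoC (igam_rray al c x).
Proof.
  intros H. unfold igam_rray, igam_ray. rewrite <- RtoC_mult, igam_real, <- RtoC_mult by auto. reflexivity.
Qed.

Lemma igam_rray_derive al c x : nonpole al -> 0 < x ->
  is_derive (igam_rray al c) x (Rpower x (al - 1) * exp (- (c * x))).
Proof.
  intros H Hx. destruct (igam_ray_Cder al (RtoC c) x H Hx) as [D _].
  rewrite <- RtoC_mult, <- RtoC_opp, Cexp_RtoC, <- RtoC_mult in D. exact D.
Qed.

Lemma igam_rray_small al c : 0 < al -> 0 < c -> exists M, 0 < M /\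
  forall x, 0 < x <= 1 -> Rabs (igam_rray al c x) <= M * Rpower x al.
Proof.
  intros H Hc. destruct (igam_tail al (nonpole_pos al H)) as [A [A0 HA]].
  exists (A * exp c). split; [apply Rmult_lt_0_compat; auto; apply exp_pos|].
  intros x Hx. unfold igam_rray, igam_ray. rewrite Re_RtoC_mult, Rabs_mult, Rmult_comm.
  rewrite (Rabs_pos_eq (Rpower x al)) by apply Rlt_le, Rpower_pos.
  apply Rmult_le_compat_r; [apply Rlt_le, Rpower_pos|].
  eapply Rle_trans; [apply re_le_Cmod|]. destruct (HA (RtoC c * RtoC x)%C) as [_ [B _]].
  eapply Rle_trans; [exact B|]. apply Rmult_le_compat_l; [lra|]. apply exp_le.
  rewrite <- RtoC_mult, Cmod_R, Rabs_pos_eq; nra.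
Qed.

Lemma Rpower_small al e : 0 < al -> 0 < e -> exists d, 0 < d <= 1 /\ forall x, 0 < x < d -> Rpower x al < e.
Proof.
  intros H He. exists (Rmin 1 (Rpower e (/ al))). split.
  - split; [apply Rmin_glb_lt; [lra | apply Rpower_pos] | apply Rmin_l].
  - intros x [Hx1 Hx2]. assert (x < Rpower e (/ al)) by (eapply Rlt_le_trans; [exact Hx2 | apply Rmin_r]).
    replace e with (Rpower (Rpower e (/ al)) al).
    + apply exp_increasing. apply Rmult_lt_compat_l; auto. now apply ln_increasing.
    + rewrite Rpower_mult. replace (/ al * al) with 1 by (field; lra). now apply Rpower_1.
Qed.

Lemma monotone_limit (f : R -> R) (M : R) :
  (forall x y, 1 <= x <= y -> f x <= f y) -> (forall x, 1 <= x -> f x <= M) ->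
  exists L, (forall x, 1 <= x -> f x <= L) /\ L <= M /\
    forall e, 0 < e -> exists X, 1 <= X /\ forall x, X <= x -> L - e < f x.
Proof.
  intros Hm Hb.
  destruct (completeness (fun y => exists x, 1 <= x /\ y = f x)) as [L [U1 U2]].
  - exists M. intros y [x [Hx ->]]. auto.
  - exists (f 1), 1. split; [lra | auto].
  - exists L. split; [|split].
    + intros x Hx. apply U1. now exists x.
    + apply U2. intros y [x [Hx ->]]. auto.
    + intros e He. destruct (Classical_Prop.classic (exists X, 1 <= X /\ L - e < f X)) as [[X [HX HL]]|N].
      * exists X. split; auto. intros x Hx. specialize (Hm X x ltac:(lra)). lra.
      * exfalso. assert (L <= L - e); [|lra]. apply U2. intros y [x [Hx ->]].
        apply Rnot_lt_le. intros Hlt. apply N. now exists x.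
Qed.

Lemma igam_rray_mono al c x y : 0 < al -> 0 < x <= y -> igam_rray al c x <= igam_rray al c y.
Proof.
  intros H Hx. apply (incr_of_derive_ge0 _ (fun x => Rpower x (al - 1) * exp (- (c * x)))); [lra| |].
  - intros; apply igam_rray_derive; [now apply nonpole_pos | lra].
  - intros. apply Rlt_le, Rpower_exp_pos.
Qed.

Lemma igam_rray_limit al c : 0 < al -> 0 < c -> exists L, 0 < L /\
  (forall x, 0 < x -> 0 <= igam_rray al c x <= L) /\
  (forall e, 0 < e -> exists X, 1 <= X /\ forall x, X <= x -> L - e < igam_rray al c x) /\
  is_RInt_gen (fun t => Rpower t (al - 1) * exp (- (c * t))) (at_right 0) (Rbar_locally p_infty) L.
Proof.
  intros H Hc. pose proof (nonpole_pos al H) as Hn.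
  assert (D : forall x, 0 < x -> is_derive (igam_rray al c) x (Rpower x (al - 1) * exp (- (c * x))))
    by (intros; now apply igam_rray_derive).
  assert (mono : forall x y, 0 < x <= y -> igam_rray al c x <= igam_rray al c y)
    by (intros; now apply igam_rray_mono).
  destruct (Rpower_exp_bounded (al - 1) (c / 2)) as [K [K0 HK]]; [lra|].
  assert (Ke : 0 < K * (2 / c)) by (apply Rmult_lt_0_compat; auto; apply Rdiv_lt_0_compat; lra).
  assert (bd : forall x, 1 <= x -> igam_rray al c x <= igam_rray al c 1 + K * (2 / c)).
  { intros x Hx.
    assert (Rabs (igam_rray al c x - igam_rray al c 1) <=
      - (K * (2 / c)) * exp (- (c / 2 * x)) - - (K * (2 / c)) * exp (- (c / 2 * 1))).
    { apply (mvt_majorant (igam_rray al c) (fun x => Rpower x (al - 1) * exp (- (c * x)))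
        (fun x => - (K * (2 / c)) * exp (- (c / 2 * x))) (fun x => K * exp (- (c / 2 * x))) 1 x Hx).
      - intros y Hy. apply D; lra.
      - intros y Hy. eapply is_derive_eq.
        + apply is_derive_Rscal, (is_derive_Rcomp exp (fun t => - (c / 2 * t))); [apply is_derive_exp|].
          apply (is_derive_opp (V := R_NormedModule)), is_derive_Rscal, is_derive_Rid.
        + unfold opp; simpl. field; lra.
      - intros y Hy. rewrite Rabs_pos_eq.
        2:{ apply Rlt_le, Rpower_exp_pos. }
        replace (- (c * y)) with (- (c / 2 * y) + - (c / 2 * y)) by field. rewrite exp_plus, <- Rmult_assoc.
        apply Rmult_le_compat_r; [apply Rlt_le, exp_pos | apply HK; lra]. }
    apply Rabs_le_between in H0.
    assert (0 <= K * (2 / c) * exp (- (c / 2 * x))) by (apply Rmult_le_pos; [lra | apply Rlt_le, exp_pos]).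
    assert (K * (2 / c) * exp (- (c / 2 * 1)) <= K * (2 / c) * 1).
    { apply Rmult_le_compat_l; [lra|]. apply exp_le_1; lra. }
    lra. }
  destruct (monotone_limit (igam_rray al c) (igam_rray al c 1 + K * (2 / c))) as [L [U1 [_ U3]]]; auto.
  { intros; apply mono; lra. }
  destruct (igam_rray_small al c H Hc) as [M [M0 HM]].
  assert (pos : forall x, 0 < x -> 0 <= igam_rray al c x).
  { intros x Hx. apply Rnot_lt_le. intros Hlt.
    destruct (Rpower_small al (- igam_rray al c x / M) H) as [d [Hd1 Hd2]]; [apply Rdiv_lt_0_compat; lra|].
    pose (y := Rmin x (d / 2)). assert (Hy : 0 < y) by (apply Rmin_glb_lt; lra).
    assert (Hy1 : y <= x) by apply Rmin_l. assert (Hy2 : y <= d / 2) by apply Rmin_r.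
    specialize (mono y x ltac:(lra)). specialize (HM y ltac:(lra)). specialize (Hd2 y ltac:(lra)).
    apply Rabs_le_between in HM.
    assert (M * Rpower y al < M * (- igam_rray al c x / M)) by (apply Rmult_lt_compat_l; lra).
    replace (M * (- igam_rray al c x / M)) with (- igam_rray al c x) in H0 by (field; lra). lra. }
  assert (L0 : 0 < L).
  { destruct (MVT_gen (igam_rray al c) 1 2 (fun x => Rpower x (al - 1) * exp (- (c * x)))) as [xi [Hxi E]].
    - intros x Hx. rewrite Rmin_left in Hx by lra. apply D; lra.
    - intros x Hx. rewrite Rmin_left in Hx by lra. apply derivable_continuous_pt.
      exists (Rpower x (al - 1) * exp (- (c * x))). apply is_derive_Reals, D; lra.
    - assert (0 < Rpower xi (al - 1) * exp (- (c * xi))) by apply Rpower_exp_pos.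
      specialize (U1 2 ltac:(lra)). specialize (pos 1 ltac:(lra)). lra. }
  exists L. split; auto. split; [|split].
  - intros x Hx. split; auto. destruct (Rle_lt_dec 1 x); auto.
    apply Rle_trans with (igam_rray al c 1); [apply mono; lra | apply U1; lra].
  - exact U3.
  - apply RInt_gen_eps. intros e He.
    destruct (U3 (e / 2)) as [X [HX1 HX]]; [lra|].
    destruct (Rpower_small al (e / 2 / M) H) as [d [Hd1 Hd2]]; [apply Rdiv_lt_0_compat; lra|].
    exists d, X. split; [lra|]. intros a b Ha Hb.
    exists (igam_rray al c b - igam_rray al c a). split.
    + apply (is_RInt_derive (V := R_CompleteNormedModule) (igam_rray al c)).
      * intros x Hx. rewrite Rmin_left, Rmax_right in Hx by lra. apply D; lra.
      * intros x Hx. rewrite Rmin_left, Rmax_right in Hx by lra. apply continuous_Rpower_exp; lra.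
    + specialize (HX b ltac:(lra)). specialize (U1 b ltac:(lra)). specialize (HM a ltac:(lra)).
      specialize (Hd2 a ltac:(lra)). specialize (pos a ltac:(lra)). rewrite Rabs_pos_eq in HM by auto.
      assert (M * Rpower a al < M * (e / 2 / M)) by (apply Rmult_lt_compat_l; lra).
      replace (M * (e / 2 / M)) with (e / 2) in H0 by (field; lra).
      apply Rabs_def1; lra.
Qed.

Lemma Gamma_integral_spec al : 0 < al -> 0 < Gamma_integral al /\
  (forall x, 0 < x -> igam_rray al 1 x <= Gamma_integral al) /\
  (forall e, 0 < e -> exists X, 1 <= X /\ forall x, X <= x -> Gamma_integral al - e < igam_rray al 1 x).
Proof.
  intros H. destruct (igam_rray_limit al 1 H ltac:(lra)) as [L [L0 [B [T I]]]].
  assert (E : Gamma_integral al = L).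
  { unfold Gamma_integral.
    apply (is_RInt_gen_unique (V := R_CompleteNormedModule)).
    eapply is_RInt_gen_ext; [|exact I]. apply filter_forall. intros ab x _. simpl. now rewrite Rmult_1_l. }
  rewrite E. split; [|split]; auto. intros x Hx; now apply B.
Qed.

Definition polar (rho th : R) : C := (RtoC rho * Cexp (0, th))%C.
Definition polar_pow (rho th a : R) : C := polar (Rpower rho a) (a * th).

Lemma Cmod_unit th : Cmod (Cexp (0, th)) = 1.
Proof. rewrite Cmod_Cexp. simpl. apply exp_0. Qed.

Lemma Cexp_ang_plus s t : Cexp (0, s + t) = (Cexp (0, s) * Cexp (0, t))%C.
Proof. rewrite <- Cexp_plus. f_equal. apply C_ext; simpl; ring. Qed.

Lemma Cmod_polar rho th : 0 <= rho -> Cmod (polar rho th) = rho.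
Proof. intros. unfold polar. rewrite Cmod_mult, Cmod_unit, Cmod_R, Rabs_pos_eq; lra. Qed.

Lemma Re_polar rho th : Re (polar rho th) = rho * cos th.
Proof. unfold polar. rewrite Re_RtoC_mult. simpl. rewrite exp_0. ring. Qed.

Lemma polar_mult r1 t1 r2 t2 : (polar r1 t1 * polar r2 t2)%C = polar (r1 * r2) (t1 + t2).
Proof. unfold polar. rewrite RtoC_mult, Cexp_ang_plus. ring. Qed.

Lemma polar_scal r x th : (RtoC r * polar x th)%C = polar (r * x) th.
Proof. unfold polar. rewrite RtoC_mult. ring. Qed.

Lemma polar_0 r : polar r 0 = RtoC r.
Proof. unfold polar. change (Cexp (0, 0)) with (Cexp 0). rewrite Cexp_0. ring. Qed.

Lemma Cder_Cexp_ang (a th : R) : Cder (fun s => Cexp (0, a * s)) th (RtoC a * Ci * Cexp (0, (a * th)%R))%C.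
Proof.
  eapply Cder_eq.
  - apply Cder_Cexp. apply Cder_ext with (fun s => (RtoC a * Ci) * RtoC s)%C.
    + intros t. apply C_ext; simpl; ring.
    + apply Cder_scal, Cder_RtoC, is_derive_Rid.
  - cbv beta; ring.
Qed.

(* The derivative of w^al igam(al,w) is w^(al-1) e^(-w), which is exponentially small on the arc. *)
Lemma igam_arc_bound al X th c : nonpole al -> 0 < X ->
  (forall s, 0 <= s <= 1 -> c <= cos (s * th)) ->
  Cmod (polar_pow X th al * igam al (polar X th) - igam_ray al 1 X)%C
    <= 2 * (Rabs th * (Rpower X al * exp (- (c * X)))).
Proof.
  intros H HX Hc.
  pose (G := fun s => (polar_pow X (s * th) al * igam al (polar X (s * th)))%C).
  assert (E0 : G 0 = igam_ray al 1 X).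
  { unfold G, igam_ray, polar_pow. rewrite Rmult_0_l, Rmult_0_r, !polar_0. f_equal. f_equal. ring. }
  assert (E1 : G 1 = (polar_pow X th al * igam al (polar X th))%C) by (unfold G; now rewrite Rmult_1_l).
  rewrite <- E0, <- E1.
  replace (Rabs th * (Rpower X al * exp (- (c * X)))) with (Rabs th * (Rpower X al * exp (- (c * X))) * (1 - 0)) by ring.
  apply Cmvt with (f' := fun s => (RtoC th * (Ci * (polar_pow X (s * th) al * Cexp (- polar X (s * th)))))%C); [lra| |].
  - intros s _. unfold G.
    apply (Cder_eq _ _ (RtoC th * (Ci * (polar_pow X (s * th) al * (RtoC al * igam al (polar X (s * th))
       - polar X (s * th) * igam (al + 1) (polar X (s * th))))))%C).
    2:{ rewrite igam_rec by auto. ring. }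
    assert (D : is_derive (fun s => s * th) s th).
    { apply is_derive_Rext with (fun s => th * s); [intros; ring|].
      eapply is_derive_eq; [apply is_derive_Rscal, is_derive_Rid | ring]. }
    eapply Cder_eq.
    + apply (Cder_comp_real (fun t => (polar_pow X t al * igam al (polar X t))%C) (fun s => s * th)); [|exact D].
      apply Cder_mult.
      * unfold polar_pow, polar. apply Cder_scal, Cder_Cexp_ang.
      * apply igam_Cder; auto. unfold polar. apply Cder_scal.
        apply Cder_ext with (fun s => Cexp (0, 1 * s)); [intros; now rewrite Rmult_1_l|]. apply Cder_Cexp_ang.
    + cbv beta. unfold polar_pow, polar. rewrite Rmult_1_l. ring.
  - intros s Hs. rewrite !Cmod_mult, Cmod_Ci, Cmod_R, Cmod_Cexp.
    unfold polar_pow. rewrite Cmod_polar by apply Rlt_le, Rpower_pos.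
    rewrite Rmult_1_l. apply Rmult_le_compat_l; [apply Rabs_pos|].
    apply Rmult_le_compat_l; [apply Rlt_le, Rpower_pos|]. apply exp_le.
    replace (Re (- polar X (s * th))%C) with (- Re (polar X (s * th))) by reflexivity.
    rewrite Re_polar. specialize (Hc s Hs). nra.
Qed.

Lemma cos_lower th s : Rabs th < PI / 2 -> 0 <= s <= 1 -> cos th <= cos (s * th).
Proof.
  intros H Hs. pose proof PI_RGT_0 as HP.
  destruct (Rle_lt_dec 0 th) as [H0|H0].
  - rewrite Rabs_pos_eq in H by lra. apply cos_decr_1; nra.
  - rewrite Rabs_left in H by lra.
    rewrite <- (cos_neg th), <- (cos_neg (s * th)), Ropp_mult_distr_r. apply cos_decr_1; nra.
Qed.

Lemma cos_pos th : Rabs th < PI / 2 -> 0 < cos th.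
Proof. intros H. apply Rabs_def2 in H. apply cos_gt_0; lra. Qed.

Lemma polar_pow_neq0 r t a : polar_pow r t a <> RtoC 0.
Proof.
  apply Cmod_gt_0. unfold polar_pow. rewrite Cmod_polar by apply Rlt_le, Rpower_pos. apply Rpower_pos.
Qed.

Lemma polar_pow_opp r t a : (polar_pow r t a * polar_pow r t (- a))%C = RtoC 1.
Proof.
  unfold polar_pow. rewrite polar_mult, <- Rpower_plus.
  replace (a + - a) with 0 by ring. replace (a * t + - a * t) with 0 by ring.
  rewrite polar_0. f_equal. unfold Rpower. rewrite Rmult_0_l. apply exp_0.
Qed.

Lemma igam_ray_tends_pos al rho th : 0 < al -> 0 < rho -> Rabs th < PI / 2 ->
  Ctends (igam_ray al (polar rho th)) (RtoC (Gamma_integral al) * polar_pow rho th (- al))%C.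
Proof.
  intros H Hr Ht e He. pose proof (nonpole_pos al H) as Hn.
  destruct (Gamma_integral_spec al H) as [G0 [G1 G2]].
  pose (q := Rpower rho (- al)). assert (Hq : 0 < q) by apply Rpower_pos.
  destruct (G2 (e / 2 / q)) as [X1 [HX1 HX]]; [apply Rdiv_lt_0_compat; lra|].
  pose proof (cos_pos th Ht) as Hc.
  assert (Ha : 0 < Rabs th + 1) by (pose proof (Rabs_pos th); lra).
  destruct (exp_neg_tends0 al (cos th) Hc (e / 2 / q / (2 * (Rabs th + 1)))) as [X2 [HX2 HY]].
  { repeat apply Rdiv_lt_0_compat; lra. }
  exists ((X1 + X2) / rho). intros x Hx.
  assert (HX' : X1 + X2 <= rho * x).
  { apply Rmult_le_reg_l with (/ rho); [now apply Rinv_0_lt_compat|].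
    rewrite <- Rmult_assoc, Rinv_l, Rmult_1_l by lra. unfold Rdiv in Hx. lra. }
  assert (x0 : 0 < x) by nra.
  assert (E : igam_ray al (polar rho th) x =
    (polar_pow rho th (- al) * (polar_pow (rho * x) th al * igam al (polar (rho * x) th)))%C).
  { unfold igam_ray. rewrite (Cmult_comm (polar rho th)), polar_scal, (Rmult_comm x), Cmult_assoc. f_equal.
    unfold polar_pow. rewrite polar_mult.
    replace (- al * th + al * th) with 0 by ring. rewrite polar_0. f_equal.
    rewrite <- (Rpower_mult_distr rho x al) by auto. rewrite <- Rmult_assoc, <- Rpower_plus.
    replace (- al + al) with 0 by ring. unfold Rpower at 2. rewrite Rmult_0_l, exp_0. ring. }
  rewrite E.
  replace (_ - _)%C with (polar_pow rho th (- al) * ((polar_pow (rho * x) th al * igam al (polar (rho * x) th) - igam_ray al 1 (rho * x)) + (igam_ray al 1 (rho * x) - RtoC (Gamma_integral al))))%C by ring.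
  rewrite Cmod_mult. unfold polar_pow at 1. rewrite Cmod_polar by apply Rlt_le, Rpower_pos. fold q.
  apply Rlt_le_trans with (q * (e / 2 / q + e / 2 / q)).
  2:{ apply Req_le. field. lra. }
  apply Rmult_lt_compat_l; auto. eapply Rle_lt_trans; [apply Cmod_triangle|].
  apply Rplus_lt_compat.
  - eapply Rle_lt_trans; [apply (igam_arc_bound al (rho * x) th (cos th)); auto; [nra|]|].
    + intros s Hs. now apply cos_lower.
    + specialize (HY (rho * x) ltac:(lra)).
      apply Rle_lt_trans with (2 * (Rabs th + 1) * (Rpower (rho * x) al * exp (- (cos th * (rho * x))))).
      * assert (0 < Rpower (rho * x) al * exp (- (cos th * (rho * x)))) by apply Rpower_exp_pos. nra.
      * apply Rlt_le_trans with (2 * (Rabs th + 1) * (e / 2 / q / (2 * (Rabs th + 1)))).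
        -- apply Rmult_lt_compat_l; lra.
        -- apply Req_le. field. lra.
  - rewrite igam_ray_real, <- RtoC_minus, Cmod_R by auto.
    specialize (HX (rho * x) ltac:(lra)). specialize (G1 (rho * x) ltac:(nra)).
    rewrite Rabs_left1 by lra. lra.
Qed.

Lemma igam_ray_rec al z x : nonpole al -> 0 < x ->
  igam_ray al z x = (RtoC (/ al) * (RtoC (Rpower x al) * Cexp (- (z * RtoC x)) + z * igam_ray (al + 1) z x))%C.
Proof.
  intros H Hx. unfold igam_ray. rewrite (Rpower_succ x al Hx), RtoC_mult.
  assert (a0 : RtoC al <> RtoC 0).
  { intros E. apply RtoC_inj in E. specialize (H O). simpl in H. lra. }
  rewrite RtoC_inv by (intros ->; now apply a0).
  replace (igam al (z * RtoC x)) with (/ RtoC al * (RtoC al * igam al (z * RtoC x)))%C by (field; auto).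
  rewrite (igam_rec al (z * RtoC x) H). ring.
Qed.

Lemma igam_ray_tends_shift n : forall al rho th, nonpole al -> 0 < al + INR n -> 0 < rho -> Rabs th < PI / 2 ->
  Ctends (igam_ray al (polar rho th)) (RtoC (Gamma_shift n al) * polar_pow rho th (- al))%C.
Proof.
  induction n as [|n IH]; intros al rho th H Hn Hr Ht.
  - simpl in *. apply igam_ray_tends_pos; auto; lra.
  - intros e He. rewrite S_INR in Hn.
    assert (a0 : al <> 0) by (specialize (H O); simpl in H; lra).
    assert (a0' : 0 < Rabs (/ al)) by (apply Rabs_pos_lt, Rinv_neq_0_compat; auto).
    destruct (IH (al + 1) rho th (nonpole_succ _ H) ltac:(lra) Hr Ht (e / 2 / Rabs (/ al) / rho)) as [X1 HX1].
    { repeat apply Rdiv_lt_0_compat; lra. }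
    pose proof (cos_pos th Ht) as Hc.
    destruct (exp_neg_tends0 al (rho * cos th) ltac:(nra) (e / 2 / Rabs (/ al))) as [X2 [HX2 HX]].
    { repeat apply Rdiv_lt_0_compat; lra. }
    exists (Rmax X1 X2). intros x Hx.
    assert (X1 <= x) by (eapply Rle_trans; [apply Rmax_l | exact Hx]).
    assert (X2 <= x) by (eapply Rle_trans; [apply Rmax_r | exact Hx]).
    rewrite igam_ray_rec by (auto; lra). simpl Gamma_shift.
    replace (RtoC (Gamma_shift n (al + 1) / al) * polar_pow rho th (- al))%C with
      (RtoC (/ al) * (polar rho th * (RtoC (Gamma_shift n (al + 1)) * polar_pow rho th (- (al + 1)))))%C.
    2:{ replace (polar_pow rho th (- al)) with (polar rho th * polar_pow rho th (- (al + 1)))%C.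
        - unfold Rdiv. rewrite RtoC_mult. ring.
        - unfold polar_pow. rewrite polar_mult. f_equal; [|ring].
          rewrite <- Rpower_succ by auto. f_equal; ring. }
    replace (_ - _)%C with (RtoC (/ al) * (RtoC (Rpower x al) * Cexp (- (polar rho th * RtoC x)) +
       polar rho th * (igam_ray (al + 1) (polar rho th) x - RtoC (Gamma_shift n (al + 1)) * polar_pow rho th (- (al + 1)))))%C by ring.
    rewrite Cmod_mult, Cmod_R.
    apply Rlt_le_trans with (Rabs (/ al) * (e / 2 / Rabs (/ al) + rho * (e / 2 / Rabs (/ al) / rho))).
    2:{ apply Req_le. field. split; lra. }
    apply Rmult_lt_compat_l; auto. eapply Rle_lt_trans; [apply Cmod_triangle|].
    apply Rplus_lt_compat.
    + rewrite Cmod_mult, Cmod_Cexp, Cmod_R, Rabs_pos_eq by apply Rlt_le, Rpower_pos.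
      replace (Re (- (polar rho th * RtoC x))%C) with (- (rho * cos th * x)); [apply HX; auto|].
      rewrite Cmult_comm, polar_scal. replace (Re (- polar (x * rho) th)%C) with (- Re (polar (x * rho) th)) by reflexivity.
      rewrite Re_polar. ring.
    + rewrite Cmod_mult, Cmod_polar by lra. apply Rmult_lt_compat_l; auto.
Qed.

Lemma Gamma_eq_shift al : exists n, Gamma al = Gamma_shift n al /\ 0 < al + INR n.
Proof.
  exists (shift_to_pos al). split; [reflexivity|]. unfold shift_to_pos.
  destruct (archimed (- al)) as [A _].
  destruct (Z.le_gt_cases 0 (up (- al))) as [Hz|Hz].
  - rewrite INR_IZR_INZ, Z2Nat.id by auto. lra.
  - pose proof (pos_INR (Z.to_nat (up (- al)))). assert (IZR (up (- al)) <= 0) by (apply IZR_le; lia). lra.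
Qed.

Lemma igam_ray_tends al rho th : nonpole al -> 0 < rho -> Rabs th < PI / 2 ->
  Ctends (igam_ray al (polar rho th)) (RtoC (Gamma al) * polar_pow rho th (- al))%C.
Proof.
  intros H Hr Ht. destruct (Gamma_eq_shift al) as [n [-> Hn]]. now apply igam_ray_tends_shift.
Qed.

Lemma shift_to_pos_of_pos al : 0 < al -> shift_to_pos al = O.
Proof.
  intros H. unfold shift_to_pos. destruct (archimed (- al)) as [_ A].
  assert (up (- al) <= 0)%Z; [|lia]. apply Z.lt_succ_r, lt_IZR. simpl. lra.
Qed.

Lemma Gamma_of_pos al : 0 < al -> Gamma al = Gamma_integral al.
Proof. intros H. unfold Gamma. now rewrite shift_to_pos_of_pos. Qed.

Lemma Gamma_pos al : 0 < al -> 0 < Gamma al.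
Proof. intros H. rewrite Gamma_of_pos by auto. now apply Gamma_integral_spec. Qed.

Lemma Ctends_unique f l l' : Ctends f l -> Ctends f l' -> l = l'.
Proof.
  intros H H'.
  assert (E : Cmod (l - l')%C = 0).
  { apply Rle_eps_eq0; [apply Cmod_ge_0|]. intros e He.
    destruct (H (e / 2)) as [X HX]; [lra|]. destruct (H' (e / 2)) as [X' HX']; [lra|].
    specialize (HX (Rmax X X') (Rmax_l _ _)). specialize (HX' (Rmax X X') (Rmax_r _ _)).
    pose proof (Cmod_minus_tri l (f (Rmax X X')) l'). rewrite Cmod_minus_sym in HX. lra. }
  apply Cmod_eq_0 in E. replace l with ((l - l') + l')%C by ring. rewrite E. ring.
Qed.

Lemma Gamma_succ al : nonpole al -> Gamma (al + 1) = al * Gamma al.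
Proof.
  intros H. assert (a0 : al <> 0) by (specialize (H O); simpl in H; lra).
  destruct (Gamma_eq_shift (al + 1)) as [n [E Hn]].
  pose proof PI_RGT_0 as HP.
  assert (T : Rabs 0 < PI / 2) by (rewrite Rabs_R0; lra).
  pose proof (igam_ray_tends al 1 0 H ltac:(lra) T) as L1.
  pose proof (igam_ray_tends_shift (S n) al 1 0 H ltac:(rewrite S_INR; lra) ltac:(lra) T) as L2.
  pose proof (Ctends_unique _ _ _ L1 L2) as Q.
  unfold polar_pow in Q. rewrite Rmult_0_r, polar_0, Rpower_1_base in Q.
  rewrite !Cmult_1_r in Q. apply RtoC_inj in Q. rewrite Q, E. simpl. field; auto.
Qed.

(** * Expansion of the sum for mu = 0 *)

Lemma neg_sq_le (q y : R) : 0 <= q -> 1 <= y -> - (y ^ 2 * q) <= - (q * y).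
Proof.
  intros Hq Hy. apply Ropp_le_contravar. rewrite (Rmult_comm q). apply Rmult_le_compat_r; auto.
  simpl. rewrite Rmult_1_r. rewrite <- (Rmult_1_r y) at 1. apply Rmult_le_compat_l; lra.
Qed.

Definition exp_tail (M : nat) (w : C) : C :=
  (Cexp (- w) - Csum (fun k => RtoC (/ INR (fact k)) * (- w) ^ k) M)%C.

Lemma Cder_pow (f : R -> C) x l n : Cder f x l ->
  Cder (fun t => f t ^ n)%C x (RtoC (INR n) * (l * f x ^ pred n))%C.
Proof.
  intros H. induction n as [|n IH].
  - eapply Cder_eq; [apply Cder_ext with (fun _ => RtoC 1); [intros; reflexivity | apply Cder_const]|]. simpl; ring.
  - eapply Cder_eq; [apply Cder_ext with (fun t => f t * f t ^ n)%C; [intros; reflexivity | apply Cder_mult; eauto]|].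
    rewrite S_INR, RtoC_plus. destruct n as [|n]; simpl; ring.
Qed.

Lemma Cder_opp (f : R -> C) x l : Cder f x l -> Cder (fun t => - f t)%C x (- l)%C.
Proof.
  intros H. eapply Cder_eq; [apply Cder_ext with (fun t => (- (1)) * f t)%C; [intros; ring | apply Cder_scal, H]|]. ring.
Qed.

Lemma Cder_exp_tail (w : R -> C) x l M : Cder w x l ->
  Cder (fun t => exp_tail M (w t)) x (- l * exp_tail (pred M) (w x))%C.
Proof.
  intros H. unfold exp_tail. eapply Cder_eq.
  - apply Cder_minus; [apply Cder_Cexp, Cder_opp, H|].
    apply Cder_Csum. intros k _. apply Cder_scal, Cder_pow, Cder_opp, H.
  - cbv beta. destruct M as [|M]; [simpl; ring|].
    rewrite Csum_S_l. simpl pred.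
    rewrite (Csum_ext _ (fun k => - l * (RtoC (/ INR (fact k)) * (- w x) ^ k))%C).
    + rewrite Csum_scal. simpl. ring.
    + intros k _. simpl pred. rewrite fact_simpl, mult_INR, Rinv_mult, RtoC_mult.
      assert (E : (RtoC (/ INR (S k)) * RtoC (INR (S k)) = 1)%C).
      { rewrite <- RtoC_mult, Rinv_l; auto. apply not_0_INR; lia. }
      transitivity ((RtoC (/ INR (S k)) * RtoC (INR (S k))) * (- l * (RtoC (/ INR (fact k)) * (- w x) ^ k)))%C; [ring|].
      rewrite E. ring.
Qed.

(* x^be w^j exp_tail (N - j) w with w = z x^2; this class is stable under differentiation
   because the truncated subtraction N - j stops at the plain exponential. *)
Definition tail_term (N : nat) (z : C) (be : R) (j : nat) (x : R) : C :=
  (z ^ j * RtoC (Rpower x (be + 2 * INR j)) * exp_tail (N - j) (z * RtoC (x ^ 2)))%C.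

Lemma is_derive_sq x : is_derive (fun t => t ^ 2) x (2 * x).
Proof.
  apply is_derive_Rext with (fun t => t * t); [intros; ring|].
  eapply is_derive_eq; [apply is_derive_Rmult; apply is_derive_Rid | cbv beta; ring].
Qed.

Lemma tail_term_Cder N z be j x : 0 < x ->
  Cder (tail_term N z be j) x
    (RtoC (be + 2 * INR j) * tail_term N z (be - 1) j x + RtoC (- 2) * tail_term N z (be - 1) (S j) x)%C.
Proof.
  intros Hx. unfold tail_term. eapply Cder_eq.
  - apply Cder_mult; [apply Cder_scal, Cder_RtoC, is_derive_Rpower; auto|].
    apply Cder_exp_tail, (Cder_scal z), Cder_RtoC, is_derive_sq.
  - cbv beta. replace (pred (N - j)) with (N - S j)%nat by lia.
    replace (be - 1 + 2 * INR j) with (be + 2 * INR j - 1) by ring.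
    replace (be - 1 + 2 * INR (S j)) with (be + 2 * INR j + 1) by (rewrite S_INR; ring).
    rewrite Rpower_succ, !RtoC_mult by auto. change (RtoC (-2)) with (RtoC (Ropp 2)).
    rewrite RtoC_opp, Cpow_S. ring.
Qed.

Fixpoint tail_coef (ga : R) (i j : nat) : R :=
  match i with
  | O => match j with O => 1 | S _ => 0 end
  | S i' => (ga - INR i' + 2 * INR j) * tail_coef ga i' j
            - 2 * match j with O => 0 | S j' => tail_coef ga i' j' end
  end.

Lemma tail_coef_0 ga i : forall j, (i < j)%nat -> tail_coef ga i j = 0.
Proof.
  induction i as [|i IH]; intros j Hj; destruct j as [|j]; try lia; simpl tail_coef; auto.
  rewrite !IH by lia. ring.
Qed.

Definition tail_family (N : nat) (ga : R) (z : C) (i : nat) (x : R) : C :=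
  Csum (fun j => RtoC (tail_coef ga i j) * tail_term N z (ga - INR i) j x)%C (S i).

Lemma tail_family_Cder N ga z i x : 0 < x ->
  Cder (tail_family N ga z i) x (tail_family N ga z (S i) x).
Proof.
  intros Hx. unfold tail_family at 1. eapply Cder_eq.
  - apply Cder_Csum. intros j _. apply Cder_scal, tail_term_Cder; auto.
  - unfold tail_family.
    rewrite S_INR. replace (ga - (INR i + 1)) with (ga - INR i - 1) by ring.
    set (t := fun j => tail_term N z (ga - INR i - 1) j x).
    rewrite (Csum_ext _ (fun j => RtoC ((ga - INR i + 2 * INR j) * tail_coef ga i j) * t j
       + RtoC (- 2 * tail_coef ga i j) * t (S j))%C).
    2:{ intros j _. fold (t j) (t (S j)). rewrite !RtoC_mult. ring. }
    rewrite Csum_plus.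
    rewrite (Csum_ext (fun j => RtoC (tail_coef ga (S i) j) * _)%C
      (fun j => RtoC ((ga - INR i + 2 * INR j) * tail_coef ga i j) * t j +
        match j with O => RtoC 0 | S j' => RtoC (- 2 * tail_coef ga i j') * t j end)%C).
    2:{ intros j _. fold (t j). simpl tail_coef. destruct j as [|j].
        - rewrite Cplus_0_r. do 2 f_equal. simpl; ring.
        - rewrite RtoC_minus, !RtoC_mult. change (RtoC (-2)) with (RtoC (Ropp 2)). rewrite RtoC_opp. ring. }
    rewrite Csum_plus, (Csum_S_l (fun j => match j with O => RtoC 0 | S j' => _ end)).
    change (Csum ?g (S (S i))) with (Csum g (S i) + g (S i))%C. cbv beta.
    rewrite (tail_coef_0 ga i (S i)) by lia. rewrite Rmult_0_r. ring.
Qed.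

Lemma pow_exp_bounded (p : nat) (c : R) : 0 < c -> exists K, 0 < K /\
  forall y, 0 <= y -> y ^ p * exp (- (c * y)) <= K.
Proof.
  intros Hc. destruct (Rpower_exp_bounded (INR p) c Hc) as [K [K0 HK]].
  exists (K + 1). split; [lra|]. intros y Hy.
  destruct (Rle_lt_dec 1 y) as [H1|H1].
  - rewrite <- Rpower_pow by lra. specialize (HK y H1). lra.
  - assert (y ^ p <= 1) by (rewrite <- (pow1 p); apply pow_incr; lra).
    assert (exp (- (c * y)) <= 1).
    { apply exp_le_1. nra. }
    pose proof (exp_pos (- (c * y))). pose proof (pow_le y p Hy). nra.
Qed.

Lemma exp_tail_bound (N j : nat) (c : R) : 0 < c -> exists K, 0 <= K /\
  forall w, c * Cmod w <= Re w -> Cmod (w ^ j * exp_tail (N - j) w)%C <= K * Cmod w ^ N.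
Proof.
  intros Hc. destruct (Nat.le_gt_cases j N) as [Hj|Hj].
  - exists 2. split; [lra|]. intros w Hw. rewrite Cmod_mult, Cmod_pow.
    pose proof (Cmod_ge_0 w).
    assert (0 <= Re w) by (eapply Rle_trans; [|exact Hw]; apply Rmult_le_pos; lra).
    replace N with (j + (N - j))%nat at 2 by lia. rewrite pow_add.
    replace (2 * (Cmod w ^ j * Cmod w ^ (N - j))) with (Cmod w ^ j * (2 * Cmod w ^ (N - j))) by ring.
    apply Rmult_le_compat_l; [now apply pow_le | now apply Csum_exp_remainder_pos].
  - destruct (pow_exp_bounded (j - N) c Hc) as [K [K0 HK]]. exists K. split; [lra|]. intros w Hw.
    replace (N - j)%nat with O by lia. unfold exp_tail. simpl Csum.
    replace (Cexp (- w) - 0)%C with (Cexp (- w)) by ring. rewrite Cmod_mult, Cmod_pow, Cmod_Cexp.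
    pose proof (Cmod_ge_0 w) as W.
    replace j with (N + (j - N))%nat at 1 by lia. rewrite pow_add, Rmult_assoc, (Rmult_comm K).
    apply Rmult_le_compat_l; [now apply pow_le|]. eapply Rle_trans; [|apply (HK (Cmod w) W)].
    apply Rmult_le_compat_l; [now apply pow_le|]. apply exp_le. change (Re (- w)%C) with (- Re w). lra.
Qed.

Lemma Rpower_sq_pow x N : 0 < x -> (x ^ 2) ^ N = Rpower x (2 * INR N).
Proof.
  intros. rewrite <- pow_mult, <- Rpower_pow by auto. f_equal. rewrite mult_INR. simpl; ring.
Qed.

Lemma tail_term_bound N j c : 0 < c -> exists K, 0 <= K /\ forall be r th x,
  0 < r -> c <= cos th -> 0 < x ->
  Cmod (tail_term N (polar r th) be j x) <= K * r ^ N * Rpower x (be + 2 * INR N).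
Proof.
  intros Hc. destruct (exp_tail_bound N j c Hc) as [K [K0 HK]]. exists K; split; auto.
  intros be r th x Hr Ht Hx. unfold tail_term.
  set (w := (polar r th * RtoC (x ^ 2))%C).
  assert (x2 : 0 < x ^ 2) by (apply pow_lt; auto).
  assert (Ew : w = polar (x ^ 2 * r) th) by (unfold w; now rewrite Cmult_comm, polar_scal).
  assert (Cw : Cmod w = r * x ^ 2) by (rewrite Ew, Cmod_polar; nra).
  assert (E : (polar r th ^ j * RtoC (Rpower x (be + 2 * INR j)) * exp_tail (N - j) w =
     RtoC (Rpower x be) * (w ^ j * exp_tail (N - j) w))%C).
  { rewrite Rpower_plus, RtoC_mult. unfold w at 2. rewrite Cpow_mult_l, <- RtoC_pow, Rpower_sq_pow by auto. ring. }
  rewrite E, Cmod_mult, Cmod_R, Rabs_pos_eq by apply Rlt_le, Rpower_pos.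
  replace (K * r ^ N * Rpower x (be + 2 * INR N)) with (Rpower x be * (K * Cmod w ^ N)).
  - apply Rmult_le_compat_l; [apply Rlt_le, Rpower_pos|]. apply HK. rewrite Cw, Ew, Re_polar.
    assert (0 < r * x ^ 2) by nra. nra.
  - rewrite Cw, Rpow_mult_distr, Rpower_sq_pow, Rpower_plus by auto. ring.
Qed.

Lemma tail_family_bound N ga i c : 0 < c -> exists K, 0 <= K /\ forall r th x,
  0 < r -> c <= cos th -> 0 < x ->
  Cmod (tail_family N ga (polar r th) i x) <= K * r ^ N * Rpower x (ga - INR i + 2 * INR N).
Proof.
  intros Hc.
  assert (F : forall n, exists K, 0 <= K /\ forall r th x, 0 < r -> c <= cos th -> 0 < x ->
    Cmod (Csum (fun j => RtoC (tail_coef ga i j) * tail_term N (polar r th) (ga - INR i) j x)%C n)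
      <= K * r ^ N * Rpower x (ga - INR i + 2 * INR N)).
  { induction n as [|n [K [K0 HK]]].
    - exists 0. split; [lra|]. intros. simpl. rewrite Cmod_0. lra.
    - destruct (tail_term_bound N n c Hc) as [K' [K0' HK']].
      exists (K + Rabs (tail_coef ga i n) * K'). pose proof (Rabs_pos (tail_coef ga i n)).
      split; [apply Rplus_le_le_0_compat; auto; now apply Rmult_le_pos|].
      intros r th x Hr Ht Hx. cbn [Csum]. eapply Rle_trans; [apply Cmod_triangle|].
      rewrite !Rmult_plus_distr_r. apply Rplus_le_compat; [auto|].
      rewrite Cmod_mult, Cmod_R, !Rmult_assoc. apply Rmult_le_compat_l; auto.
      rewrite <- Rmult_assoc. auto. }
  apply F.
Qed.

Section Theta.
Variable ga : R.
Hypothesis Hga : forall m : nat, ga <> - (2 * INR m + 1).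

Let al := (ga + 1) / 2.

Lemma theta_nonpole : nonpole al.
Proof. intros k E. apply (Hga k). unfold al in E. lra. Qed.

Definition zarg (k : nat) : R := - 2 * INR k - ga.

Lemma zarg_neq1 k : zarg k <> 1.
Proof. intros E. apply (Hga k). unfold zarg in E. lra. Qed.

Lemma RtoC_zarg_neq1 k : RtoC (zarg k) <> RtoC 1.
Proof. intros E. apply RtoC_inj in E. now apply zarg_neq1 in E. Qed.

Definition theta_coef (z : C) (k : nat) : C := (RtoC (/ INR (fact k)) * (- z) ^ k)%C.

Definition theta_primitive (z : C) (x : R) : C := (RtoC (/ 2) * igam_ray al z (x ^ 2))%C.

Lemma theta_primitive_Cder z x : 0 < x ->
  Cder (theta_primitive z) x (RtoC (Rpower x ga) * Cexp (- (z * RtoC (x ^ 2))))%C.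
Proof.
  intros Hx. unfold theta_primitive. eapply Cder_eq.
  - apply Cder_scal, (Cder_comp_real (igam_ray al z) (fun x => x ^ 2));
      [apply igam_ray_Cder; [apply theta_nonpole | apply pow_lt; auto] | apply is_derive_sq].
  - replace (Rpower x ga) with (/ 2 * (2 * x * Rpower (x ^ 2) (al - 1))).
    + rewrite !RtoC_mult. ring.
    + replace (x ^ 2) with (Rpower x 2) by (rewrite <- (Rpower_pow 2) by auto; f_equal; simpl; ring).
      rewrite Rpower_mult. replace (/ 2 * (2 * x * Rpower x (2 * (al - 1)))) with (x * Rpower x (2 * (al - 1))) by field.
      rewrite <- Rpower_succ by auto. f_equal. unfold al. field.
Qed.

(* Derivatives of the primitive of x^ga (e^(-z x^2) - its first N Taylor terms). *)
Definition theta_family (N : nat) (z : C) (i : nat) (x : R) : C :=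
  match i with
  | O => (theta_primitive z x - Csum (fun k => theta_coef z k * power_family (RtoC (zarg k)) 0 x) N)%C
  | S j => tail_family N ga z j x
  end.

Lemma power_family_real_1 k x : 0 < x -> power_family (RtoC (zarg k)) 1 x = RtoC (Rpower x (ga + 2 * INR k)).
Proof.
  intros Hx. cbn [power_family falling]. rewrite Cmult_1_l.
  rewrite <- RtoC_opp, <- RtoC_minus, <- RtoC_mult, Cexp_RtoC. unfold Rpower, zarg. do 3 f_equal. simpl; ring.
Qed.

Lemma tail_family_0 N z x : 0 < x -> tail_family N ga z 0 x = 
  (RtoC (Rpower x ga) * Cexp (- (z * RtoC (x ^ 2))) -
   Csum (fun k => theta_coef z k * power_family (RtoC (zarg k)) 1 x) N)%C.
Proof.
  intros Hx. unfold tail_family, tail_term, exp_tail. cbn [Csum tail_coef].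
  rewrite Nat.sub_0_r. change (INR 0) with 0. replace (ga - 0 + 2 * 0) with ga by ring.
  rewrite (Csum_ext (fun k => theta_coef z k * _)%C
    (fun k => RtoC (Rpower x ga) * (RtoC (/ INR (fact k)) * (- (z * RtoC (x ^ 2))) ^ k))%C).
  - rewrite Csum_scal. ring.
  - intros k _. rewrite power_family_real_1 by auto. unfold theta_coef.
    replace (- (z * RtoC (x ^ 2)))%C with ((- z) * RtoC (x ^ 2))%C by ring.
    rewrite Cpow_mult_l, <- RtoC_pow, Rpower_sq_pow, Rpower_plus, RtoC_mult by auto. ring.
Qed.

Lemma theta_family_Cder N z i x : 0 < x -> Cder (theta_family N z i) x (theta_family N z (S i) x).
Proof.
  intros Hx. destruct i as [|i]; [|apply tail_family_Cder; auto].
  cbn [theta_family]. rewrite tail_family_0 by auto.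
  apply Cder_minus; [apply theta_primitive_Cder; auto|].
  apply Cder_Csum. intros k _. apply Cder_scal, power_family_Cder; auto. apply RtoC_zarg_neq1.
Qed.

Lemma theta_family_split N z i : forall x, 0 < x ->
  theta_family 0 z i x =
  (theta_family N z i x + Csum (fun k => theta_coef z k * power_family (RtoC (zarg k)) i x) N)%C.
Proof.
  induction i as [|i IH]; intros x Hx; [cbn [theta_family Csum]; ring|].
  apply (Cder_unique (theta_family 0 z i) x); [apply theta_family_Cder; auto|].
  apply Cder_ext_loc with (fun x => theta_family N z i x +
    Csum (fun k => theta_coef z k * power_family (RtoC (zarg k)) i x) N)%C.
  - apply locally_of_pos; auto. intros y Hy. symmetry. now apply IH.
  - apply Cder_plus; [apply theta_family_Cder; auto|].
    apply Cder_Csum. intros k _. apply Cder_scal, power_family_Cder; auto. apply RtoC_zarg_neq1.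
Qed.

Lemma em_partial_split N z m M :
  em_partial m (theta_family 0 z) M = (em_partial m (theta_family N z) M +
    Csum (fun k => theta_coef z k * em_partial m (power_family (RtoC (zarg k))) M) N)%C.
Proof.
  unfold em_partial, em_bdry.
  rewrite (Csum_ext (fun n => theta_family 0 z 1 (INR (S n))) (fun n => theta_family N z 1 (INR (S n)) +
    Csum (fun k => theta_coef z k * power_family (RtoC (zarg k)) 1 (INR (S n))) N)%C).
  2:{ intros; apply theta_family_split. pose proof (xn_ge1 n); lra. }
  rewrite (Csum_ext (fun i => RtoC (bern i) * theta_family 0 z i (INR (S M)))%C
    (fun i => RtoC (bern i) * theta_family N z i (INR (S M)) +
      Csum (fun k => theta_coef z k * (RtoC (bern i) * power_family (RtoC (zarg k)) i (INR (S M)))) N)%C).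
  2:{ intros i _. rewrite (theta_family_split N) by (pose proof (xn_ge1 M); lra).
      rewrite Cmult_plus_distr_l, <- Csum_scal. f_equal. apply Csum_ext; intros; ring. }
  rewrite !Csum_plus, (Csum_exchange _ M N), (Csum_exchange _ (S m) N).
  rewrite (Csum_ext (fun k => theta_coef z k * (_ - _))%C (fun k =>
    Csum (fun n => theta_coef z k * power_family (RtoC (zarg k)) 1 (INR (S n))) M -
    Csum (fun i => theta_coef z k * (RtoC (bern i) * power_family (RtoC (zarg k)) i (INR (S M)))) (S m))%C).
  - rewrite Csum_minus. ring.
  - intros k _. rewrite !Csum_scal. ring.
Qed.

Definition theta_term (z : C) (n : nat) : C :=
  (RtoC (Rpower (INR (S n)) ga) * Cexp (- (z * RtoC (INR (S n) ^ 2))))%C.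

Definition Theta (z : C) : C := CSeries (theta_term z).

Lemma exp_decay_summable c : 0 < c -> exists K L, 0 <= K /\ Rser (fun n => K * Rpower (INR (S n)) (- (2))) L /\
  (forall n x, c <= x -> Rpower (INR (S n)) ga * exp (- (x * INR (S n) ^ 2)) <= K * Rpower (INR (S n)) (- (2))) .
Proof.
  intros Hc. destruct (Rpower_exp_bounded (ga + 2) c Hc) as [K [K0 HK]].
  destruct (Rpower_summable 2) as [L HL]; [lra|].
  exists K, (K * L). split; [lra|]. split; [now apply Rser_scal|].
  intros n x Hx. set (y := INR (S n)). assert (Hy : 1 <= y) by apply xn_ge1.
  specialize (HK y Hy).
  apply Rle_trans with (Rpower y ga * exp (- (c * y))).
  - apply Rmult_le_compat_l; [apply Rlt_le, Rpower_pos|]. apply exp_le.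
    clearbody y. apply Ropp_le_contravar. simpl. rewrite Rmult_1_r, <- Rmult_assoc.
    rewrite <- (Rmult_1_r (c * y)). apply Rmult_le_compat; try lra; [|apply Rmult_le_compat_r; lra].
    apply Rmult_le_pos; lra.
  - replace (Rpower y ga) with (Rpower y (ga + 2) * Rpower y (- (2))).
    + pose proof (Rpower_pos y (- (2))). 
      replace (Rpower y (ga + 2) * Rpower y (- (2)) * exp (- (c * y))) with
        (Rpower y (ga + 2) * exp (- (c * y)) * Rpower y (- (2))) by ring.
      apply Rmult_le_compat_r; lra.
    + rewrite <- Rpower_plus. f_equal; ring.
Qed.

Lemma Cmod_theta_term z n : Cmod (theta_term z n) = Rpower (INR (S n)) ga * exp (- (Re z * INR (S n) ^ 2)).
Proof.
  unfold theta_term. rewrite Cmod_mult, Cmod_R, Cmod_Cexp, Rabs_pos_eq by apply Rlt_le, Rpower_pos.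
  do 2 f_equal. change (Re (- (z * RtoC (INR (S n) ^ 2)))%C) with (- Re (z * RtoC (INR (S n) ^ 2))%C).
  rewrite Cmult_comm, Re_RtoC_mult. ring.
Qed.

Lemma Theta_spec z : 0 < Re z -> Cser (theta_term z) (Theta z).
Proof.
  intros Hz. destruct (exp_decay_summable (Re z) Hz) as [K [L [K0 [HL HK]]]].
  destruct (Cser_abs (theta_term z) (fun n => K * Rpower (INR (S n)) (- (2))) L) with (2 := HL) as [s [Hs _]].
  - intros n. rewrite Cmod_theta_term. apply HK. lra.
  - unfold Theta. now rewrite (CSeries_unique _ _ Hs).
Qed.

Lemma Ctends_seq (f : R -> C) l (x : nat -> R) :
  Ctends f l -> (forall n, INR n <= x n) -> Clim (fun n => f (x n)) l.
Proof.
  intros H Hx. apply Clim_eps. intros e He. destruct (H e He) as [X HX].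
  destruct (nfloor_ex (Rmax X 0)) as [N HN]; [apply Rmax_r|].
  exists (S N). intros n Hn. apply HX. apply le_INR in Hn. rewrite S_INR in Hn.
  specialize (Hx n). pose proof (Rmax_l X 0). lra.
Qed.

Lemma theta_family_bdry_limit z m r th : z = polar r th -> 0 < r -> Rabs th < PI / 2 ->
  Clim (fun M => em_bdry m (theta_family 0 z) (INR (S M)))
    (RtoC (/ 2 * Gamma al) * polar_pow r th (- al))%C.
Proof.
  intros Ez Hr Ht. pose proof (cos_pos th Ht) as Hc.
  induction m as [|m IH]; unfold em_bdry.
  - apply Clim_ext with (fun M => RtoC (/ 2) * igam_ray al z (INR (S M) ^ 2))%C.
    + intros M. cbn [Csum theta_family]. unfold theta_primitive, bern. simpl bern_upto.
      replace (1 - 0) with 1 by ring. ring.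
    + rewrite RtoC_mult, <- Cmult_assoc. apply Clim_scal. subst z.
      apply (Ctends_seq _ _ (fun M => INR (S M) ^ 2) (igam_ray_tends al r th theta_nonpole Hr Ht)).
      intros n. rewrite S_INR. pose proof (pos_INR n). nra.
  - change (Clim (fun M => em_bdry m (theta_family 0 z) (INR (S M)) +
       RtoC (bern (S m)) * tail_family 0 ga z m (INR (S M)))%C (RtoC (/ 2 * Gamma al) * polar_pow r th (- al))%C).
    replace (RtoC (/ 2 * Gamma al) * polar_pow r th (- al))%C with
      (RtoC (/ 2 * Gamma al) * polar_pow r th (- al) + RtoC (bern (S m)) * 0)%C by ring.
    apply Clim_plus; auto. apply Clim_scal. unfold tail_family.
    assert (G : forall n, Clim (fun M => Csum (fun j => RtoC (tail_coef ga m j) *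
       tail_term 0 z (ga - INR m) j (INR (S M))) n)%C 0).
    { induction n as [|n IHn]; [exact (Clim_const 0)|]. cbn [Csum].
      replace (RtoC 0) with (0 + RtoC (tail_coef ga m n) * 0)%C by ring.
      apply Clim_plus; auto. apply Clim_scal. unfold tail_term, exp_tail. cbn [Nat.sub Csum].
      apply Clim_squeeze with (fun M => Cmod (z ^ n)%C * (Rpower (INR (S M)) (ga - INR m + 2 * INR n) * exp (- (r * cos th * INR (S M))))).
      - intros M. replace (_ - 0)%C with (z ^ n * (RtoC (Rpower (INR (S M)) (ga - INR m + 2 * INR n)) * Cexp (- (z * RtoC (INR (S M) ^ 2)))))%C by ring.
        rewrite !Cmod_mult, Cmod_R, Cmod_Cexp, Rabs_pos_eq by apply Rlt_le, Rpower_pos.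
        apply Rmult_le_compat_l; [apply Cmod_ge_0|].
        apply Rmult_le_compat_l; [apply Rlt_le, Rpower_pos|]. apply exp_le.
        change (Re (- (z * RtoC (INR (S M) ^ 2)))%C) with (- Re (z * RtoC (INR (S M) ^ 2))%C).
        rewrite Cmult_comm, Re_RtoC_mult, Ez, Re_polar. pose proof (xn_ge1 M).
        apply neg_sq_le; auto. apply Rlt_le, Rmult_lt_0_compat; auto.
      - apply lim0_mult_const. apply is_lim_seq_eps. intros e He.
        destruct (exp_neg_tends0 (ga - INR m + 2 * INR n) (r * cos th) ltac:(nra) e He) as [X [HX1 HX]].
        destruct (nfloor_ex X) as [N0 HN0]; [lra|]. exists N0. intros M HM.
        rewrite Rminus_0_r, Rabs_pos_eq.
        + apply HX. rewrite S_INR. apply le_INR in HM. lra.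
        + apply Rlt_le, Rpower_exp_pos. }
    apply G.
Qed.

Lemma theta_family_at_1 N : exists K, 0 <= K /\ forall z, Cmod z <= 1 ->
  Cmod (theta_family N z 0 1) <= K * Cmod z ^ N.
Proof.
  destruct (igam_tail al theta_nonpole) as [A [A0 HA]].
  exists (A * exp 1). pose proof (exp_pos 1). split; [apply Rmult_le_pos; lra|]. intros z Hz.
  destruct (HA z) as [_ [_ T]]. specialize (T N).
  replace (theta_family N z 0 1) with (RtoC (/ 2) * (igam al z - Csum (fun k => RtoC (igam_coef al k) * (- z) ^ k) N))%C.
  - rewrite Cmod_mult, Cmod_R, Rabs_pos_eq by lra.
    pose proof (Csum_exp_remainder (RtoC (- Cmod z)) N (exp 1)) as R1.
    pose proof (Cmod_ge_0 z) as Z0.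
    assert (E : Cmod (Cexp (- RtoC (- Cmod z)) - Csum (fun k => RtoC (/ INR (fact k)) * (- RtoC (- Cmod z)) ^ k) N)%C =
      Rabs (exp (Cmod z) - Rsum (fun k => Cmod z ^ k / INR (fact k)) N)).
    { rewrite <- RtoC_opp, Ropp_involutive, Cexp_RtoC.
      rewrite (Csum_ext _ (fun k => RtoC (Cmod z ^ k / INR (fact k)))).
      - now rewrite <- RtoC_Rsum, <- RtoC_minus, Cmod_R.
      - intros k _. rewrite <- RtoC_pow, <- RtoC_mult. f_equal. unfold Rdiv; ring. }
    rewrite E in R1. clear E.
    assert (R2 : exp (Cmod z) - Rsum (fun k => Cmod z ^ k / INR (fact k)) N <= 2 * (exp 1 * Cmod z ^ N)).
    { eapply Rle_trans; [apply Rle_abs|]. eapply Rle_trans; [apply R1|].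
      - intros t Ht. apply exp_le. simpl. nra.
      - apply Rle_trans with (exp 0); [rewrite exp_0; lra | apply exp_le; lra].
      - apply Rmult_le_compat_l; [lra|]. apply Rmult_le_compat_l; [lra|].
        rewrite Cmod_R, Rabs_Ropp, Rabs_pos_eq by auto.
        unfold Rdiv. rewrite <- (Rmult_1_r (Cmod z ^ N)) at 2. apply Rmult_le_compat_l; [now apply pow_le | apply inv_fact_bounds]. }
    assert (A * (exp (Cmod z) - Rsum (fun k => Cmod z ^ k / INR (fact k)) N) <= A * (2 * (exp 1 * Cmod z ^ N))).
    { apply Rmult_le_compat_l; lra. }
    lra.
  - cbn [theta_family]. unfold theta_primitive, igam_ray.
    replace (1 ^ 2) with 1 by ring. rewrite Rpower_1_base.
    rewrite (Csum_ext (fun k => theta_coef z k * _)%C (fun k => RtoC (/ 2) * (RtoC (igam_coef al k) * (- z) ^ k))%C).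
    + rewrite Csum_scal. replace (z * RtoC 1)%C with z by ring. ring.
    + intros k _. unfold theta_coef, igam_coef. cbn [power_family].
      rewrite ln_1. replace ((1 - RtoC (zarg k)) * RtoC 0)%C with (RtoC 0) by ring. rewrite Cexp_0.
      pose proof (theta_nonpole k) as Q. pose proof (zarg_neq1 k).
      rewrite <- RtoC_minus, <- RtoC_div by lra.
      replace (1 / (1 - zarg k)) with (/ 2 * / (al + INR k)).
      * rewrite !RtoC_mult. ring.
      * unfold al, zarg in *. field. repeat split; lra.
Qed.

Definition theta_remainder (N : nat) (r th : R) : C :=
  (Theta (polar r th) - RtoC (/ 2 * Gamma al) * polar_pow r th (- al)
   - Csum (fun k => theta_coef (polar r th) k * zeta (RtoC (zarg k))) N)%C.

Lemma theta_expansion_small N c : 0 < c -> exists K, 0 <= K /\ forall r th,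
  0 < r <= 1 -> Rabs th < PI / 2 -> c <= cos th -> Cmod (theta_remainder N r th) <= K * r ^ N.
Proof.
  intros Hc.
  destruct (exists_nat_above (- ga - 2 * INR N)) as [m0 Hm0].
  pose (m := (m0 + 3)%nat).
  assert (Hm : 1 < INR m - ga - 2 * INR N) by (unfold m; rewrite plus_INR; simpl; lra).
  destruct (tail_family_bound N ga m c Hc) as [K1 [K10 HK1]].
  destruct (theta_family_at_1 N) as [K2 [K20 HK2]].
  destruct (Rpower_summable _ Hm) as [l Hl].
  assert (B : forall i, exists K, 0 <= K /\ forall r th, 0 < r <= 1 -> c <= cos th ->
     Cmod (theta_family N (polar r th) i 1) <= K * r ^ N).
  { intros [|i].
    - exists K2. split; auto. intros r th Hr Ht. pose proof (HK2 (polar r th)) as Q.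
      rewrite Cmod_polar in Q by lra. apply Q; lra.
    - destruct (tail_family_bound N ga i c Hc) as [K3 [K30 HK3]]. exists K3. split; auto.
      intros r th Hr Ht. cbn [theta_family]. eapply Rle_trans; [apply HK3; lra|].
      rewrite Rpower_1_base. lra. }
  assert (B2 : forall n, exists K, 0 <= K /\ forall r th, 0 < r <= 1 -> c <= cos th ->
     Cmod (Csum (fun i => RtoC (bern i) * theta_family N (polar r th) i 1) n)%C <= K * r ^ N).
  { induction n as [|n [K [K0 HK]]].
    - exists 0. split; [lra|]. intros. simpl. rewrite Cmod_0; lra.
    - destruct (B n) as [K' [K0' HK']]. exists (K + Rabs (bern n) * K').
      pose proof (Rabs_pos (bern n)). split; [apply Rplus_le_le_0_compat; auto; now apply Rmult_le_pos|].
      intros r th Hr Ht. cbn [Csum]. eapply Rle_trans; [apply Cmod_triangle|].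
      rewrite Rmult_plus_distr_r. apply Rplus_le_compat; auto.
      rewrite Cmod_mult, Cmod_R, Rmult_assoc. apply Rmult_le_compat_l; auto. }
  destruct (B2 (S m)) as [K3 [K30 HK3]].
  assert (l0 : 0 <= l).
  { apply (Rser_ge_sum _ l O) in Hl; auto. intros; apply Rlt_le, Rpower_pos. }
  exists (emB m * K1 * l + K3). pose proof (emB_pos m) as E0.
  split; [apply Rplus_le_le_0_compat; auto; apply Rmult_le_pos; auto; now apply Rmult_le_pos|].
  intros r th Hr Ht Hct. pose (z := polar r th).
  assert (rN : 0 <= r ^ N) by (apply pow_le; lra).
  destruct (em_converges m (theta_family N z) (K1 * r ^ N) (INR m - ga - 2 * INR N) l) as [s [_ [Hs L]]]; auto.
  - unfold m; lia.
  - intros; apply theta_family_Cder; lra.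
  - now apply Rmult_le_pos.
  - intros x Hx. cbn [theta_family]. eapply Rle_trans; [apply HK1; lra|].
    apply Req_le. do 2 f_equal. ring.
  - assert (L2 : Clim (em_partial m (theta_family 0 z))
      (s - em_bdry m (theta_family N z) 1 + Csum (fun k => theta_coef z k * zeta (RtoC (zarg k))) N)%C).
    { eapply Clim_ext; [intros; symmetry; apply (em_partial_split N)|].
      apply Clim_plus; auto.
      assert (G : forall n, (n <= N)%nat -> Clim (fun M => Csum (fun k => theta_coef z k *
        em_partial m (power_family (RtoC (zarg k))) M) n)%C (Csum (fun k => theta_coef z k * zeta (RtoC (zarg k)))%C n)).
      { induction n as [|n IH]; intros Hn; [exact (Clim_const 0)|]. cbn [Csum].
        apply Clim_plus; [apply IH; lia|]. apply Clim_scal.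
        rewrite zeta_real by apply zarg_neq1. apply (zeta_em_spec _ (RtoC_zarg_neq1 n)); [unfold m; lia|].
        simpl Re. unfold zarg. apply le_INR in Hn. rewrite S_INR in Hn. lra. }
      apply G; auto. }
    assert (L3 : Clim (em_partial m (theta_family 0 z)) (Theta z - RtoC (/ 2 * Gamma al) * polar_pow r th (- al))%C).
    { unfold em_partial. apply Clim_minus.
      - assert (Rz : 0 < Re z) by (unfold z; rewrite Re_polar; nra).
        apply (Cser_ext (theta_term z)); [|now apply Theta_spec].
        intros n. cbn [theta_family]. rewrite tail_family_0 by (pose proof (xn_ge1 n); lra).
        unfold theta_term. cbn [Csum]. ring.
      - apply (theta_family_bdry_limit z m r th); auto; lra. }
    pose proof (Clim_unique _ _ _ L3 L2) as E. unfold theta_remainder. fold z. rewrite E.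
    replace (_ - _)%C with (s - em_bdry m (theta_family N z) 1)%C by ring.
    eapply Rle_trans; [apply Cmod_minus_le|]. rewrite Rmult_plus_distr_r.
    apply Rplus_le_compat.
    + eapply Rle_trans; [exact Hs|]. apply Req_le. ring.
    + apply HK3; auto.
Qed.

Theorem theta_expansion N c : 0 < c -> exists K p, 0 <= K /\ forall r th,
  0 < r -> Rabs th < PI / 2 -> c <= cos th ->
  Cmod (theta_remainder N r th) <= K * (r ^ N * (1 + r) ^ p).
Proof.
  intros Hc. destruct (theta_expansion_small N c Hc) as [K1 [K10 HK1]].
  destruct (exp_decay_summable c Hc) as [K2 [L [K20 [HL HK2]]]].
  destruct (nfloor_ex (Rabs al)) as [p0 Hp0]; [apply Rabs_pos|]. pose (p := S p0).
  assert (Hp : - al <= INR p).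
  { unfold p. rewrite S_INR. pose proof (Rle_abs (- al)). rewrite Rabs_Ropp in H. lra. }
  assert (B : forall n, exists K, 0 <= K /\ forall r th, 1 <= r ->
     Cmod (Csum (fun k => theta_coef (polar r th) k * zeta (RtoC (zarg k))) n)%C <= K * r ^ n).
  { induction n as [|n [K [K0 HK]]].
    - exists 0. split; [lra|]. intros. simpl. rewrite Cmod_0; lra.
    - exists (K + Cmod (zeta (RtoC (zarg n)))). pose proof (Cmod_ge_0 (zeta (RtoC (zarg n)))).
      split; [lra|]. intros r th Hr. cbn [Csum]. eapply Rle_trans; [apply Cmod_triangle|].
      assert (P : r ^ n <= r ^ S n) by (apply Rle_pow; auto).
      assert (P0 : 0 <= r ^ n) by (apply pow_le; lra).
      rewrite Rmult_plus_distr_r. apply Rplus_le_compat.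
      + eapply Rle_trans; [apply HK; auto|]. apply Rmult_le_compat_l; auto.
      + unfold theta_coef. rewrite !Cmod_mult, Cmod_pow, Cmod_opp, Cmod_polar, Cmod_R by lra.
        assert (F : Rabs (/ INR (fact n)) <= 1).
        { pose proof (inv_fact_bounds n). rewrite Rabs_pos_eq; lra. }
        rewrite Rmult_comm. apply Rmult_le_compat_l; auto.
        pose proof (Rabs_pos (/ INR (fact n))). nra. }
  destruct (B N) as [K3 [K30 HK3]].
  assert (L0 : 0 <= L).
  { apply (Rser_ge_sum _ L O) in HL; auto. intros; apply Rmult_le_pos; [lra | apply Rlt_le, Rpower_pos]. }
  exists (K1 + (L + Rabs (/ 2 * Gamma al) + K3)), p.
  pose proof (Rabs_pos (/ 2 * Gamma al)) as G0. split; [lra|].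
  intros r th Hr Ht Hct.
  assert (P1 : 1 <= (1 + r) ^ p) by (apply pow_R1_Rle; lra).
  assert (P2 : 0 < r ^ N) by now apply pow_lt.
  destruct (Rle_lt_dec r 1) as [H1|H1].
  - eapply Rle_trans; [apply HK1; auto; lra|].
    apply Rmult_le_compat; try lra. rewrite <- (Rmult_1_r (r ^ N)) at 1. apply Rmult_le_compat_l; lra.
  - assert (P3 : 1 <= r ^ N) by (apply pow_R1_Rle; lra).
    assert (T : Cmod (Theta (polar r th)) <= L).
    { assert (Rz : c <= Re (polar r th)) by (rewrite Re_polar; nra).
      destruct (Cser_abs (theta_term (polar r th)) (fun n => K2 * Rpower (INR (S n)) (- (2))) L) with (2 := HL) as [s [Hs [Bs _]]].
      - intros n. rewrite Cmod_theta_term. now apply HK2.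
      - rewrite (Cser_unique _ _ _ (Theta_spec (polar r th) ltac:(lra)) Hs). auto. }
    assert (M : Cmod (RtoC (/ 2 * Gamma al) * polar_pow r th (- al))%C <= Rabs (/ 2 * Gamma al) * (1 + r) ^ p).
    { unfold polar_pow. rewrite Cmod_mult, Cmod_R, Cmod_polar by apply Rlt_le, Rpower_pos.
      apply Rmult_le_compat_l; auto. apply Rle_trans with (Rpower r (INR p)).
      - apply Rpower_le_exponent; lra.
      - rewrite Rpower_pow by lra. apply pow_incr; lra. }
    specialize (HK3 r th ltac:(lra)). unfold theta_remainder.
    eapply Rle_trans; [apply Cmod_minus_le|].
    eapply Rle_trans; [apply Rplus_le_compat_r, Cmod_minus_le|].
    set (X := r ^ N * (1 + r) ^ p). assert (X1 : (1 + r) ^ p <= X) by (unfold X; nra).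
    assert (X2 : r ^ N <= X) by (unfold X; nra).
    assert (L <= L * X) by nra.
    assert (Rabs (/ 2 * Gamma al) * (1 + r) ^ p <= Rabs (/ 2 * Gamma al) * X) by (apply Rmult_le_compat_l; auto).
    assert (K3 * r ^ N <= K3 * X) by (apply Rmult_le_compat_l; auto).
    assert (0 <= K1 * X) by (apply Rmult_le_pos; lra). lra.
Qed.

End Theta.

(** * Truncated gamma averages *)

Lemma RInt_Rext (f g : R -> R) (a b : R) :
  (forall x, Rmin a b < x < Rmax a b -> f x = g x) -> RInt f a b = RInt g a b.
Proof. intros H. now apply RInt_ext. Qed.

Definition cont_pos (f : R -> R) : Prop := forall t, 0 < t -> continuous f t.

Lemma cont_pos_plus f g : cont_pos f -> cont_pos g -> cont_pos (fun t => f t + g t).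
Proof. intros H G t Ht. apply (continuous_plus f g t (H t Ht) (G t Ht)). Qed.

Lemma cont_pos_mult f g : cont_pos f -> cont_pos g -> cont_pos (fun t => f t * g t).
Proof. intros H G t Ht. apply (continuous_mult f g t (H t Ht) (G t Ht)). Qed.

Lemma cont_pos_const c : cont_pos (fun _ => c).
Proof. intros t _. apply continuous_const. Qed.

Lemma cont_pos_scal c f : cont_pos f -> cont_pos (fun t => c * f t).
Proof. intros H. apply (cont_pos_mult (fun _ => c)); auto. apply cont_pos_const. Qed.

Lemma cont_pos_derive (f f' : R -> R) : (forall t, 0 < t -> is_derive f t (f' t)) -> cont_pos f.
Proof. intros H t Ht. now apply (is_derive_continuous f t (f' t)), H. Qed.

Lemma cont_pos_id : cont_pos (fun t => t).
Proof. intros t _. apply continuous_id. Qed.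

Lemma cont_pos_pow n f : cont_pos f -> cont_pos (fun t => f t ^ n).
Proof.
  intros H. induction n as [|n IH]; [apply (cont_pos_const 1)|]. simpl. now apply cont_pos_mult.
Qed.

Lemma cont_pos_weight mu : cont_pos (fun t => Rpower t (mu - 1) * exp (- t)).
Proof.
  intros t Ht. apply (continuous_ext (fun t => Rpower t (mu - 1) * exp (- (1 * t)))).
  - intros; now rewrite Rmult_1_l.
  - now apply continuous_Rpower_exp.
Qed.

Definition lo (k : nat) : R := / INR (S k).
Definition hi (k : nat) : R := INR (S k).

(* Truncations of Gamma(mu) times the expectation under the Gamma(mu) distribution. *)
Definition gexp (mu : R) (k : nat) (f : R -> R) : R :=
  RInt (fun t => Rpower t (mu - 1) * exp (- t) * f t) (lo k) (hi k).

Lemma lo_pos k : 0 < lo k.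
Proof. apply Rinv_0_lt_compat. pose proof (xn_ge1 k). lra. Qed.

Lemma lo_le_1 k : lo k <= 1.
Proof. unfold lo. rewrite <- Rinv_1. apply Rinv_le_contravar; [lra | apply xn_ge1]. Qed.

Lemma lo_le_hi k : lo k <= hi k.
Proof. pose proof (lo_le_1 k). pose proof (xn_ge1 k). unfold hi. lra. Qed.

Lemma ex_RInt_cont_pos f a b : cont_pos f -> 0 < a <= b -> ex_RInt f a b.
Proof.
  intros H Hab. apply (ex_RInt_continuous (V := R_CompleteNormedModule)).
  intros z Hz. rewrite Rmin_left, Rmax_right in Hz by lra. apply H; lra.
Qed.

Lemma ex_RInt_gexp mu k f : cont_pos f ->
  ex_RInt (fun t => Rpower t (mu - 1) * exp (- t) * f t) (lo k) (hi k).
Proof.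
  intros H. apply ex_RInt_cont_pos.
  - apply cont_pos_mult; auto. apply cont_pos_weight.
  - pose proof (lo_pos k); pose proof (lo_le_hi k). lra.
Qed.

Lemma gexp_ext mu k f g : (forall t, 0 < t -> f t = g t) -> gexp mu k f = gexp mu k g.
Proof.
  intros H. apply RInt_Rext. intros t Ht. pose proof (lo_pos k). pose proof (lo_le_hi k).
  rewrite Rmin_left in Ht by lra. rewrite H; auto; lra.
Qed.

Lemma gexp_plus mu k f g : cont_pos f -> cont_pos g ->
  gexp mu k (fun t => f t + g t) = gexp mu k f + gexp mu k g.
Proof.
  intros H G. unfold gexp.
  pose proof (RInt_plus (V := R_CompleteNormedModule) _ _ (lo k) (hi k) (ex_RInt_gexp mu k f H) (ex_RInt_gexp mu k g G)) as E.
  unfold plus in E; simpl in E. rewrite <- E. apply RInt_Rext. intros t _. apply Rmult_plus_distr_l.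
Qed.

Lemma gexp_scal mu k c f : cont_pos f -> gexp mu k (fun t => c * f t) = c * gexp mu k f.
Proof.
  intros H. unfold gexp.
  pose proof (RInt_scal (V := R_CompleteNormedModule) _ (lo k) (hi k) c (ex_RInt_gexp mu k f H)) as E.
  unfold scal in E; simpl in E; unfold mult in E; simpl in E. rewrite <- E.
  apply RInt_Rext. intros t _. ring.
Qed.

Lemma gexp_le mu k f g : cont_pos f -> cont_pos g -> (forall t, 0 < t -> f t <= g t) ->
  gexp mu k f <= gexp mu k g.
Proof.
  intros H G L. apply RInt_le; auto using lo_le_hi, ex_RInt_gexp. intros t Ht.
  pose proof (lo_pos k). apply Rmult_le_compat_l; [apply Rlt_le, Rpower_exp_pos | apply L; lra].
Qed.

Lemma gexp_abs mu k f g : cont_pos f -> cont_pos g -> (forall t, 0 < t -> Rabs (f t) <= g t) ->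
  Rabs (gexp mu k f) <= gexp mu k g.
Proof.
  intros H G L.
  apply (norm_RInt_le (V := R_NormedModule) (fun t => Rpower t (mu - 1) * exp (- t) * f t)
    (fun t => Rpower t (mu - 1) * exp (- t) * g t) (lo k) (hi k)).
  - apply lo_le_hi.
  - intros t Ht. pose proof (lo_pos k). change (Rabs (Rpower t (mu - 1) * exp (- t) * f t) <= Rpower t (mu - 1) * exp (- t) * g t).
    rewrite Rabs_mult, (Rabs_pos_eq _ (Rlt_le _ _ (Rpower_exp_pos t (mu - 1) (- t)))).
    apply Rmult_le_compat_l; [apply Rlt_le, Rpower_exp_pos | apply L; lra].
  - apply (RInt_correct (V := R_CompleteNormedModule)), ex_RInt_gexp, H.
  - apply (RInt_correct (V := R_CompleteNormedModule)), ex_RInt_gexp, G.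
Qed.

Lemma gexp_mono_k mu k l f : (k <= l)%nat -> cont_pos f -> (forall t, 0 < t -> 0 <= f t) ->
  gexp mu k f <= gexp mu l f.
Proof.
  intros Hkl H P. unfold gexp. set (g := fun t => Rpower t (mu - 1) * exp (- t) * f t).
  assert (Cg : cont_pos g) by (apply cont_pos_mult; auto; apply cont_pos_weight).
  assert (Pg : forall t, 0 < t -> 0 <= g t).
  { intros t Ht. apply Rmult_le_pos; auto. apply Rlt_le, Rpower_exp_pos. }
  pose proof (lo_pos k). pose proof (lo_pos l). pose proof (lo_le_hi k). pose proof (lo_le_hi l).
  assert (lo l <= lo k).
  { unfold lo. apply Rinv_le_contravar; [pose proof (xn_ge1 k); lra|]. apply le_INR; lia. }
  assert (hi k <= hi l) by (unfold hi; apply le_INR; lia).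
  rewrite <- (RInt_Chasles (V := R_CompleteNormedModule) g (lo l) (lo k) (hi l)) by (apply ex_RInt_cont_pos; auto; lra).
  rewrite <- (RInt_Chasles (V := R_CompleteNormedModule) g (lo k) (hi k) (hi l)) by (apply ex_RInt_cont_pos; auto; lra).
  unfold plus; simpl.
  assert (0 <= RInt g (lo l) (lo k)).
  { apply RInt_ge_0; [lra | apply ex_RInt_cont_pos; auto; lra |]. intros; apply Pg; lra. }
  assert (0 <= RInt g (hi k) (hi l)).
  { apply RInt_ge_0; [lra | apply ex_RInt_cont_pos; auto; lra |]. intros; apply Pg; lra. }
  lra.
Qed.

Lemma gexp_primitive mu k f G : cont_pos f ->
  (forall t, 0 < t -> is_derive G t (Rpower t (mu - 1) * exp (- t) * f t)) ->
  gexp mu k f = G (hi k) - G (lo k).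
Proof.
  intros H D. unfold gexp. apply (is_RInt_unique (V := R_CompleteNormedModule)).
  pose proof (lo_pos k). pose proof (lo_le_hi k).
  apply (is_RInt_derive (V := R_CompleteNormedModule) G).
  - intros x Hx. rewrite Rmin_left, Rmax_right in Hx by lra. apply D; lra.
  - intros x Hx. rewrite Rmin_left, Rmax_right in Hx by lra.
    apply (cont_pos_mult _ _ (cont_pos_weight mu) H). lra.
Qed.

Definition ccont_pos (F : R -> C) : Prop :=
  cont_pos (fun t => Re (F t)) /\ cont_pos (fun t => Im (F t)).

Definition cgexp (mu : R) (k : nat) (F : R -> C) : C :=
  (gexp mu k (fun t => Re (F t)), gexp mu k (fun t => Im (F t))).

Lemma ccont_pos_Cder (F F' : R -> C) : (forall t, 0 < t -> Cder F t (F' t)) -> ccont_pos F.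
Proof.
  intros H; split.
  - apply cont_pos_derive with (fun t => Re (F' t)). intros; now apply H.
  - apply cont_pos_derive with (fun t => Im (F' t)). intros; now apply H.
Qed.

Lemma cont_pos_ext (f g : R -> R) : (forall t, f t = g t) -> cont_pos f -> cont_pos g.
Proof. intros E H t Ht. apply (continuous_ext f); auto. Qed.

Lemma ccont_pos_ext F G : (forall t, F t = G t) -> ccont_pos F -> ccont_pos G.
Proof.
  intros E [H1 H2]; split.
  - apply (cont_pos_ext (fun t => Re (F t))); auto. intros; now rewrite E.
  - apply (cont_pos_ext (fun t => Im (F t))); auto. intros; now rewrite E.
Qed.

Lemma ccont_pos_plus F G : ccont_pos F -> ccont_pos G -> ccont_pos (fun t => F t + G t)%C.
Proof. intros [H1 H2] [G1 G2]; split; simpl; now apply cont_pos_plus. Qed.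

Lemma ccont_pos_scal c F : ccont_pos F -> ccont_pos (fun t => c * F t)%C.
Proof.
  intros [H1 H2]; split.
  - apply (cont_pos_ext (fun t => Re c * Re (F t) + (- Im c) * Im (F t))).
    + intros; simpl; unfold Re, Im; ring.
    + now apply cont_pos_plus; apply cont_pos_scal.
  - apply (cont_pos_ext (fun t => Re c * Im (F t) + Im c * Re (F t))).
    + intros; simpl; unfold Re, Im; ring.
    + now apply cont_pos_plus; apply cont_pos_scal.
Qed.

Lemma ccont_pos_RtoC f : cont_pos f -> ccont_pos (fun t => RtoC (f t)).
Proof. intros H; split; simpl; auto. apply cont_pos_const. Qed.

Lemma ccont_pos_Csum (F : nat -> R -> C) n : (forall k, (k < n)%nat -> ccont_pos (F k)) ->
  ccont_pos (fun t => Csum (fun k => F k t) n).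
Proof.
  induction n as [|n IH]; intros H; simpl; [apply ccont_pos_RtoC, cont_pos_const|].
  apply ccont_pos_plus; [apply IH; intros; apply H; lia | apply H; lia].
Qed.

Lemma cgexp_ext mu k F G : (forall t, 0 < t -> F t = G t) -> cgexp mu k F = cgexp mu k G.
Proof. intros H. apply C_ext; simpl; apply gexp_ext; intros; now rewrite H. Qed.

Lemma cgexp_plus mu k F G : ccont_pos F -> ccont_pos G ->
  cgexp mu k (fun t => F t + G t)%C = (cgexp mu k F + cgexp mu k G)%C.
Proof. intros [H1 H2] [G1 G2]. apply C_ext; simpl; now apply gexp_plus. Qed.

Lemma cgexp_scal mu k c F : ccont_pos F -> cgexp mu k (fun t => c * F t)%C = (c * cgexp mu k F)%C.
Proof.
  intros [H1 H2]. apply C_ext.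
  - simpl Re at 1. transitivity (gexp mu k (fun t => Re c * Re (F t) + (- Im c) * Im (F t))).
    + apply gexp_ext. intros; simpl; unfold Re, Im; ring.
    + rewrite gexp_plus by now apply cont_pos_scal. rewrite !gexp_scal by auto. simpl. unfold Re, Im; ring.
  - simpl Im at 1. transitivity (gexp mu k (fun t => Re c * Im (F t) + Im c * Re (F t))).
    + apply gexp_ext. intros; simpl; unfold Re, Im; ring.
    + rewrite gexp_plus by now apply cont_pos_scal. rewrite !gexp_scal by auto. simpl. unfold Re, Im; ring.
Qed.

Lemma gexp_zero mu k : gexp mu k (fun _ => 0) = 0.
Proof.
  transitivity (gexp mu k (fun t => 0 * 0)); [apply gexp_ext; intros; ring|].
  rewrite (gexp_scal mu k 0 (fun _ => 0)) by apply cont_pos_const. ring.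
Qed.

Lemma cgexp_RtoC mu k f : cgexp mu k (fun t => RtoC (f t)) = RtoC (gexp mu k f).
Proof. apply C_ext; simpl; [reflexivity | apply gexp_zero]. Qed.

Lemma cgexp_minus mu k F G : ccont_pos F -> ccont_pos G ->
  cgexp mu k (fun t => F t - G t)%C = (cgexp mu k F - cgexp mu k G)%C.
Proof.
  intros H1 H2. transitivity (cgexp mu k (fun t => F t + (- (1)) * G t)%C).
  - apply cgexp_ext. intros; ring.
  - rewrite cgexp_plus, cgexp_scal; auto; [ring | now apply ccont_pos_scal].
Qed.

Lemma ccont_pos_minus F G : ccont_pos F -> ccont_pos G -> ccont_pos (fun t => F t - G t)%C.
Proof.
  intros H1 H2. apply ccont_pos_ext with (fun t => F t + (- (1)) * G t)%C; [intros; ring|].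
  apply ccont_pos_plus; auto. now apply ccont_pos_scal.
Qed.

Lemma cgexp_Csum mu k (F : nat -> R -> C) n : (forall j, (j < n)%nat -> ccont_pos (F j)) ->
  cgexp mu k (fun t => Csum (fun j => F j t) n) = Csum (fun j => cgexp mu k (F j)) n.
Proof.
  induction n as [|n IH]; intros H; simpl.
  - rewrite cgexp_RtoC, gexp_zero. reflexivity.
  - rewrite <- IH by (intros; apply H; lia).
    apply (cgexp_plus mu k (fun t => Csum (fun j => F j t) n) (F n)); [apply ccont_pos_Csum; intros; apply H; lia | apply H; lia].
Qed.

Lemma cgexp_bound mu k F g : ccont_pos F -> cont_pos g -> (forall t, 0 < t -> Cmod (F t) <= g t) ->
  Cmod (cgexp mu k F) <= 2 * gexp mu k g.
Proof.
  intros [H1 H2] G L. eapply Rle_trans; [apply Cmod_le_parts|]. simpl.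
  assert (Rabs (gexp mu k (fun t => Re (F t))) <= gexp mu k g).
  { apply gexp_abs; auto. intros t Ht. eapply Rle_trans; [apply re_le_Cmod | auto]. }
  assert (Rabs (gexp mu k (fun t => Im (F t))) <= gexp mu k g).
  { apply gexp_abs; auto. intros t Ht. eapply Rle_trans; [apply im_le_Cmod | auto]. }
  unfold Re, Im in *. simpl in *. lra.
Qed.

Lemma cgexp_primitive mu k F G : ccont_pos F ->
  (forall t, 0 < t -> Cder G t (RtoC (Rpower t (mu - 1) * exp (- t)) * F t)%C) ->
  cgexp mu k F = (G (hi k) - G (lo k))%C.
Proof.
  intros [H1 H2] D. apply C_ext; simpl.
  - rewrite (gexp_primitive mu k _ (fun t => Re (G t))); auto.
    intros t Ht. destruct (D t Ht) as [D1 _]. now rewrite Re_RtoC_mult in D1.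
  - rewrite (gexp_primitive mu k _ (fun t => Im (G t))); auto.
    intros t Ht. destruct (D t Ht) as [_ D2]. now rewrite Im_RtoC_mult in D2.
Qed.

Lemma cont_pos_uniform (f : R -> R) (g : nat -> R -> R) (tau : nat -> R) :
  (forall n, cont_pos (g n)) -> (forall n t, 0 < t -> Rabs (f t - g n t) <= tau n) ->
  is_lim_seq tau 0 -> cont_pos f.
Proof.
  intros Hg Hf Ht t Ht0.
  apply continuity_pt_filterlim. intros e He.
  destruct (proj1 (is_lim_seq_eps _ _) Ht (e / 4)) as [N HN]; [lra|]. specialize (HN N (le_n N)).
  rewrite Rminus_0_r in HN. apply Rabs_def2 in HN.
  pose proof (proj2 (continuity_pt_filterlim _ _) (Hg N t Ht0)) as Cg.
  destruct (Cg (e / 4)) as [d [Hd Hdd]]; [lra|].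
  exists (Rmin d t). split; [apply Rmin_glb_lt; auto|].
  intros x [Dx Hx]. simpl in *. unfold Rdist in *.
  assert (X1 : Rabs (x - t) < d) by (eapply Rlt_le_trans; [exact Hx | apply Rmin_l]).
  assert (X2 : Rabs (x - t) < t) by (eapply Rlt_le_trans; [exact Hx | apply Rmin_r]).
  apply Rabs_def2 in X2. specialize (Hdd x (conj Dx X1)). unfold Rdist in Hdd.
  pose proof (Hf N x ltac:(lra)) as F1. pose proof (Hf N t Ht0) as F2.
  apply Rabs_le_between in F1, F2. apply Rabs_def2 in Hdd. apply Rabs_def1; lra.
Qed.

Lemma ccont_pos_uniform (F : R -> C) (G : nat -> R -> C) (tau : nat -> R) :
  (forall n, ccont_pos (G n)) -> (forall n t, 0 < t -> Cmod (F t - G n t)%C <= tau n) ->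
  is_lim_seq tau 0 -> ccont_pos F.
Proof.
  intros HG HF Ht. split.
  - apply (cont_pos_uniform _ (fun n t => Re (G n t)) tau); auto.
    + intros n; apply HG.
    + intros n t H0. rewrite <- Re_minus. eapply Rle_trans; [apply re_le_Cmod | auto].
  - apply (cont_pos_uniform _ (fun n t => Im (G n t)) tau); auto.
    + intros n; apply HG.
    + intros n t H0. rewrite <- Im_minus. eapply Rle_trans; [apply im_le_Cmod | auto].
Qed.

Lemma igam_ray_lo_lim mu z : 0 < mu -> Clim (fun k => igam_ray mu z (lo k)) 0.
Proof.
  intros H. destruct (igam_tail mu (nonpole_pos mu H)) as [A [A0 HA]].
  apply Clim_squeeze with (fun k => A * exp (Cmod z) * Rpower (INR (S k)) (- mu)).
  - intros k. replace (igam_ray mu z (lo k) - 0)%C with (igam_ray mu z (lo k)) by ring.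
    unfold igam_ray. rewrite Cmod_mult, Cmod_R, Rabs_pos_eq by apply Rlt_le, Rpower_pos.
    rewrite Rmult_comm. unfold lo. pose proof (xn_ge1 k).
    apply Rmult_le_compat.
    + apply Cmod_ge_0.
    + apply Rlt_le, Rpower_pos.
    + destruct (HA (z * RtoC (/ INR (S k)))%C) as [_ [B _]]. eapply Rle_trans; [exact B|].
      apply Rmult_le_compat_l; [lra|]. apply exp_le. rewrite Cmod_mult, Cmod_R.
      pose proof (lo_pos k). pose proof (lo_le_1 k). unfold lo in *. rewrite Rabs_pos_eq by lra.
      pose proof (Cmod_ge_0 z). nra.
    + apply Req_le. unfold Rpower. rewrite ln_Rinv by lra. f_equal. ring.
  - apply lim0_mult_const, Rpower_neg_lim0, H.
Qed.

Lemma ccont_pos_exp z : ccont_pos (fun t => Cexp (- (RtoC t * z))).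
Proof.
  apply ccont_pos_Cder with (fun t => - (1 * z + RtoC t * 0) * Cexp (- (RtoC t * z)))%C.
  intros t _. apply Cder_Cexp, Cder_opp, (Cder_mult RtoC (fun _ => z));
    [apply Cder_RtoC, is_derive_Rid | apply Cder_const].
Qed.

Lemma cgexp_exp mu k z : 0 < mu ->
  cgexp mu k (fun t => Cexp (- (RtoC t * z))) = (igam_ray mu (1 + z) (hi k) - igam_ray mu (1 + z) (lo k))%C.
Proof.
  intros H. apply cgexp_primitive.
  - apply ccont_pos_exp.
  - intros t Ht. eapply Cder_eq; [apply igam_ray_Cder; [now apply nonpole_pos | auto]|].
    rewrite RtoC_mult, <- Cexp_RtoC, <- Cmult_assoc, <- Cexp_plus. f_equal. f_equal. rewrite RtoC_opp. ring.
Qed.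

Lemma cgexp_exp_lim mu z r th : 0 < mu -> (1 + z)%C = polar r th -> 0 < r -> Rabs th < PI / 2 ->
  Clim (fun k => cgexp mu k (fun t => Cexp (- (RtoC t * z)))) (RtoC (Gamma mu) * polar_pow r th (- mu))%C.
Proof.
  intros H E Hr Ht.
  apply Clim_ext with (fun k => igam_ray mu (1 + z) (hi k) - igam_ray mu (1 + z) (lo k))%C.
  { intros k. now rewrite cgexp_exp. }
  replace (RtoC (Gamma mu) * polar_pow r th (- mu))%C with (RtoC (Gamma mu) * polar_pow r th (- mu) - 0)%C by ring.
  apply Clim_minus; [|now apply igam_ray_lo_lim]. rewrite E.
  apply (Ctends_seq _ _ hi (igam_ray_tends mu r th (nonpole_pos mu H) Hr Ht)).
  intros n. unfold hi. rewrite S_INR. lra.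
Qed.

Lemma polar_pow_real r a : polar_pow r 0 a = RtoC (Rpower r a).
Proof. unfold polar_pow. now rewrite Rmult_0_r, polar_0. Qed.

Lemma Rabs_0_lt_PI2 : Rabs 0 < PI / 2.
Proof. rewrite Rabs_R0. pose proof PI_RGT_0. lra. Qed.

Lemma gexp_exp mu k x : 0 < mu ->
  gexp mu k (fun t => exp (- (t * x))) = igam_rray mu (1 + x) (hi k) - igam_rray mu (1 + x) (lo k).
Proof.
  intros H. pose proof (cgexp_exp mu k (RtoC x) H) as E.
  rewrite <- RtoC_plus, !igam_ray_real, <- RtoC_minus in E by now apply nonpole_pos.
  rewrite (cgexp_ext mu k _ (fun t => RtoC (exp (- (t * x))))), cgexp_RtoC in E.
  - now apply RtoC_inj in E.
  - intros t _. now rewrite <- RtoC_mult, <- RtoC_opp, Cexp_RtoC.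
Qed.

Lemma gexp_exp_lim mu x : 0 < mu -> 0 <= x ->
  is_lim_seq (fun k => gexp mu k (fun t => exp (- (t * x)))) (Gamma mu * Rpower (1 + x) (- mu)).
Proof.
  intros H Hx.
  pose proof (cgexp_exp_lim mu (RtoC x) (1 + x) 0 H ltac:(rewrite polar_0, RtoC_plus; auto) ltac:(lra) Rabs_0_lt_PI2) as L.
  rewrite polar_pow_real, <- RtoC_mult in L. apply Clim_Re in L. simpl (Re (RtoC _)) in L.
  eapply is_lim_seq_ext; [|exact L]. intros k.
  apply (gexp_ext mu k (fun t => Re (Cexp (- (RtoC t * RtoC x))))). intros t _.
  rewrite <- RtoC_mult, <- RtoC_opp, Cexp_RtoC. reflexivity.
Qed.

Lemma gexp_shift mu k f j :
  gexp mu k (fun t => t ^ j * f t) = gexp (mu + INR j) k f.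
Proof.
  unfold gexp. apply RInt_Rext. intros t Ht. pose proof (lo_pos k). pose proof (lo_le_hi k).
  rewrite Rmin_left in Ht by lra.
  replace (mu + INR j - 1) with (mu - 1 + INR j) by ring. rewrite Rpower_plus, Rpower_pow by lra. ring.
Qed.

Lemma gexp_one_lim mu : 0 < mu -> is_lim_seq (fun k => gexp mu k (fun _ => 1)) (Gamma mu).
Proof.
  intros H. pose proof (gexp_exp_lim mu 0 H (Rle_refl 0)) as L.
  rewrite Rplus_0_r, Rpower_1_base, Rmult_1_r in L.
  eapply is_lim_seq_ext; [|exact L]. intros k. apply gexp_ext. intros t _.
  rewrite Rmult_0_r, Ropp_0. apply exp_0.
Qed.

Lemma gexp_one_le mu k : 0 < mu -> gexp mu k (fun _ => 1) <= Gamma mu.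
Proof.
  intros H. apply (is_lim_seq_incr_compare _ _ (gexp_one_lim mu H)).
  intros n. apply gexp_mono_k; [lia | apply cont_pos_const | intros; lra].
Qed.

Lemma gexp_pow_lim mu j : 0 < mu -> is_lim_seq (fun k => gexp mu k (fun t => t ^ j)) (Gamma (mu + INR j)).
Proof.
  intros H. eapply is_lim_seq_ext; [|apply (gexp_one_lim (mu + INR j)); pose proof (pos_INR j); lra].
  intros k. cbv beta. rewrite <- (gexp_shift mu k (fun _ => 1) j). apply gexp_ext. intros; ring.
Qed.

Lemma Gamma_poch mu j : 0 < mu -> Gamma (mu + INR j) = Gamma mu * poch mu j.
Proof.
  intros H. induction j as [|j IH]; [simpl; rewrite Rplus_0_r; ring|].
  rewrite S_INR, <- Rplus_assoc, Gamma_succ.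
  - rewrite IH. simpl. ring.
  - apply nonpole_pos. pose proof (pos_INR j). lra.
Qed.

Lemma gexp_Rsum mu k (f : nat -> R -> R) n : (forall j, (j < n)%nat -> cont_pos (f j)) ->
  gexp mu k (fun t => Rsum (fun j => f j t) n) = Rsum (fun j => gexp mu k (f j)) n.
Proof.
  intros H. assert (Hc : cont_pos (fun t => Rsum (fun j => f j t) n) /\
    gexp mu k (fun t => Rsum (fun j => f j t) n) = Rsum (fun j => gexp mu k (f j)) n); [|apply Hc].
  induction n as [|n IH]; simpl.
  - split; [apply cont_pos_const | apply gexp_zero].
  - destruct IH as [I1 I2]; [intros; apply H; lia|]. split.
    + apply cont_pos_plus; auto.
    + rewrite <- I2. apply (gexp_plus mu k (fun t => Rsum (fun j => f j t) n)); auto.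
Qed.

Lemma pow_binomial x y n : (x + y) ^ n =
  Rsum (fun i => INR (fact n) / (INR (fact i) * INR (fact (n - i))) * x ^ i * y ^ (n - i)) (S n).
Proof.
  rewrite binomial, sum_f_R0_Rsum. reflexivity.
Qed.

Definition gmoment (mu lam : R) (n : nat) : R :=
  Rsum (fun i => INR (fact n) / (INR (fact i) * INR (fact (n - i))) * lam ^ i * poch mu (n - i)) (S n).

Lemma Rsum_lim (f : nat -> nat -> R) (l : nat -> R) n :
  (forall j, (j < n)%nat -> is_lim_seq (f j) (l j)) ->
  is_lim_seq (fun k => Rsum (fun j => f j k) n) (Rsum l n).
Proof.
  induction n as [|n IH]; intros H; simpl; [apply is_lim_seq_const|].
  apply lim_seq_plus; [apply IH; intros; apply H; lia | apply H; lia].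
Qed.

Lemma gexp_binom_lim mu lam n : 0 < mu ->
  is_lim_seq (fun k => gexp mu k (fun t => (lam + t) ^ n)) (Gamma mu * gmoment mu lam n).
Proof.
  intros H. unfold gmoment. rewrite <- Rsum_scal.
  eapply is_lim_seq_ext.
  2:{ apply (Rsum_lim (fun i k => gexp mu k (fun t => INR (fact n) / (INR (fact i) * INR (fact (n - i))) * lam ^ i * t ^ (n - i)))).
      intros i _.
      pose (c := INR (fact n) / (INR (fact i) * INR (fact (n - i))) * lam ^ i).
      fold c. replace (Gamma mu * (c * poch mu (n - i))) with (c * Gamma (mu + INR (n - i))).
      - apply is_lim_seq_ext with (fun k => c * gexp mu k (fun t => t ^ (n - i))).
        + intros k. now rewrite gexp_scal by apply cont_pos_pow, cont_pos_id.
        + apply (is_lim_seq_scal_l _ c _ (gexp_pow_lim mu (n - i) H)).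
      - rewrite Gamma_poch by auto. ring. }
  intros k. cbv beta. rewrite <- gexp_Rsum.
  - apply gexp_ext. intros t _. now rewrite <- pow_binomial.
  - intros j _. apply cont_pos_scal, cont_pos_pow, cont_pos_id.
Qed.

Lemma poch_split mu n i : poch mu (n + i) = poch mu n * poch (mu + INR n) i.
Proof.
  induction i as [|i IH]; [rewrite Nat.add_0_r; simpl; ring|].
  rewrite Nat.add_succ_r. simpl. rewrite IH, plus_INR. ring.
Qed.

Lemma poch_reflect mu n i : (i <= n)%nat ->
  poch (1 - mu - INR n) i = (-1) ^ i * poch (mu + INR (n - i)) i.
Proof.
  assert (G : forall i x, poch (1 - x - INR i) i = (-1) ^ i * poch x i).
  { clear. induction i as [|i IH]; intros x; [simpl; ring|].
    replace (poch (1 - x - INR (S i)) (S i)) with ((- x - INR i) * poch (1 - x - INR i) i).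
    - rewrite IH. simpl. ring.
    - rewrite <- Nat.add_1_l, poch_split. rewrite plus_INR. simpl (INR 1). simpl (poch _ 1).
      replace (1 - x - (1 + INR i) + 1) with (1 - x - INR i) by ring. ring. }
  intros H. rewrite <- G. f_equal. rewrite minus_INR by auto. ring.
Qed.

Lemma poch_pos mu n : 0 < mu -> 0 < poch mu n.
Proof.
  intros H. induction n as [|n IH]; simpl; [lra|]. apply Rmult_lt_0_compat; auto. pose proof (pos_INR n). lra.
Qed.

Lemma poch_neg_nat n i : (i <= n)%nat -> poch (- INR n) i * INR (fact (n - i)) = (-1) ^ i * INR (fact n).
Proof.
  induction i as [|i IH]; intros H; [simpl; rewrite Nat.sub_0_r; ring|].
  simpl.
  replace (-1 * (-1) ^ i * INR (fact n)) with (- ((-1) ^ i * INR (fact n))) by ring.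
  rewrite <- IH by lia. replace (n - i)%nat with (S (n - S i)) by lia.
  rewrite fact_simpl, mult_INR. replace (S (n - S i)) with (n - i)%nat by lia. rewrite minus_INR by lia. ring.
Qed.

Lemma gmoment_hyp mu lam n : 0 < mu ->
  gmoment mu lam n = poch mu n * hyp1F1_neg n (1 - mu - INR n) lam.
Proof.
  intros H. unfold hyp1F1_neg, gmoment.
  rewrite sum_f_R0_Rsum, <- Rsum_scal. apply Rsum_ext. intros i Hi. assert (Hi' : (i <= n)%nat) by lia.
  rewrite poch_reflect by auto. pose proof (poch_neg_nat n i Hi') as Q.
  replace (poch mu n) with (poch mu (n - i) * poch (mu + INR (n - i)) i)
    by (rewrite <- poch_split; f_equal; lia).
  assert (P1 : 0 < poch (mu + INR (n - i)) i) by (apply poch_pos; pose proof (pos_INR (n - i)); lra).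
  assert (P2 : (-1) ^ i <> 0) by (apply pow_nonzero; lra).
  pose proof (INR_fact_neq_0 i). pose proof (INR_fact_neq_0 (n - i)).
  apply (Rmult_eq_reg_r (INR (fact (n - i)) * ((-1) ^ i))).
  2:{ apply Rmult_integral_contrapositive; auto. }
  transitivity (((-1) ^ i * INR (fact n)) * (lam ^ i * poch mu (n - i) / INR (fact i))).
  - field. auto.
  - rewrite <- Q. field. repeat split; auto. lra.
Qed.

(** * Kummer's transformation *)

Lemma igam_rray_tends al c : 0 < al -> 0 < c -> forall e, 0 < e -> exists X, forall x, X <= x ->
  Rabs (igam_rray al c x - Gamma al * Rpower c (- al)) < e.
Proof.
  intros H Hc e He.
  destruct (igam_ray_tends al c 0 (nonpole_pos al H) Hc Rabs_0_lt_PI2 e He) as [X HX].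
  exists X. intros x Hx. specialize (HX x Hx).
  rewrite polar_0, polar_pow_real, igam_ray_real, <- RtoC_mult, <- RtoC_minus, Cmod_R in HX by now apply nonpole_pos.
  exact HX.
Qed.

Lemma igam_rray_increment al lam t x y : 0 < al -> 0 <= t -> 0 < x <= y ->
  0 <= igam_rray al (lam + t) y - igam_rray al (lam + t) x <= igam_rray al lam y - igam_rray al lam x.
Proof.
  intros H Ht Hx. pose proof (nonpole_pos al H) as Hn. split.
  - pose proof (igam_rray_mono al (lam + t) x y H Hx). lra.
  - eapply Rle_trans; [apply Rle_abs|].
    apply (mvt_majorant (igam_rray al (lam + t)) (fun s => Rpower s (al - 1) * exp (- ((lam + t) * s)))
      (igam_rray al lam) (fun s => Rpower s (al - 1) * exp (- (lam * s)))); try lra.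
    + intros; apply igam_rray_derive; auto; lra.
    + intros; apply igam_rray_derive; auto; lra.
    + intros s Hs. rewrite Rabs_pos_eq by apply Rlt_le, Rpower_exp_pos.
      apply Rmult_le_compat_l; [apply Rlt_le, Rpower_pos|]. apply exp_le. nra.
Qed.

Lemma igam_rray_tail al lam t x : 0 < al -> 0 < lam -> 0 <= t -> 0 < x ->
  0 <= Gamma al * Rpower (lam + t) (- al) - igam_rray al (lam + t) x
    <= Gamma al * Rpower lam (- al) - igam_rray al lam x.
Proof.
  intros H Hl Ht Hx. split.
  - apply Rle_plus_epsilon. intros e He.
    destruct (igam_rray_tends al (lam + t) H ltac:(lra) e He) as [X HX].
    specialize (HX (Rmax X x) (Rmax_l _ _)). apply Rabs_def2 in HX.
    pose proof (igam_rray_mono al (lam + t) x (Rmax X x) H (conj Hx (Rmax_r _ _))). lra.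
  - apply Rle_plus_epsilon. intros e He.
    destruct (igam_rray_tends al (lam + t) H ltac:(lra) (e / 2)) as [X HX]; [lra|].
    destruct (igam_rray_tends al lam H Hl (e / 2)) as [Y HY]; [lra|].
    pose (z := Rmax (Rmax X Y) x).
    assert (z1 : X <= z) by (eapply Rle_trans; [apply Rmax_l | apply Rmax_l]).
    assert (z2 : Y <= z) by (eapply Rle_trans; [apply Rmax_r | apply Rmax_l]).
    assert (z3 : x <= z) by apply Rmax_r.
    specialize (HX z z1). specialize (HY z z2). apply Rabs_def2 in HX, HY.
    pose proof (igam_rray_increment al lam t x z H Ht (conj Hx z3)). lra.
Qed.

Lemma igam_rray_head al lam t x : 0 < al -> 0 < lam -> 0 <= t -> 0 < x ->
  0 <= igam_rray al (lam + t) x <= igam_rray al lam x.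
Proof.
  intros H Hl Ht Hx. split.
  - destruct (igam_rray_limit al (lam + t) H ltac:(lra)) as [L [_ [B _]]]. now apply B.
  - apply Rle_plus_epsilon. intros e He.
    destruct (igam_rray_small al (lam + t) H ltac:(lra)) as [M [M0 HM]].
    destruct (Rpower_small al (e / M) H) as [d [Hd1 Hd2]]; [apply Rdiv_lt_0_compat; lra|].
    pose (y := Rmin x (d / 2)). assert (Hy : 0 < y) by (apply Rmin_glb_lt; lra).
    assert (Hy1 : y <= x) by apply Rmin_l. assert (Hy2 : y <= d / 2) by apply Rmin_r.
    specialize (HM y ltac:(lra)). specialize (Hd2 y ltac:(lra)). apply Rabs_le_between in HM.
    assert (M * Rpower y al < M * (e / M)) by (apply Rmult_lt_compat_l; lra).
    replace (M * (e / M)) with e in H0 by (field; lra).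
    pose proof (igam_rray_increment al lam t y x H Ht (conj Hy Hy1)) as I.
    destruct (igam_rray_limit al lam H Hl) as [L [_ [B _]]]. specialize (B y Hy). lra.
Qed.

Lemma igam_rray_param_cont al (c : R -> R) (c' : R -> R) x : nonpole al ->
  (forall t, 0 < t -> is_derive c t (c' t)) -> cont_pos (fun t => igam_rray al (c t) x).
Proof.
  intros H D.
  apply (proj1 (ccont_pos_Cder (fun t => igam_ray al (RtoC (c t)) x)
    (fun t => RtoC (Rpower x al) * ((RtoC (c' t) * RtoC x + RtoC (c t) * 0) * - igam (al + 1) (RtoC (c t) * RtoC x)))%C
    (fun t Ht => Cder_scal (RtoC (Rpower x al)) _ _ _
      (igam_Cder al (fun t => RtoC (c t) * RtoC x)%C t _ H
         (Cder_mult _ _ _ _ _ (Cder_RtoC _ _ _ (D t Ht)) (Cder_const (RtoC x) t)))))).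
Qed.

Lemma cont_pos_kernel al lam x : nonpole al -> cont_pos (fun t => igam_rray al (lam + t) x).
Proof.
  intros H. apply (igam_rray_param_cont al (fun t => lam + t) (fun _ => 1)); auto.
  intros t _. eapply is_derive_eq; [apply is_derive_Rplus; [apply is_derive_Rconst | apply is_derive_Rid] | ring].
Qed.

Lemma cont_pos_exp_lin x : cont_pos (fun t => exp (- (t * x))).
Proof.
  apply cont_pos_derive with (fun t => - (1 * x + t * 0) * exp (- (t * x))). intros t _.
  apply (is_derive_Rcomp exp (fun t => - (t * x))); [apply is_derive_exp|].
  apply (is_derive_opp (V := R_NormedModule)).
  apply (is_derive_Rmult (fun t => t) (fun _ => x)); [apply is_derive_Rid | apply is_derive_Rconst].
Qed.

Lemma continuity_pt_of_derive f x l : is_derive f x l -> continuity_pt f x.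
Proof. intros H. apply derivable_continuous_pt. exists l. now apply is_derive_Reals. Qed.

Lemma gexp_kernel_derive mu k al lam x : 0 < al -> 0 < x ->
  is_derive (fun x => gexp mu k (fun t => igam_rray al (lam + t) x)) x
    (Rpower x (al - 1) * exp (- (lam * x)) * gexp mu k (fun t => exp (- (t * x)))).
Proof.
  intros H Hx. pose proof (nonpole_pos al H) as Hn.
  pose (f := fun u t => Rpower t (mu - 1) * exp (- t) * igam_rray al (lam + t) u).
  pose proof (lo_pos k) as Hlo. pose proof (lo_le_hi k) as Hlh.
  assert (D : forall u t, 0 < u -> is_derive (fun u => f u t) u
     (Rpower t (mu - 1) * exp (- t) * (Rpower u (al - 1) * exp (- ((lam + t) * u))))).
  { intros u t Hu. unfold f. apply is_derive_Rscal, igam_rray_derive; auto. }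
  eapply is_derive_eq.
  - apply (is_derive_RInt_param f (lo k) (hi k) x).
    + apply locally_of_pos; auto. intros u Hu t _. eexists. now apply D.
    + intros t Ht. rewrite Rmin_left, Rmax_right in Ht by lra.
      apply continuity_2d_pt_ext_loc with
        (fun u v => Rpower v (mu - 1) * exp (- v) * (Rpower u (al - 1) * exp (- ((lam + v) * u)))).
      * exists (mkposreal x Hx). intros u v Hu _. simpl in Hu. apply Rabs_def2 in Hu.
        symmetry. apply is_derive_unique, D. lra.
      * apply continuity_2d_pt_mult; [|apply continuity_2d_pt_mult].
        -- apply (continuity_1d_2d_pt_comp (fun v => Rpower v (mu - 1) * exp (- v)) (fun _ v => v)).
           ++ apply continuity_pt_filterlim, cont_pos_weight. lra.
           ++ apply continuity_2d_pt_id2.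
        -- apply (continuity_1d_2d_pt_comp (fun v => Rpower v (al - 1)) (fun u _ => u)).
           ++ apply (continuity_pt_of_derive _ _ _ (is_derive_Rpower _ _ Hx)).
           ++ apply continuity_2d_pt_id1.
        -- apply (continuity_1d_2d_pt_comp exp (fun u v => - ((lam + v) * u))).
           ++ apply (continuity_pt_of_derive _ _ _ (is_derive_exp _)).
           ++ apply continuity_2d_pt_opp, continuity_2d_pt_mult; [|apply continuity_2d_pt_id1].
              apply continuity_2d_pt_plus; [apply continuity_2d_pt_const | apply continuity_2d_pt_id2].
    + apply locally_of_pos; auto. intros u Hu. apply (ex_RInt_gexp mu k (fun t => igam_rray al (lam + t) u)), cont_pos_kernel; auto.
  - rewrite <- gexp_scal by apply cont_pos_exp_lin. unfold gexp. apply RInt_Rext. intros t Ht.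
    rewrite Rmin_left, Rmax_right in Ht by lra.
    transitivity (Rpower t (mu - 1) * exp (- t) * (Rpower x (al - 1) * exp (- ((lam + t) * x)))).
    + apply is_derive_unique, D; auto.
    + replace (- ((lam + t) * x)) with (- (lam * x) + - (t * x)) by ring. rewrite exp_plus. ring.
Qed.

Lemma cont_pos_gexp_exp mu k : 0 < mu -> cont_pos (fun x => gexp mu k (fun t => exp (- (t * x)))).
Proof.
  intros H. pose proof (nonpole_pos mu H) as Hn.
  apply (cont_pos_ext (fun x => igam_rray mu (1 + x) (hi k) + -1 * igam_rray mu (1 + x) (lo k))).
  - intros x. rewrite gexp_exp by auto. ring.
  - apply cont_pos_plus; [|apply cont_pos_scal]; apply cont_pos_kernel; auto.
Qed.

Lemma cont_pos_Rpower_shift lam a : 0 <= lam -> cont_pos (fun t => Rpower (lam + t) a).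
Proof.
  intros Hl. apply cont_pos_derive with (fun t => (0 + 1) * (a * Rpower (lam + t) (a - 1))). intros t Ht.
  apply (is_derive_Rcomp (fun s => Rpower s a) (fun t => lam + t)).
  - apply is_derive_Rpower. lra.
  - apply is_derive_Rplus; [apply is_derive_Rconst | apply is_derive_Rid].
Qed.

Lemma gexp_exp_deficit mu k x : 0 < mu -> 0 <= x ->
  0 <= Gamma mu * Rpower (1 + x) (- mu) - gexp mu k (fun t => exp (- (t * x)))
    <= Gamma mu - gexp mu k (fun _ => 1).
Proof.
  intros H Hx.
  pose proof (gexp_exp_lim mu x H Hx) as L1. pose proof (gexp_one_lim mu H) as L2.
  split.
  - assert (gexp mu k (fun t => exp (- (t * x))) <= Gamma mu * Rpower (1 + x) (- mu)); [|lra].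
    apply (is_lim_seq_incr_compare _ _ L1).
    intros n. apply gexp_mono_k; [lia | apply cont_pos_exp_lin | intros; apply Rlt_le, exp_pos].
  - assert (gexp mu k (fun _ => 1) - gexp mu k (fun t => exp (- (t * x))) <= Gamma mu - Gamma mu * Rpower (1 + x) (- mu)); [|lra].
    pose proof (is_lim_seq_minus' _ _ _ _ L2 L1) as L3.
    apply (is_lim_seq_incr_compare _ _ L3).
    assert (E : forall n, gexp mu n (fun _ => 1) - gexp mu n (fun t => exp (- (t * x))) =
       gexp mu n (fun t => 1 + -1 * exp (- (t * x)))).
    { intros n. rewrite gexp_plus, gexp_scal; try apply cont_pos_const; try apply cont_pos_exp_lin; [ring|].
      apply cont_pos_scal, cont_pos_exp_lin. }
    intros n. rewrite !E. apply gexp_mono_k; [lia | |].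
    + apply cont_pos_plus; [apply cont_pos_const | apply cont_pos_scal, cont_pos_exp_lin].
    + intros t Ht. assert (exp (- (t * x)) <= 1); [|lra].
      apply exp_le_1; nra.
Qed.

(* Kummer's transformation: both sides of the identity are limits of the double integral of
   s^(al-1) e^(-lam s) t^(mu-1) e^(-t) e^(-t s), truncated in t. *)
Lemma gexp_power_lim_pos mu al lam : 0 < mu -> 0 < al -> 0 < lam ->
  is_lim_seq (fun k => gexp mu k (fun t => Rpower (lam + t) (- al)))
    (Gamma mu * tricomiU_integral al (1 + al - mu) lam).
Proof.
  intros Hmu Hal Hl.
  pose proof (Gamma_pos mu Hmu) as Gm. pose proof (Gamma_pos al Hal) as Ga.
  pose proof (nonpole_pos al Hal) as Hn.
  pose (Ek := fun k => gexp mu k (fun t => Rpower (lam + t) (- al))).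
  assert (Ck : cont_pos (fun t => Rpower (lam + t) (- al))) by (apply cont_pos_Rpower_shift; lra).
  destruct (ex_finite_lim_seq_incr Ek (Gamma mu * Rpower lam (- al))) as [l Hlim].
  { intros n. apply gexp_mono_k; auto. intros; apply Rlt_le, Rpower_pos. }
  { intros n. unfold Ek. apply Rle_trans with (Rpower lam (- al) * gexp mu n (fun _ => 1)).
    - rewrite <- gexp_scal by apply cont_pos_const. apply gexp_le; auto.
      + apply cont_pos_scal, cont_pos_const.
      + intros t Ht. rewrite Rmult_1_r. apply Rpower_neg_anti; lra.
    - rewrite Rmult_comm. apply Rmult_le_compat_r; [apply Rlt_le, Rpower_pos|].
      now apply gexp_one_le. }
  pose (u := fun s => Rpower s (al - 1) * exp (- (lam * s)) * (Gamma mu * Rpower (1 + s) (- mu))).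
  assert (Cu : cont_pos u).
  { apply cont_pos_mult.
    - intros s Hs. now apply continuous_Rpower_exp.
    - apply cont_pos_scal, cont_pos_Rpower_shift. lra. }
  assert (I : is_RInt_gen u (at_right 0) (Rbar_locally p_infty) (Gamma al * l)).
  { apply RInt_gen_eps. intros e He.
    pose (W := Gamma al * Rpower lam (- al)).
    assert (W0 : 0 < W) by (apply Rmult_lt_0_compat; auto; apply Rpower_pos).
    destruct (proj1 (is_lim_seq_eps _ _) (gexp_one_lim mu Hmu) (e / 4 / W)) as [N1 HN1].
    { repeat apply Rdiv_lt_0_compat; lra. }
    destruct (proj1 (is_lim_seq_eps _ _) Hlim (e / 4 / Gamma al)) as [N2 HN2].
    { repeat apply Rdiv_lt_0_compat; lra. }
    pose (k := max N1 N2). specialize (HN1 k ltac:(unfold k; lia)). specialize (HN2 k ltac:(unfold k; lia)).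
    apply Rabs_def2 in HN1, HN2.
    pose (J := fun x => gexp mu k (fun t => igam_rray al (lam + t) x)).
    pose proof (gexp_one_le mu k Hmu) as e1.
    assert (e0 : 0 <= gexp mu k (fun _ => 1)).
    { rewrite <- (gexp_zero mu k). apply gexp_le; try apply cont_pos_const. intros; lra. }
    destruct (igam_rray_tends al lam Hal Hl (e / 4 / Gamma mu)) as [X HX]; [repeat apply Rdiv_lt_0_compat; lra|].
    destruct (igam_rray_small al lam Hal Hl) as [M [M0 HM]].
    destruct (Rpower_small al (e / 4 / Gamma mu / M) Hal) as [d [Hd1 Hd2]]; [repeat apply Rdiv_lt_0_compat; lra|].
    exists d, (Rmax X 1). split; [lra|]. intros a b Ha Hb.
    assert (b1 : X < b) by (eapply Rle_lt_trans; [apply Rmax_l | exact Hb]).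
    assert (b2 : 1 < b) by (eapply Rle_lt_trans; [apply Rmax_r | exact Hb]).
    exists (RInt u a b). split.
    { apply (RInt_correct (V := R_CompleteNormedModule)), ex_RInt_cont_pos; auto; lra. }
    pose (v := fun s => Rpower s (al - 1) * exp (- (lam * s)) * gexp mu k (fun t => exp (- (t * s)))).
    assert (Iv : is_RInt v a b (J b - J a)).
    { apply (is_RInt_derive (V := R_CompleteNormedModule) J).
      - intros x Hx. rewrite Rmin_left, Rmax_right in Hx by lra.
        assert (Hx0 : 0 < x) by lra. exact (gexp_kernel_derive mu k al lam x Hal Hx0).
      - intros x Hx. rewrite Rmin_left, Rmax_right in Hx by lra.
        apply (cont_pos_mult (fun s => Rpower s (al - 1) * exp (- (lam * s)))); [|now apply cont_pos_gexp_exp|lra].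
        intros s Hs. now apply continuous_Rpower_exp. }
    assert (Iw : is_RInt (fun s => e / 4 / W * (Rpower s (al - 1) * exp (- (lam * s)))) a b
       (e / 4 / W * (igam_rray al lam b - igam_rray al lam a))).
    { apply (is_RInt_scal (V := R_NormedModule) (fun s => Rpower s (al - 1) * exp (- (lam * s)))).
      apply (is_RInt_derive (V := R_CompleteNormedModule) (igam_rray al lam)).
      - intros x Hx. rewrite Rmin_left, Rmax_right in Hx by lra. apply igam_rray_derive; auto; lra.
      - intros x Hx. rewrite Rmin_left, Rmax_right in Hx by lra. apply continuous_Rpower_exp; lra. }
    assert (B1 : Rabs (RInt u a b - (J b - J a)) <= e / 4 / W * (igam_rray al lam b - igam_rray al lam a)).
    { apply (norm_RInt_le (V := R_NormedModule) (fun s => minus (u s) (v s)) (fun s => e / 4 / W * (Rpower s (al - 1) * exp (- (lam * s)))) a b); [lra| | |exact Iw].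
      - intros s Hs. change (Rabs (u s - v s) <= e / 4 / W * (Rpower s (al - 1) * exp (- (lam * s)))).
        unfold u, v. rewrite <- Rmult_minus_distr_l, Rabs_mult, Rmult_comm.
        rewrite (Rabs_pos_eq (Rpower s (al - 1) * _)) by apply Rlt_le, Rpower_exp_pos.
        apply Rmult_le_compat_r; [apply Rlt_le, Rpower_exp_pos|].
        pose proof (gexp_exp_deficit mu k s Hmu ltac:(lra)) as Q. rewrite Rabs_pos_eq by lra. lra.
      - apply (is_RInt_minus (V := R_NormedModule)); auto.
        apply (RInt_correct (V := R_CompleteNormedModule)), ex_RInt_cont_pos; auto; lra. }
    assert (B2 : igam_rray al lam b - igam_rray al lam a <= W).
    { pose proof (igam_rray_tail al lam 0 b Hal Hl (Rle_refl 0) ltac:(lra)) as Q1. rewrite Rplus_0_r in Q1.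
      pose proof (igam_rray_head al lam 0 a Hal Hl (Rle_refl 0) ltac:(lra)) as Q2. rewrite Rplus_0_r in Q2.
      unfold W. lra. }
    assert (B1' : e / 4 / W * (igam_rray al lam b - igam_rray al lam a) <= e / 4).
    { apply Rle_trans with (e / 4 / W * W).
      - apply Rmult_le_compat_l; auto. apply Rlt_le. repeat apply Rdiv_lt_0_compat; lra.
      - apply Req_le. field. lra. }
    assert (B3 : 0 <= J a <= Gamma mu * igam_rray al lam a).
    { unfold J. split.
      - rewrite <- (gexp_zero mu k). apply gexp_le; [apply cont_pos_const | now apply cont_pos_kernel |].
        intros t Ht. apply igam_rray_head; auto; lra.
      - apply Rle_trans with (igam_rray al lam a * gexp mu k (fun _ => 1)).
        + rewrite <- gexp_scal by apply cont_pos_const. apply gexp_le; [now apply cont_pos_kernel | apply cont_pos_scal, cont_pos_const |].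
          intros t Ht. rewrite Rmult_1_r. apply igam_rray_head; auto; lra.
        + rewrite Rmult_comm. apply Rmult_le_compat_r; auto.
          pose proof (igam_rray_head al lam 0 a Hal Hl (Rle_refl 0) ltac:(lra)) as Q2. rewrite Rplus_0_r in Q2. lra. }
    assert (B3' : Gamma mu * igam_rray al lam a < e / 4).
    { specialize (HM a ltac:(lra)). specialize (Hd2 a ltac:(lra)). apply Rabs_le_between in HM.
      apply Rle_lt_trans with (Gamma mu * (M * Rpower a al)); [apply Rmult_le_compat_l; lra|].
      apply Rlt_le_trans with (Gamma mu * (M * (e / 4 / Gamma mu / M))).
      - apply Rmult_lt_compat_l; auto. apply Rmult_lt_compat_l; auto.
      - apply Req_le. field. lra. }
    assert (B4 : 0 <= Gamma al * Ek k - J b <= Gamma mu * (W - igam_rray al lam b)).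
    { unfold Ek, J. rewrite <- gexp_scal by auto.
      assert (E : gexp mu k (fun t => Gamma al * Rpower (lam + t) (- al)) - gexp mu k (fun t => igam_rray al (lam + t) b)
        = gexp mu k (fun t => Gamma al * Rpower (lam + t) (- al) + -1 * igam_rray al (lam + t) b)).
      { rewrite gexp_plus, (gexp_scal mu k (-1)); try apply cont_pos_scal; auto; try now apply cont_pos_kernel. ring. }
      assert (Ce : cont_pos (fun t => Gamma al * Rpower (lam + t) (- al) + -1 * igam_rray al (lam + t) b)).
      { apply cont_pos_plus; apply cont_pos_scal; auto. now apply cont_pos_kernel. }
      rewrite E. split.
      - rewrite <- (gexp_zero mu k) at 1. apply gexp_le; [apply cont_pos_const | auto |].
        intros t Ht. pose proof (igam_rray_tail al lam t b Hal Hl ltac:(lra) ltac:(lra)). lra.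
      - apply Rle_trans with ((W - igam_rray al lam b) * gexp mu k (fun _ => 1)).
        + rewrite <- gexp_scal by apply cont_pos_const. apply gexp_le; [auto | apply cont_pos_scal, cont_pos_const |].
          intros t Ht. pose proof (igam_rray_tail al lam t b Hal Hl ltac:(lra) ltac:(lra)). unfold W. lra.
        + rewrite Rmult_comm. apply Rmult_le_compat_r; auto.
          pose proof (igam_rray_tail al lam 0 b Hal Hl (Rle_refl 0) ltac:(lra)) as Q1. rewrite Rplus_0_r in Q1. unfold W. lra. }
    assert (B4' : Gamma mu * (W - igam_rray al lam b) <= e / 4).
    { specialize (HX b ltac:(lra)). fold W in HX. apply Rabs_def2 in HX.
      apply Rle_trans with (Gamma mu * (e / 4 / Gamma mu)); [apply Rmult_le_compat_l; lra|].
      apply Req_le. field. lra. }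
    assert (B5 : Rabs (Gamma al * Ek k - Gamma al * l) < e / 4).
    { rewrite <- Rmult_minus_distr_l, Rabs_mult, Rabs_pos_eq by lra.
      apply Rlt_le_trans with (Gamma al * (e / 4 / Gamma al)).
      - apply Rmult_lt_compat_l; auto. unfold Ek. apply Rabs_def1; unfold Ek in *; lra.
      - apply Req_le. field. lra. }
    apply Rabs_le_between in B1. apply Rabs_def2 in B5. apply Rabs_def1; lra. }
  replace (Gamma mu * tricomiU_integral al (1 + al - mu) lam) with l; [exact Hlim|].
  unfold tricomiU_integral.
  assert (E : RInt_gen (fun t => exp (- lam * t) * Rpower t (al - 1) * Rpower (1 + t) (1 + al - mu - al - 1))
     (at_right 0) (Rbar_locally p_infty) = / Gamma mu * (Gamma al * l)).
  { apply (is_RInt_gen_unique (V := R_CompleteNormedModule)).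
    apply (is_RInt_gen_ext (V := R_NormedModule) (fun s => scal (/ Gamma mu) (u s))).
    - apply filter_forall. intros ab x _. unfold scal, u; simpl; unfold mult; simpl.
      replace (1 + al - mu - al - 1) with (- mu) by ring. replace (- lam * x) with (- (lam * x)) by ring. 
      match goal with |- ?a = ?b => change (a = b :> R) end. field. lra.
    - apply (is_RInt_gen_scal (V := R_NormedModule) u (/ Gamma mu)). exact I. }
  rewrite E. field. lra.
Qed.

Lemma gexp_power_lim_shift n : forall mu al lam, 0 < mu -> 0 < lam -> 0 < al + INR n ->
  is_lim_seq (fun k => gexp mu k (fun t => Rpower (lam + t) (- al)))
    (Gamma mu * tricomiU_shift n al (1 + al - mu) lam).
Proof.
  induction n as [|n IH]; intros mu al lam Hmu Hl Hal.
  - simpl in *. apply gexp_power_lim_pos; auto; lra.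
  - rewrite S_INR in Hal. cbn [tricomiU_shift].
    pose proof (IH mu (al + 1) lam Hmu Hl ltac:(lra)) as L1.
    pose proof (IH (mu + 1) (al + 1) lam ltac:(lra) Hl ltac:(lra)) as L2.
    replace (1 + al - mu + 1) with (1 + (al + 1) - mu) by ring.
    replace (tricomiU_shift n (al + 1) (1 + al - mu) lam) with (tricomiU_shift n (al + 1) (1 + (al + 1) - (mu + 1)) lam)
      by (f_equal; ring).
    replace (Gamma mu * (lam * tricomiU_shift n (al + 1) (1 + (al + 1) - mu) lam -
       (1 + al - mu - al - 1) * tricomiU_shift n (al + 1) (1 + (al + 1) - (mu + 1)) lam)) with
      (lam * (Gamma mu * tricomiU_shift n (al + 1) (1 + (al + 1) - mu) lam) +
       Gamma (mu + 1) * tricomiU_shift n (al + 1) (1 + (al + 1) - (mu + 1)) lam).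
    2:{ rewrite Gamma_succ by now apply nonpole_pos. ring. }
    assert (Cp : cont_pos (fun t => Rpower (lam + t) (- (al + 1)))) by (apply cont_pos_Rpower_shift; lra).
    eapply is_lim_seq_ext; [|apply lim_seq_plus; [apply (is_lim_seq_scal_l _ lam _ L1) | exact L2]].
    intros k. cbv beta. 
    rewrite <- (gexp_scal mu k lam) by auto.
    replace (mu + 1) with (mu + INR 1) by (simpl; ring).
    rewrite <- (gexp_shift mu k _ 1).
    rewrite <- gexp_plus.
    + apply gexp_ext. intros t Ht.
      replace (- al) with (- (al + 1) + 1) by ring. rewrite (Rpower_succ (lam + t)) by lra. ring.
    + now apply cont_pos_scal.
    + apply cont_pos_mult; auto. apply cont_pos_pow, cont_pos_id.
Qed.

Lemma gexp_power_lim mu al lam : 0 < mu -> 0 < lam ->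
  is_lim_seq (fun k => gexp mu k (fun t => Rpower (lam + t) (- al)))
    (Gamma mu * tricomiU al (1 + al - mu) lam).
Proof.
  intros Hmu Hl. apply gexp_power_lim_shift; auto.
  destruct (Rle_lt_dec al 0) as [H|H].
  - clear Hmu. pose proof (archimed (- al)) as [A _]. unfold shift_to_pos.
    rewrite INR_IZR_INZ, Z2Nat.id; [lra|]. apply le_IZR. lra.
  - pose proof (pos_INR (shift_to_pos al)). lra.
Qed.

(** * The sector expansions *)

Lemma Im_polar r t : Im (polar r t) = r * sin t.
Proof. unfold polar. rewrite Im_RtoC_mult. simpl. rewrite exp_0. ring. Qed.

Lemma Re_div_Cmod z : z <> RtoC 0 -> -1 <= Re z / Cmod z <= 1.
Proof.
  intros Hz. apply Cmod_gt_0 in Hz. pose proof (re_le_Cmod z) as H. apply Rabs_le_between in H.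
  split; apply Rmult_le_reg_r with (Cmod z); auto; unfold Rdiv; rewrite Rmult_assoc, Rinv_l by lra; lra.
Qed.

Lemma polar_repr z : z <> RtoC 0 -> z = polar (Cmod z) (Carg z).
Proof.
  intros Hz. pose proof (Re_div_Cmod z Hz) as B. apply Cmod_gt_0 in Hz.
  assert (S : Cmod z * sin (acos (Re z / Cmod z)) = Rabs (Im z)).
  { rewrite sin_acos by auto. rewrite <- (sqrt_Rsqr (Cmod z)) at 1 by lra.
    rewrite <- sqrt_mult_alt by apply Rle_0_sqr. rewrite <- sqrt_Rsqr_abs. f_equal.
    pose proof (Cmod2_alt z) as E. unfold Rsqr. 
    replace (Cmod z * Cmod z * (1 - Re z / Cmod z * (Re z / Cmod z))) with (Cmod z ^ 2 - Re z ^ 2) by (field; lra).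
    rewrite E. ring. }
  assert (Cc : Cmod z * cos (acos (Re z / Cmod z)) = Re z) by (rewrite cos_acos by auto; field; lra).
  apply C_ext; rewrite ?Re_polar, ?Im_polar; unfold Carg; destruct (Rlt_dec (Im z) 0).
  - rewrite cos_neg. auto.
  - auto.
  - rewrite sin_neg. rewrite Ropp_mult_distr_r_reverse, S, Rabs_left by auto. ring.
  - rewrite S, Rabs_pos_eq; auto. lra.
Qed.

Lemma Carg_polar r t : 0 < r -> - PI < t < PI -> Carg (polar r t) = t.
Proof.
  intros Hr Ht. unfold Carg. rewrite Cmod_polar, Re_polar, Im_polar by lra.
  replace (r * cos t / r) with (cos t) by (field; lra).
  destruct (Rlt_dec (r * sin t) 0) as [H|H].
  - assert (t < 0).
    { apply Rnot_le_lt. intros H0.  pose proof (sin_ge_0 t H0 ltac:(lra)). nra. }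
    rewrite <- cos_neg, acos_cos by lra. ring.
  - assert (0 <= t).
    { apply Rnot_lt_le. intros H0. apply H. pose proof (sin_gt_0 (- t) ltac:(lra) ltac:(lra)) as G.
      rewrite sin_neg in G. nra. }
    rewrite acos_cos; lra.
Qed.

Lemma Cpower_polar r t p : 0 < r -> - PI < t < PI -> Cpower (polar r t) (RtoC p) = polar_pow r t p.
Proof.
  intros Hr Ht. unfold Cpower, Cln. rewrite Carg_polar, Cmod_polar by lra. unfold polar_pow, polar, Rpower.
  replace (RtoC p * (ln r, t))%C with (RtoC (p * ln r) + (0, (p * t)%R))%C by (apply C_ext; simpl; ring).
  now rewrite Cexp_plus, Cexp_RtoC.
Qed.

Lemma right_half_plane_polar z : 0 < Re z -> exists r t, 0 < r /\ Rabs t < PI / 2 /\ z = polar r t.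
Proof.
  intros Hz. assert (Z : z <> RtoC 0) by (intros ->; simpl in Hz; lra).
  pose proof (polar_repr z Z) as E. pose proof (proj1 (Cmod_gt_0 z) Z) as M.
  exists (Cmod z), (Carg z). split; [|split]; auto.
  pose proof (f_equal Re E) as ER. rewrite Re_polar in ER. 
  assert (Hc : 0 < cos (Carg z)).
  { apply Rnot_le_lt. intros H. rewrite ER in Hz. nra. }
  pose proof (acos_bound (Re z / Cmod z)) as B. clear ER. clear E.
  assert (B2 : Rabs (Carg z) = acos (Re z / Cmod z)).
  { unfold Carg. destruct (Rlt_dec (Im z) 0); [rewrite Rabs_Ropp|]; apply Rabs_pos_eq; lra. }
  assert (Hc2 : cos (Rabs (Carg z)) = cos (Carg z)).
  { unfold Rabs. destruct (Rcase_abs (Carg z)); [apply cos_neg | auto]. }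
  rewrite <- Hc2 in Hc. apply Rnot_le_lt. intros H.
  assert (cos (Rabs (Carg z)) <= 0) by (apply cos_le_0; lra). lra.
Qed.

Lemma polar_pow_mult r t s u p : 0 < r -> 0 < s ->
  polar_pow (r * s) (t + u) p = (polar_pow r t p * polar_pow s u p)%C.
Proof.
  intros Hr Hs. unfold polar_pow. rewrite polar_mult, Rpower_mult_distr by auto. f_equal. ring.
Qed.

Lemma polar_pow_plus r t p q : polar_pow r t (p + q) = (polar_pow r t p * polar_pow r t q)%C.
Proof. unfold polar_pow. rewrite polar_mult, <- Rpower_plus. f_equal. ring. Qed.

Lemma Cmod_polar_pow r t p : Cmod (polar_pow r t p) = Rpower r p.
Proof. unfold polar_pow. apply Cmod_polar, Rlt_le, Rpower_pos. Qed.

Lemma polar_neq_0 r t : 0 < r -> polar r t <> RtoC 0.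
Proof. intros H. apply Cmod_gt_0. rewrite Cmod_polar; lra. Qed.

Section Sector.
Variables (rho th : R).
Hypothesis Hrho : 0 < rho.
Hypothesis Hth : Rabs (-2 * th) < PI / 2.

Let a := polar rho th.

Definition zray (y : R) : C := polar (y / rho ^ 2) (-2 * th).

Lemma sector_angle : - (PI / 2) < 2 * th < PI / 2.
Proof. apply Rabs_def2 in Hth. lra. Qed.

Lemma polar_sq : (a ^ 2)%C = polar (rho ^ 2) (2 * th).
Proof. unfold a. simpl. rewrite Cmult_1_r, polar_mult. f_equal; ring. Qed.

Lemma sector_neq0 : a <> RtoC 0.
Proof. now apply polar_neq_0. Qed.

Lemma polar_sq_neq0 : (a ^ 2)%C <> RtoC 0.
Proof. rewrite polar_sq. apply polar_neq_0, pow_lt; auto. Qed.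

Lemma zray_eq y : zray y = (RtoC y / a ^ 2)%C.
Proof.
  unfold Cdiv. assert (E : (zray y * a ^ 2 = RtoC y)%C).
  { rewrite polar_sq. unfold zray. rewrite polar_mult.
    replace (-2 * th + 2 * th) with 0 by ring. rewrite polar_0. f_equal.
    assert (0 < rho ^ 2) by now apply pow_lt. field. lra. }
  rewrite <- E. field. exact sector_neq0.
Qed.

Lemma zray_pow y p : 0 < y ->
  polar_pow (y / rho ^ 2) (-2 * th) (- p) = (polar_pow rho th (2 * p) * RtoC (Rpower y (- p)))%C.
Proof.
  intros Hy. rewrite <- polar_pow_real. unfold polar_pow. rewrite polar_mult. f_equal; [|ring].
  assert (0 < rho ^ 2) by now apply pow_lt.
  unfold Rdiv. rewrite <- Rpower_mult_distr; auto; [|now apply Rinv_0_lt_compat].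
  rewrite Rmult_comm. f_equal.
  unfold Rpower. rewrite ln_Rinv by auto. f_equal.
  replace (ln (rho ^ 2)) with (2 * ln rho); [ring|].
  simpl. rewrite Rmult_1_r, ln_mult by auto. ring.
Qed.

Lemma zray_coef y k : theta_coef (zray y) k = (RtoC (y ^ k) * theta_coef (zray 1) k)%C.
Proof.
  unfold theta_coef. rewrite !zray_eq.
  replace (- (RtoC y / a ^ 2))%C with (RtoC y * (- (1 / a ^ 2)))%C by (field; exact sector_neq0).
  rewrite Cpow_mult_l, <- RtoC_pow. ring.
Qed.

Lemma zray_coef_1 k : theta_coef (zray 1) k = (RtoC ((-1) ^ k) / (RtoC (INR (fact k)) * a ^ (2 * k)))%C.
Proof.
  unfold theta_coef. rewrite zray_eq.
  replace (- (1 / a ^ 2))%C with (RtoC (-1) * / a ^ 2)%C by (change (RtoC (-1)) with (RtoC (Ropp 1)); rewrite RtoC_opp; field; exact sector_neq0).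
  rewrite Cpow_mult_l, <- RtoC_pow, Cpow_inv by apply polar_sq_neq0.
  rewrite Cpow_mult_r, RtoC_inv by apply INR_fact_neq_0. field. split.
  - apply Cpow_nz, polar_sq_neq0.
  - intros E. apply RtoC_inj in E. now apply INR_fact_neq_0 in E.
Qed.

Lemma zray_Re y : 0 < y -> Re (zray y) = y / rho ^ 2 * cos (2 * th).
Proof.
  intros. unfold zray. rewrite Re_polar. replace (-2 * th) with (- (2 * th)) by ring. now rewrite cos_neg.
Qed.

Lemma sector_cos_pos : 0 < cos (2 * th).
Proof. pose proof sector_angle. apply cos_gt_0; lra. Qed.

Lemma theta_remainder_zray ga N y : 0 < y ->
  theta_remainder ga N (y / rho ^ 2) (-2 * th) =
  (Theta ga (zray y) - (RtoC (/ 2 * Gamma ((ga + 1) / 2)) * polar_pow rho th (ga + 1)) * RtoC (Rpower y (- ((ga + 1) / 2)))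
   - Csum (fun k => (theta_coef (zray 1) k * zeta (RtoC (zarg ga k))) * RtoC (y ^ k)) N)%C.
Proof.
  intros Hy. unfold theta_remainder. fold (zray y). rewrite zray_pow by auto.
  replace (2 * ((ga + 1) / 2)) with (ga + 1) by field.
  rewrite (Csum_ext (fun k => theta_coef (zray y) k * zeta (RtoC (zarg ga k)))%C
    (fun k => (theta_coef (zray 1) k * zeta (RtoC (zarg ga k))) * RtoC (y ^ k))%C).
  - ring.
  - intros k _. rewrite zray_coef. ring.
Qed.

Definition S_term (mu ga lam : R) (n : nat) : C :=
  (RtoC (Rpower (INR (S n)) ga) * Cexp (- (RtoC (lam * INR (S n) ^ 2) / a ^ 2))
     / Cpower (RtoC (INR (S n) ^ 2) + a ^ 2) (RtoC mu))%C.

Lemma theta_term_zray ga lam t n :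
  theta_term ga (zray (lam + t)) n =
  (RtoC (Rpower (INR (S n)) ga) * Cexp (- (RtoC (lam * INR (S n) ^ 2) / a ^ 2)) *
     Cexp (- (RtoC t * (RtoC (INR (S n) ^ 2) / a ^ 2))))%C.
Proof.
  unfold theta_term. rewrite zray_eq, <- Cmult_assoc, <- Cexp_plus. do 2 f_equal.
  rewrite RtoC_plus, RtoC_mult. field. exact sector_neq0.
Qed.

Lemma theta_term_ccont ga lam n : ccont_pos (fun t => theta_term ga (zray (lam + t)) n).
Proof.
  pose (c := (RtoC (Rpower (INR (S n)) ga) * Cexp (- (RtoC (lam * INR (S n) ^ 2) / a ^ 2)))%C).
  pose (w := (RtoC (INR (S n) ^ 2) / a ^ 2)%C).
  apply ccont_pos_ext with (fun t => c * Cexp (- (RtoC t * w)))%C.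
  - intros t. now rewrite theta_term_zray.
  - apply ccont_pos_scal.
    apply ccont_pos_exp.
Qed.

Lemma cgexp_theta_term_lim mu ga lam n : 0 < mu ->
  Clim (fun k => cgexp mu k (fun t => theta_term ga (zray (lam + t)) n))
    (RtoC (Gamma mu) * polar_pow rho th (2 * mu) * S_term mu ga lam n)%C.
Proof.
  intros Hmu.
  pose (c := (RtoC (Rpower (INR (S n)) ga) * Cexp (- (RtoC (lam * INR (S n) ^ 2) / a ^ 2)))%C).
  pose (w := (RtoC (INR (S n) ^ 2) / a ^ 2)%C).
  assert (n2 : 0 < INR (S n) ^ 2) by (apply pow_lt; pose proof (xn_ge1 n); lra).
  assert (r2 : 0 < rho ^ 2) by now apply pow_lt.
  assert (Ew : w = zray (INR (S n) ^ 2)) by (symmetry; apply zray_eq).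
  assert (Rw : 0 < Re w).
  { rewrite Ew, zray_Re by auto. apply Rmult_lt_0_compat; [now apply Rdiv_lt_0_compat | apply sector_cos_pos]. }
  destruct (right_half_plane_polar (1 + w)) as [r [t0 [Hr [Ht0 E]]]].
  { rewrite Re_plus. simpl (Re 1). lra. }
  pose proof (cgexp_exp_lim mu w r t0 Hmu E Hr Ht0) as L. apply (Clim_scal c) in L.
  replace (RtoC (Gamma mu) * polar_pow rho th (2 * mu) * S_term mu ga lam n)%C with
    (c * (RtoC (Gamma mu) * polar_pow r t0 (- mu)))%C.
  - eapply Clim_ext; [|exact L]. intros k. cbv beta. rewrite <- cgexp_scal.
    + apply cgexp_ext. intros t _. now rewrite theta_term_zray.
    + apply ccont_pos_exp.
  - unfold S_term. fold c.
    assert (E2 : (RtoC (INR (S n) ^ 2) + a ^ 2)%C = polar (rho ^ 2 * r) (2 * th + t0)).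
    { rewrite <- polar_mult, <- polar_sq, <- E. unfold w. field. exact sector_neq0. }
    pose proof sector_angle as SA. apply Rabs_def2 in Ht0.
    rewrite E2, Cpower_polar; [|now apply Rmult_lt_0_compat | lra].
    rewrite polar_pow_mult by auto.
    replace (polar_pow (rho ^ 2) (2 * th) mu) with (polar_pow rho th (2 * mu)).
    + pose proof (polar_pow_opp r t0 mu) as Q.
      pose proof (polar_pow_neq0 r t0 mu) as N1. pose proof (polar_pow_neq0 rho th (2 * mu)) as N2.
      replace (polar_pow r t0 (- mu)) with (/ polar_pow r t0 mu)%C.
      * field. auto.
      * rewrite <- (Cmult_1_r (/ polar_pow r t0 mu)), <- Q. field. auto.
    + unfold polar_pow. f_equal; [|ring].
      rewrite <- (Rpower_pow 2) by auto. rewrite Rpower_mult. f_equal. 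
Qed.

Lemma cgexp_Theta mu ga lam : 0 < mu -> 0 < lam ->
  ccont_pos (fun t => Theta ga (zray (lam + t))) /\
  Clim (fun k => cgexp mu k (fun t => Theta ga (zray (lam + t))))
    (RtoC (Gamma mu) * polar_pow rho th (2 * mu) * CSeries (S_term mu ga lam))%C.
Proof.
  intros Hmu Hl. pose proof sector_cos_pos as Hc.
  assert (r2 : 0 < rho ^ 2) by now apply pow_lt.
  pose (c := lam / rho ^ 2 * cos (2 * th)).
  assert (c0 : 0 < c) by (apply Rmult_lt_0_compat; auto; now apply Rdiv_lt_0_compat).
  destruct (exp_decay_summable ga c c0) as [K [L [K0 [HL HK]]]].
  pose (A := fun n => K * Rpower (INR (S n)) (- (2))).
  assert (Rz : forall t, 0 < t -> c <= Re (zray (lam + t))).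
  { intros t Ht. rewrite zray_Re by lra. apply Rmult_le_compat_r; [lra|].
    apply Rmult_le_compat_r; [apply Rlt_le, Rinv_0_lt_compat; auto | lra]. }
  assert (TB : forall n t, 0 < t -> Cmod (theta_term ga (zray (lam + t)) n) <= A n).
  { intros n t Ht. rewrite Cmod_theta_term. apply HK. auto. }
  pose (tau := fun M => L - Rsum A M).
  assert (Tau : is_lim_seq tau 0).
  { replace (Finite 0) with (Finite (L - L)) by (f_equal; ring).
    apply is_lim_seq_minus'; [apply is_lim_seq_const | exact HL]. }
  assert (Tail : forall M t, 0 < t ->
    Cmod (Theta ga (zray (lam + t)) - Csum (theta_term ga (zray (lam + t))) M)%C <= tau M).
  { intros M t Ht.
    destruct (Cser_abs (theta_term ga (zray (lam + t))) A L) as [s [Hs [_ T]]]; auto.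
    specialize (Rz t Ht).
    rewrite (Cser_unique _ _ _ (Theta_spec ga (zray (lam + t)) ltac:(lra)) Hs). apply T. }
  assert (Cont : ccont_pos (fun t => Theta ga (zray (lam + t)))).
  { apply (ccont_pos_uniform _ (fun M t => Csum (theta_term ga (zray (lam + t))) M) tau); auto.
    intros M. apply (ccont_pos_Csum (fun n t => theta_term ga (zray (lam + t)) n)).
    intros; apply theta_term_ccont. }
  split; auto.
  pose proof (Gamma_pos mu Hmu) as Gm.
  assert (bound1 : forall k x, 0 <= x -> gexp mu k (fun _ => x) <= Gamma mu * x).
  { intros k x Hx. rewrite (gexp_ext mu k (fun _ => x) (fun _ => x * 1)) by (intros; ring).
    rewrite gexp_scal by apply cont_pos_const. rewrite Rmult_comm. apply Rmult_le_compat_r; auto. now apply gexp_one_le. }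
  assert (A0 : forall n, 0 <= A n) by (intros; apply Rmult_le_pos; [lra | apply Rlt_le, Rpower_pos]).
  pose (u := fun n k => cgexp mu k (fun t => theta_term ga (zray (lam + t)) n)).
  pose (v := fun n => (RtoC (Gamma mu) * polar_pow rho th (2 * mu) * S_term mu ga lam n)%C).
  assert (Hu : forall n k, Cmod (u n k) <= 2 * Gamma mu * A n).
  { intros n k. eapply Rle_trans; [apply (cgexp_bound mu k _ (fun _ => A n)); [apply theta_term_ccont | apply cont_pos_const | intros; auto]|].
    specialize (bound1 k (A n) (A0 n)). lra. }
  assert (Hv : forall n, Clim (u n) (v n)) by (intros n; now apply cgexp_theta_term_lim).
  assert (SA : Rser (fun n => 2 * Gamma mu * A n) (2 * Gamma mu * L)) by now apply Rser_scal.
  destruct (Cser_abs v (fun n => 2 * Gamma mu * A n) (2 * Gamma mu * L)) with (2 := SA) as [s [Hs _]].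
  { intros n. apply (Clim_Cmod_le (u n)); auto. }
  assert (ES : s = (RtoC (Gamma mu) * polar_pow rho th (2 * mu) * CSeries (S_term mu ga lam))%C).
  { assert (q0 : (RtoC (Gamma mu) * polar_pow rho th (2 * mu))%C <> RtoC 0).
    { apply Cmult_neq_0; [|apply polar_pow_neq0]. intros E. apply RtoC_inj in E. lra. }
    rewrite (CSeries_unique (S_term mu ga lam) (/ (RtoC (Gamma mu) * polar_pow rho th (2 * mu)) * s)%C).
    - field. split; [apply polar_pow_neq0 | intros E; apply RtoC_inj in E; lra].
    - eapply Cser_ext; [|apply (Cser_scal (/ (RtoC (Gamma mu) * polar_pow rho th (2 * mu)))%C), Hs].
      intros n. unfold v. field. split; [apply polar_pow_neq0 | intros E; apply RtoC_inj in E; lra]. }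
  rewrite <- ES.
  apply (tannery u v (fun n => 2 * Gamma mu * A n) (2 * Gamma mu * L)); auto.
  intros k. apply Clim_squeeze with (fun M => 2 * Gamma mu * tau M); [|now apply lim0_mult_const].
  intros M. rewrite Cmod_minus_sym. unfold u.
  rewrite <- (cgexp_Csum mu k (fun n t => theta_term ga (zray (lam + t)) n)) by (intros; apply theta_term_ccont).
  rewrite <- cgexp_minus; auto.
  - assert (t0 : 0 <= tau M) by (eapply Rle_trans; [apply Cmod_ge_0 | apply (Tail M 1); lra]).
    eapply Rle_trans; [apply (cgexp_bound mu k _ (fun _ => tau M))|].
    + apply ccont_pos_minus; auto. apply (ccont_pos_Csum (fun n t => theta_term ga (zray (lam + t)) n)).
      intros; apply theta_term_ccont.
    + apply cont_pos_const.
    + intros t Ht. apply Tail; auto.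
    + specialize (bound1 k (tau M) t0). lra.
  - apply (ccont_pos_Csum (fun n t => theta_term ga (zray (lam + t)) n)). intros; apply theta_term_ccont.
Qed.

Lemma sector_remainder_mu mu ga lam N K p : 0 < mu -> 0 < lam -> 1 <= rho -> 0 <= K ->
  (forall y, 0 < y -> Cmod (theta_remainder ga N (y / rho ^ 2) (-2 * th)) <= K * ((y / rho ^ 2) ^ N * (1 + y / rho ^ 2) ^ p)) ->
  Cmod (CSeries (S_term mu ga lam)
     - polar_pow rho th (ga + 1 - 2 * mu) * RtoC (H1 mu ga lam)
     - Csum (fun k => polar_pow rho th (- 2 * mu) * (RtoC ((-1) ^ k * poch mu k) / (RtoC (INR (fact k)) * a ^ (2 * k))
          * zeta (RtoC (- 2 * INR k - ga)) * RtoC (hyp1F1_neg k (1 - mu - INR k) lam))) N)%C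
  <= 2 * K * gmoment mu (1 + lam) (N + p) * Rpower rho (- 2 * mu - 2 * INR N).
Proof.
  intros Hmu Hl Hr1 HK B.
  assert (r2 : 1 <= rho ^ 2) by (rewrite <- (pow1 2); apply pow_incr; lra).
  pose proof (Gamma_pos mu Hmu) as Gm.
  destruct (cgexp_Theta mu ga lam Hmu Hl) as [CT LT].
  pose (al := (ga + 1) / 2).
  pose (c1 := (RtoC (/ 2 * Gamma al) * polar_pow rho th (ga + 1))%C).
  pose (c2 := fun k => (theta_coef (zray 1) k * zeta (RtoC (zarg ga k)))%C).
  pose (f := fun t => theta_remainder ga N ((lam + t) / rho ^ 2) (-2 * th)).
  pose (F2 := fun t => (c1 * RtoC (Rpower (lam + t) (- al)))%C).
  pose (F3 := fun t => Csum (fun k => c2 k * RtoC ((lam + t) ^ k))%C N).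
  assert (Ef : forall t, 0 < t -> f t = (Theta ga (zray (lam + t)) - F2 t - F3 t)%C).
  { intros t Ht. unfold f. rewrite theta_remainder_zray by lra. reflexivity. }
  assert (C2r : cont_pos (fun t => Rpower (lam + t) (- al))) by (apply cont_pos_Rpower_shift; lra).
  assert (C2 : ccont_pos F2) by (apply ccont_pos_scal, ccont_pos_RtoC; auto).
  assert (Cl : forall x k, cont_pos (fun t => (x + t) ^ k)).
  { intros x k. apply cont_pos_pow, (cont_pos_plus (fun _ => x)); [apply cont_pos_const | apply cont_pos_id]. }
  assert (C3k : forall k, ccont_pos (fun t => c2 k * RtoC ((lam + t) ^ k))%C).
  { intros k. apply ccont_pos_scal, ccont_pos_RtoC. auto. }
  assert (C3 : ccont_pos F3) by (apply (ccont_pos_Csum (fun k t => c2 k * RtoC ((lam + t) ^ k))%C); auto).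
  assert (Cr : ccont_pos (fun t => Theta ga (zray (lam + t)) - F2 t - F3 t)%C).
  { apply ccont_pos_minus; auto. now apply ccont_pos_minus. }
  pose (lim := (RtoC (Gamma mu) * polar_pow rho th (2 * mu) * CSeries (S_term mu ga lam)
     - c1 * RtoC (Gamma mu * tricomiU al (1 + al - mu) lam)
     - Csum (fun k => c2 k * RtoC (Gamma mu * gmoment mu lam k)) N)%C).
  assert (Lf : Clim (fun k => cgexp mu k (fun t => Theta ga (zray (lam + t)) - F2 t - F3 t)%C) lim).
  { apply Clim_ext with (fun k => cgexp mu k (fun t => Theta ga (zray (lam + t))) -
      c1 * RtoC (gexp mu k (fun t => Rpower (lam + t) (- al))) -
      Csum (fun j => c2 j * RtoC (gexp mu k (fun t => ((lam + t) ^ j)%R))) N)%C.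
    - intros k. rewrite !cgexp_minus; auto; [|now apply ccont_pos_minus].
      f_equal; [f_equal|].
      + f_equal. unfold F2. rewrite cgexp_scal by now apply ccont_pos_RtoC. now rewrite cgexp_RtoC.
      + f_equal. unfold F3. rewrite (cgexp_Csum mu k (fun j t => c2 j * RtoC ((lam + t) ^ j))%C) by auto.
        apply Csum_ext. intros j _. rewrite cgexp_scal by (apply ccont_pos_RtoC; auto). now rewrite cgexp_RtoC.
    - apply Clim_minus; [apply Clim_minus; auto|].
      + apply Clim_scal, Clim_RtoC, gexp_power_lim; auto.
      + clear - Hmu. induction N as [|n IH]; [exact (Clim_const 0)|]. cbn [Csum].
        apply Clim_plus; auto. apply Clim_scal, Clim_RtoC, gexp_binom_lim; auto. }
  pose (q := K * Rpower rho (- 2 * INR N)).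
  assert (q0 : 0 <= q) by (apply Rmult_le_pos; auto; apply Rlt_le, Rpower_pos).
  assert (Bf : forall t, 0 < t -> Cmod (Theta ga (zray (lam + t)) - F2 t - F3 t)%C <= q * (1 + lam + t) ^ (N + p)).
  { intros t Ht. rewrite <- Ef by auto.
    assert (Hy : 0 < lam + t) by lra. eapply Rle_trans; [exact (B (lam + t) Hy)|]. unfold q. rewrite Rmult_assoc.
    apply Rmult_le_compat_l; auto.
    assert (E : ((lam + t) / rho ^ 2) ^ N = Rpower rho (- 2 * INR N) * (lam + t) ^ N).
    { unfold Rdiv. rewrite Rpow_mult_distr, pow_inv, Rpower_sq_pow by auto.
      replace (- 2 * INR N) with (- (2 * INR N)) by ring. rewrite Rpower_Ropp. ring. }
    rewrite E, Rmult_assoc. apply Rmult_le_compat_l; [apply Rlt_le, Rpower_pos|].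
    rewrite pow_add. 
    assert (D : (lam + t) / rho ^ 2 <= lam + t).
    { apply Rmult_le_reg_r with (rho ^ 2); [lra|]. unfold Rdiv. rewrite Rmult_assoc, Rinv_l by lra. nra. }
    assert (D0 : 0 <= (lam + t) / rho ^ 2) by (apply Rdiv_le_0_compat; lra).
    apply Rmult_le_compat.
    - apply pow_le; lra.
    - apply pow_le; lra.
    - apply pow_incr; lra.
    - apply pow_incr; lra. }
  assert (Bl : Cmod lim <= 2 * (q * (Gamma mu * gmoment mu (1 + lam) (N + p)))).
  { apply (Clim_Cmod_le _ _ _ Lf). intros k.
    eapply Rle_trans; [apply (cgexp_bound mu k _ (fun t => q * (1 + lam + t) ^ (N + p))); auto|].
    - apply cont_pos_scal; auto.
    - rewrite gexp_scal by auto. apply Rmult_le_compat_l; [lra|]. apply Rmult_le_compat_l; auto.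
      apply (is_lim_seq_incr_compare _ _ (gexp_binom_lim mu (1 + lam) (N + p) Hmu)).
      intros n. apply gexp_mono_k; auto. intros t Ht. apply pow_le; lra. }
  assert (Gn : RtoC (Gamma mu) <> RtoC 0) by (intros E; apply RtoC_inj in E; lra).
  pose proof (polar_pow_neq0 rho th (2 * mu)) as Pn.
  assert (Pi : polar_pow rho th (- 2 * mu) = (/ polar_pow rho th (2 * mu))%C).
  { pose proof (polar_pow_opp rho th (2 * mu)) as Q. replace (- 2 * mu) with (- (2 * mu)) by ring.
    rewrite <- (Cmult_1_r (/ polar_pow rho th (2 * mu))), <- Q. field. auto. }
  match goal with |- Cmod ?X <= _ => assert (EX : X = (/ (RtoC (Gamma mu) * polar_pow rho th (2 * mu)) * lim)%C) end.
  { unfold lim.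
    replace (ga + 1 - 2 * mu) with ((ga + 1) + (- 2 * mu)) by ring. rewrite polar_pow_plus, Pi.
    rewrite (Csum_ext (fun k => / polar_pow rho th (2 * mu) * _)%C
      (fun k => / (RtoC (Gamma mu) * polar_pow rho th (2 * mu)) * (c2 k * RtoC (Gamma mu * gmoment mu lam k)))%C).
    - rewrite Csum_scal. unfold H1. rewrite (Rplus_comm 1 ga). fold al. unfold c1.
      rewrite !RtoC_mult. field. auto.
    - intros k _. unfold c2. rewrite gmoment_hyp, zray_coef_1 by auto. fold (zarg ga k).
      rewrite !RtoC_mult. field. repeat split; auto.
      + unfold a. apply Cpow_nz, polar_neq_0; auto.
      + intros E. apply RtoC_inj in E. now apply INR_fact_neq_0 in E. }
  rewrite EX, Cmod_mult, Cmod_inv by (now apply Cmult_neq_0).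
  rewrite Cmod_mult, Cmod_polar_pow, Cmod_R, Rabs_pos_eq by lra.
  pose proof (Rpower_pos rho (2 * mu)) as P.
  apply Rle_trans with (/ (Gamma mu * Rpower rho (2 * mu)) * (2 * (q * (Gamma mu * gmoment mu (1 + lam) (N + p))))).
  - apply Rmult_le_compat_l; auto. apply Rlt_le, Rinv_0_lt_compat. now apply Rmult_lt_0_compat.
  - unfold q. replace (- 2 * mu - 2 * INR N) with (- (2 * mu) + - 2 * INR N) by ring.
    rewrite Rpower_plus, Rpower_Ropp. apply Req_le. field. lra.
Qed.

End Sector.

Lemma sector_uniform eps : 0 < eps -> exists c, 0 < c /\ forall th, Rabs th <= PI / 4 - eps ->
  Rabs (-2 * th) < PI / 2 /\ c <= cos (-2 * th).
Proof.
  intros He. pose proof PI_RGT_0 as HP.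
  pose (e := Rmin eps (PI / 8)). assert (e0 : 0 < e) by (apply Rmin_glb_lt; lra).
  assert (e1 : e <= eps) by apply Rmin_l. assert (e2 : e <= PI / 8) by apply Rmin_r.
  exists (cos (PI / 2 - 2 * e)). split; [apply cos_gt_0; lra|]. intros th Hth.
  assert (E : Rabs (-2 * th) = 2 * Rabs th).
  { rewrite Rabs_mult. replace (Rabs (-2)) with 2; auto. rewrite Rabs_left; lra. }
  split; [lra|].
  assert (Ec : cos (-2 * th) = cos (Rabs (-2 * th))).
  { unfold Rabs. destruct (Rcase_abs (-2 * th)); auto. now rewrite cos_neg. }
  rewrite Ec. pose proof (Rabs_pos (-2 * th)). apply cos_decr_1; lra.
Qed.

Lemma cut_angle th eps : 0 < eps -> Rabs th <= PI / 4 - eps -> - PI < th < PI.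
Proof. intros He H. pose proof PI_RGT_0. apply Rabs_le_between in H. lra. Qed.

Lemma sector_expansion_pos lambda gamma mu : 0 < lambda ->
  (forall m : nat, gamma <> - (2 * INR m + 1)) -> 0 < mu ->
  sector_expansion mu
    (fun a => S_sum mu gamma a lambda
              - Cpower a (RtoC (1 - (2 * mu - gamma))) * RtoC (H1 mu gamma lambda))%C
    (fun k a =>
       Cpower a (RtoC (- 2 * mu))
       * (RtoC ((-1) ^ k * poch mu k) / (RtoC (INR (fact k)) * a ^ (2 * k))
          * zeta (RtoC (- 2 * INR k - gamma))
          * RtoC (hyp1F1_neg k (1 - mu - INR k) lambda)))%C.
Proof.
  intros Hl Hga Hmu N eps He.
  destruct (sector_uniform eps He) as [c [Hc Hs]].
  destruct (theta_expansion gamma Hga N c Hc) as [K [p [HK HB]]].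
  exists (2 * K * gmoment mu (1 + lambda) (N + p)), 1. split; [lra|].
  intros a Ha Harg. destruct (Hs _ Harg) as [H1' H2'].
  assert (a0 : a <> RtoC 0) by (apply Cmod_gt_0; lra).
  pose proof (polar_repr a a0) as E.
  pose proof (cut_angle _ _ He Harg) as Hcut.
  pose proof (sector_remainder_mu (Cmod a) (Carg a) ltac:(lra) H1' mu gamma lambda N K p Hmu Hl Ha HK) as R.
  unfold S_term in R. rewrite <- E in R.
  rewrite <- !(Cpower_polar (Cmod a) (Carg a)) in R by (lra || auto). rewrite <- E in R.
  replace (1 - (2 * mu - gamma)) with (gamma + 1 - 2 * mu) by ring.
  apply R. intros y Hy. apply HB; auto. apply Rdiv_lt_0_compat; auto. apply pow_lt; lra.
Qed.

Lemma sector_expansion_zero lambda gamma : 0 < lambda ->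
  (forall m : nat, gamma <> - (2 * INR m + 1)) ->
  sector_expansion 0
    (fun a => S_sum 0 gamma a lambda
              - RtoC (/ 2) * Cpower (a ^ 2 / RtoC lambda) (RtoC ((gamma + 1) / 2))
                * RtoC (Gamma ((gamma + 1) / 2)))%C
    (fun k a =>
       RtoC ((- lambda) ^ k) / (RtoC (INR (fact k)) * a ^ (2 * k))
       * zeta (RtoC (- 2 * INR k - gamma)))%C.
Proof.
  intros Hl Hga N eps He.
  destruct (sector_uniform eps He) as [c [Hc Hs]].
  destruct (theta_expansion gamma Hga N c Hc) as [K [p [HK HB]]].
  exists (K * (lambda ^ N * (1 + lambda) ^ p)), 1. split; [lra|].
  intros a Ha Harg. destruct (Hs _ Harg) as [H1' H2'].
  assert (a0 : a <> RtoC 0) by (apply Cmod_gt_0; lra).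
  pose proof (polar_repr a a0) as E.
  pose proof (cut_angle _ _ He Harg) as Hcut.
  set (rho := Cmod a) in *. set (th := Carg a) in *.
  assert (r0 : 0 < rho) by lra.
  assert (r2 : 1 <= rho ^ 2) by (rewrite <- (pow1 2); apply pow_incr; lra).
  assert (lr : 0 < lambda / rho ^ 2) by (apply Rdiv_lt_0_compat; lra).
  specialize (HB (lambda / rho ^ 2) (-2 * th) lr H1' H2').
  rewrite (theta_remainder_zray rho th r0) in HB by auto.
  match goal with |- Cmod ?X <= _ => match type of HB with Cmod ?Y <= _ => replace X with Y end end.
  - eapply Rle_trans; [exact HB|]. rewrite !Rmult_assoc. apply Rmult_le_compat_l; auto.
    replace (- 2 * 0 - 2 * INR N) with (- (2 * INR N)) by ring.
    unfold Rdiv at 1. rewrite Rpow_mult_distr, pow_inv, Rpower_sq_pow, <- Rpower_Ropp by auto.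
    rewrite Rmult_assoc. apply Rmult_le_compat_l; [apply pow_le; lra|].
    rewrite Rmult_comm. apply Rmult_le_compat_r; [apply Rlt_le, Rpower_pos|].
    apply pow_incr. split; [lra|].
    assert (lambda / rho ^ 2 <= lambda); [|lra].
    apply Rmult_le_reg_r with (rho ^ 2); [lra|]. unfold Rdiv. rewrite Rmult_assoc, Rinv_l by lra. nra.
  - f_equal; [f_equal|].
    + unfold Theta, S_sum. f_equal.
      apply FunctionalExtensionality.functional_extensionality. intros n.
      pose proof (theta_term_zray rho th r0 gamma lambda 0 n) as T.
      rewrite Rplus_0_r in T. rewrite T. rewrite <- E.
      replace (- (0 * (RtoC (INR (S n) ^ 2) / a ^ 2)))%C with (RtoC 0) by ring.
      unfold Cpower. rewrite Cmult_0_l, !Cexp_0.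
      unfold Cdiv. rewrite <- RtoC_inv, Rinv_1 by lra. reflexivity.
    + assert (E2 : (a ^ 2 / RtoC lambda)%C = polar (rho ^ 2 / lambda) (2 * th)).
      { unfold Cdiv. rewrite E, (polar_sq rho th), <- RtoC_inv, Cmult_comm, polar_scal by lra. f_equal.
        unfold Rdiv; ring. }
      pose proof (sector_angle th H1') as SA. pose proof PI_RGT_0.
      rewrite E2, Cpower_polar; [|apply Rdiv_lt_0_compat; lra | lra].
      rewrite RtoC_mult.
      replace (polar_pow (rho ^ 2 / lambda) (2 * th) ((gamma + 1) / 2)) with
        (polar_pow rho th (gamma + 1) * RtoC (Rpower lambda (- ((gamma + 1) / 2))))%C; [ring|].
      rewrite <- polar_pow_real. unfold polar_pow. rewrite polar_mult. f_equal; [|field].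
      unfold Rdiv at 2. rewrite <- Rpower_mult_distr; [|lra | apply Rinv_0_lt_compat; lra].
      unfold Rpower. rewrite ln_Rinv by lra. rewrite <- !exp_plus. f_equal.
      replace (ln (rho ^ 2)) with (2 * ln rho) by (simpl; rewrite Rmult_1_r, ln_mult by auto; ring). field.
    + apply Csum_ext. intros k _. rewrite zray_coef_1 by auto. rewrite <- E.
      unfold zarg. replace ((- lambda) ^ k) with ((-1) ^ k * lambda ^ k) by (rewrite <- Rpow_mult_distr; f_equal; ring).
      rewrite RtoC_mult. unfold Cdiv. ring.
Qed.

Theorem mainTheorem1 :
  forall lambda gamma : R,
    0 < lambda ->
    (forall m : nat, gamma <> - (2 * INR m + 1)) ->
    (forall mu : R, 0 < mu ->
       let delta := 2 * mu - gamma in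
       sector_expansion mu
         (fun a => S_sum mu gamma a lambda
                   - Cpower a (RtoC (1 - delta)) * RtoC (H1 mu gamma lambda))%C
         (fun k a =>
            Cpower a (RtoC (- 2 * mu))
            * (RtoC ((-1) ^ k * poch mu k) / (RtoC (INR (fact k)) * a ^ (2 * k))
               * zeta (RtoC (- 2 * INR k - gamma))
               * RtoC (hyp1F1_neg k (1 - mu - INR k) lambda)))%C)
    /\
    sector_expansion 0
      (fun a => S_sum 0 gamma a lambda
                - RtoC (/ 2) * Cpower (a ^ 2 / RtoC lambda) (RtoC ((gamma + 1) / 2))
                  * RtoC (Gamma ((gamma + 1) / 2)))%C
      (fun k a =>
         RtoC ((- lambda) ^ k) / (RtoC (INR (fact k)) * a ^ (2 * k))
         * zeta (RtoC (- 2 * INR k - gamma)))%C.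
Proof.
  intros lambda gamma Hl Hga. split.
  - intros mu Hmu delta. now apply sector_expansion_pos.
  - now apply sector_expansion_zero.
Qed.
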